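(* Let $X(t)$, $t\ge0$, be a Markov process on $M$ satisfying the continuous time strong Doeblin condition with invariant measure $\mu$, let $\ell\ge 1$, and let $q_1,\dots,q_\ell$ be as in the context (with $q_1(t)=\alpha_1 t$, $\alpha_1>0$, i.e. $k=1$). Let $W_\lambda(x_1,\dots,x_\ell)$, $\lambda\in(-\infty,\infty)$, be a family of bounded measurable functions on $M^\ell$, differentiable in $\lambda$ and such that $dW_\lambda(x_1,\dots,x_\ell)/d\lambda$ is also bounded for each $\lambda$. Then for any $x\in M$ the limit $$Q_{\mathrm{cont}}(W_\lambda)=\lim_{T\to\infty}\frac1T\ln E_x\exp\Big(\int_0^T W_\lambda\big(X(q_1(t)),\dots,X(q_\ell(t))\big)\,dt\Big)$$ exists, it is independent of $x$, and it is differentiable in $\lambda$. In fact, $Q_{\mathrm{cont}}(W_\lambda)=\ln r_{\mathrm{cont}}(W_\lambda)$, where for a bounded measurable function $W$ on $M^\ell$, $r_{\mathrm{cont}}(W)$ is the spectral radius of the semigroup of positive operators $$R^t_{\mathrm{cont}}(W)g(x)=E_x\big(g(X(\alpha_1 t))\,\hat W_{\mathrm{cont}}(t)\big),$$ $$\hat W_{\mathrm{cont}}(t)=\exp\Big(\int_0^t ds\int W(X(\alpha_1 s),x_2,\dots,x_\ell)\,d\mu(x_2)\cdots d\mu(x_\ell)\Big).$$ Furthermore, let $F$ be a bounded measurable function on $M^\ell$, set $W_\lambda=\lambda F$, $S_T=\int_0^T F\big(X(q_1(t)),\dots,X(q_\ell(t))\big)\,dt$ and $$J(u)=\sup_{\lambda\in\mathbb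 R}\big(\lambda u-\ln r_{\mathrm{cont}}(\lambda F)\big),\quad u\in\mathbb R.$$ Then for any closed set $K\subset\mathbb R$, $$\limsup_{T\to\infty}\frac1T\ln P\Big\{\frac1T S_T\in K\Big\}\le-\inf_{u\in K}J(u),$$ and for any open set $U\subset\mathbb R$, $$\liminf_{T\to\infty}\frac1T\ln P\Big\{\frac1T S_T\in U\Big\}\ge-\inf_{u\in U}J(u).$$
   Context: $X(t)$, $t\ge 0$, is a (time-homogeneous) Markov process on a probability space $(\Omega,\mathcal F,P)$ with values in a Polish space $M$ with its Borel $\sigma$-algebra; $P(t,x,\cdot)$ is its time $t$ transition probability. $P_x$ is the probability conditioned on $X(0)=x$, and $E_x$ the corresponding expectation. Strong Doeblin condition: there are $t_0>0$, a constant $C>0$ and a probability measure $\nu$ on $M$ with $C^{-1}\nu(G)\le P(t_0,x,G)\le C\nu(G)$ for every $x\in M$ and every measurable $G\subset M$. This implies that there is a unique invariant probability measure $\mu$ of the process. The functions $q_1,\dots,q_\ell$ are positive increasing functions on $\mathbb R_+$ such that $q_1(t)=\alpha_1t$ for some $\alpha_1>0$ and, for each $j=2,\dots,\ell$ and any $\gamma>0$, $$\lim_{t\to\infty}\big(q_j(t+\gamma)-q_j(t)\big)=\infty\quad\text{and}\quad\liminf_{t\to\infty}\big(q_j(\gamma t)-q_{j-1}(t)\big)>0 .$$ The operators $R^t_{\mathrm{cont}}(W)$ act on bounded measurable functions on $M$ (with the supremum norm), and the spectral radius of the semigroup means the number $r_{\mathrm{cont}}(W)>0$ with $\ln r_{\mathrm{cont}}(W)=\lim_{t\to\infty}\frac1t\ln\|R^t_{\mathrm{cont}}(W)\|$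 (i.e. the spectral radius of $R^1_{\mathrm{cont}}(W)$).
   Formalization: Besides differentiability in λ with dW_λ/dλ bounded for each λ, the difference quotients of W_λ at each λ are assumed bounded uniformly in (x_1,…,x_ℓ) for small increments; with the pointwise hypotheses alone, differentiability of Q_cont(W_λ) can fail. *)

(* Defs.v *)
From HB Require Import structures.
From mathcomp Require Import all_boot all_order all_algebra.
From mathcomp Require Import all_classical all_reals all_analysis.

Set Implicit Arguments.
Unset Strict Implicit.
Unset Printing Implicit Defensive.
Import Order.TTheory GRing.Theory Num.Theory.
Import numFieldNormedType.Exports.

Local Open Scope classical_set_scope.
Local Open Scope ring_scope.

Notation borel M := (g_sigma_algebraType (@open M)).

(* Completeness and the metric are carried by the type; what remains of
   "Polish" is that the pseudometric separates points and that the space is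
   separable. *)
Definition polish (R : realType) (M : completePseudoMetricType R) : Prop :=
  hausdorff_space M /\ exists2 D : set M, countable D & dense D.

(* Times are arbitrary reals, but a process X : R -> Omega -> E and its
   transition probabilities are only constrained at nonnegative times. *)
Section markov.
Context (R : realType) (dO dE : measure_display).
Context (Omega : measurableType dO) (E : measurableType dE).
Implicit Types (X : R -> Omega -> E) (p : R -> R.-pker E ~> E).

Definition natural_filtration X (s : R) : set (set Omega) :=
  <<s [set A | exists u B,
         [/\ 0 <= u, u <= s, measurable B & A = X u @^-1` B]] >>.

Definition markov_property X p (Q : {measure set Omega -> \bar R}) : Prop :=
  forall (s t : R) (A : set Omega) (B : set E), 0 <= s -> 0 <= t ->
    natural_filtration X s A -> measurable B ->
    Q (A `&` X (s + t) @^-1` B) = (\int[Q]_(w in A) p t (X s w) B)%E.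

(* Joint measurability in (t, w) is what makes the time integrals of
   functionals of X random variables. The law [Px x] is the probability
   conditioned on X(0) = x: the family [Px] is a regular conditional probability
   of [P] given X(0), and it is defined for every x, also outside the support of
   the law of X(0) under [P]. *)
Record markov_process X p (P : probability Omega R) (Px : R.-pker E ~> Omega)
    : Prop := {
  process_measurable :
    measurable_fun ([set t : R | 0 <= t] `*` [set: Omega])
      (fun z : R * Omega => X z.1 z.2);
  process_markov : markov_property X p P;
  process_start : forall (x : E) (B : set E), measurable B ->
    Px x (X 0 @^-1` B) = \d_x B;
  process_markov_from : forall x : E, markov_property X p (Px x);
  process_conditioned : forall (A : set Omega) (B : set E),
    measurable A -> measurable B ->
    P (A `&` X 0 @^-1` B) = (\int[P]_(w in X 0%R @^-1` B) Px (X 0%R w) A)%E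
}.

Definition strong_doeblin p : Prop :=
  exists (t0 C : R) (nu : probability E R), [/\ 0 < t0, 0 < C &
    forall (x : E) (G : set E), measurable G ->
      ((C^-1)%:E * nu G <= p t0 x G)%E /\ (p t0 x G <= C%:E * nu G)%E].

Definition invariant_measure p (mu : probability E R) : Prop :=
  forall (t : R) (G : set E), 0 <= t -> measurable G ->
    (\int[mu]_x p t x G)%E = mu G.

End markov.

(* The function q_j is [q i] where [i : 'I_l.+1] has value j - 1. *)
Record time_scales (R : realType) (l : nat) (alpha1 : R)
    (q : 'I_l.+1 -> R -> R) : Prop := {
  scales_ge0 : forall i t, 0 <= t -> 0 <= q i t;
  scales_increasing : forall i s t, 0 <= s -> s <= t -> q i s <= q i t;
  scales_alpha1 : 0 < alpha1;
  scales_first : forall t, 0 <= t -> q ord0 t = alpha1 * t;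
  scales_gap : forall (j : 'I_l) (gamma : R), 0 < gamma ->
    (q (lift ord0 j) (t + gamma) - q (lift ord0 j) t) @[t --> +oo] --> +oo;
  scales_order : forall (j : 'I_l) (gamma : R), 0 < gamma ->
    (0 < limf_einf (fun t : R =>
           (q (lift ord0 j) (gamma * t)
            - q (widen_ord (leqnSn l) j) t)%:E) +oo%R)%E
}.

Section bounded_functions.
Context (R : realType) (d : measure_display) (T : measurableType d).

Definition bounded_measurable (f : T -> R) : Prop :=
  measurable_fun [set: T] f /\ bounded_fun f.

Definition sup_norm (f : T -> R) : R := sup (range (fun x => `|f x|)).

Definition operator_norm (A : (T -> R) -> T -> R) : R :=
  sup [set sup_norm (A g) | g in
         [set g | bounded_measurable g /\ sup_norm g <= 1]].

(* The last clause asks the difference quotients at each lambda to be bounded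
   uniformly in z. It makes the pointwise derivative bounded, and it holds both
   when lambda |-> W lambda is differentiable for the supremum norm and when
   dW/dlambda is bounded uniformly in z and locally uniformly in lambda. With
   only a bounded pointwise derivative at each lambda, the differentiability of
   Q_cont fails: for reflected Brownian motion on [0, 1] and functions of one
   variable, take W lambda = 0 for lambda <= 0 and, for lambda > 0, W lambda z =
   phi (z / lambda) with phi a smooth nonnegative bump supported in [1/2, 3/2].
   Then dW/dlambda = 0 at lambda = 0, but Q_cont (W lambda), which is at least
   the mean of W lambda, has a kink there. *)
Record differentiable_family (W : R -> T -> R) : Prop := {
  family_bounded : forall lambda, bounded_measurable (W lambda);
  family_derivable : forall lambda z,
    derivable (fun c : R => W c z) lambda 1;
  family_derive_bounded : forall lambda,
    bounded_fun (fun z => derive1 (fun c : R => W c z) lambda);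
  family_quotient_bounded : forall lambda, exists C : R,
    \forall h \near (0 : R), forall z : T,
      `|W (lambda + h) z - W lambda z| <= C * `|h|
}.

End bounded_functions.

Section functionals.
Context (R : realType) (dO dE : measure_display).
Context (Omega : measurableType dO) (E : measurableType dE).
Implicit Types (X : R -> Omega -> E) (Px : R.-pker E ~> Omega).

Definition Ex Px (x : E) (f : Omega -> R) : R := \int[Px x]_w f w.

(* \int_0^T W (X (q_1 t), ..., X (q_l t)) dt *)
Definition nonconventional_integral X (l : nat) (q : 'I_l.+1 -> R -> R)
    (W : l.+1.-tuple E -> R) (T : R) (w : Omega) : R :=
  \int[lebesgue_measure]_(t in `[0, T]) W [tuple X (q i t) w | i < l.+1].

Fixpoint iterated_integral (mu : probability E R) (k : nat) :
    (k.-tuple E -> R) -> R :=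
  match k with
  | 0 => fun f => f [tuple]
  | k'.+1 => fun f =>
      \int[mu]_y iterated_integral mu (fun z => f [tuple of y :: z])
  end.

Definition hatW X (mu : probability E R) (alpha1 : R) (l : nat)
    (W : l.+1.-tuple E -> R) (t : R) (w : Omega) : R :=
  expR (\int[lebesgue_measure]_(s in `[0, t])
    iterated_integral mu (fun z => W [tuple of X (alpha1 * s) w :: z])).

Definition Rcont X Px (mu : probability E R) (alpha1 : R) (l : nat)
    (W : l.+1.-tuple E -> R) (t : R) (g : E -> R) (x : E) : R :=
  Ex Px x (fun w => g (X (alpha1 * t) w) * hatW X mu alpha1 W t w).

End functionals.

Section spectral_radius.
Context (R : realType) (d : measure_display) (T : measurableType d).

Definition growth_rate (A : R -> (T -> R) -> T -> R) (t : R) : R :=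
  t^-1 * ln (operator_norm (A t)).

Definition spectral_radius (A : R -> (T -> R) -> T -> R) : R :=
  expR (lim (growth_rate A t @[t --> +oo])).

End spectral_radius.

Definition rate_function (R : realType) (r : R -> R) (u : R) : \bar R :=
  ereal_sup [set (lambda * u - ln (r lambda))%:E | lambda in [set: R]].

(* Main.v *)
Require Import Defs.
From HB Require Import structures.
From mathcomp Require Import all_boot all_order all_algebra.
From mathcomp Require Import all_classical all_reals all_analysis.
From mathcomp Require Import measurable_realfun.
From mathcomp Require Import ring lra zify.

(* Since [q j (t + gamma) - q j t] tends to infinity, over a short time block after
   [gamma T] the fast coordinate [X (q j t)] has forgotten the past and equilibrated,
   while the slower coordinates, being read before [q j (gamma T)], are already known.
   Replacing W block by block by its average over that coordinate then changes the
   logarithm of the exponential moment by o(T): the first-order term vanishes by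
   mixing, and the second-order terms are small with the length of the blocks.
   Iterating over the coordinates leaves the Feynman-Kac semigroup of a function of
   one variable.  By the Doeblin condition its operators contract the oscillation of
   ratios, which yields a Perron eigenfunction bounded above and below, hence the
   growth rate, and the perturbation of the eigenvalue shows that this rate is
   differentiable.  The large deviations follow from differentiability by tilting and
   Chernoff bounds; the lower bound is first proved at points exposed by a quadratic
   penalty and transferred by letting the penalty vanish. *)

Set Implicit Arguments.
Unset Strict Implicit.
Unset Printing Implicit Defensive.
Import Order.TTheory GRing.Theory Num.Theory.
Import numFieldNormedType.Exports.
Local Open Scope classical_set_scope.
Local Open Scope ring_scope.

(** * Bounded measurable functions and their integrals *)

(** Conditional expectations are never constructed: conditioning on the past of a time is tested
    against bounded variables measurable for that past ([orth]), and the Markov property passes from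
    single times to exponentials of time integrals through products of factors [1 + A / n], which
    approximate [expR A] uniformly. In the averaging estimate one block is left free between the
    known past and the block being averaged; this is the delay in which the fast coordinate mixes.
    The times before [gam * T] escape the argument and are paid for by the trivial bound, which is
    why [gam] is sent to 0. The difference quotients of the family converge only pointwise, under a
    uniform bound. Hence the first-order expansion of the growth rate is proved uniformly over all
    directions with a given bound, and the derivative is shown to be Lipschitz for the L1 norm of
    [mu], so that dominated convergence suffices. Growth rates are encoded by two-sided bounds
    uniform in the starting point; they give the same limit under each law started at a point and
    under [P], whatever the law of [X 0]. *)

Definition bdm (R : realType) d (T : measurableType d) (f : T -> R) (B : R) :=
  measurable_fun [set: T] f /\ forall x, `|f x| <= B.

Section bdm.
Context (R : realType) d (T : measurableType d).
Implicit Types (f g : T -> R) (B C : R).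

Lemma bounded_measurableP f : bounded_measurable f <-> exists B, bdm f B.
Proof.
split=> [[mf [B [_ fB]]]|[B [mf fB]]].
  exists (`|B| + 1); split=> // x; apply: fB => //.
  by rewrite (le_lt_trans (ler_norm B))// ltrDl.
split=> //; exists B; split; first exact: num_real.
by move=> C BC x _ /=; rewrite (le_trans (fB x))// ltW.
Qed.

Lemma bdm_cst (c : R) : bdm (fun _ : T => c) `|c|.
Proof. by split. Qed.

Lemma bdm1 : bdm (fun _ : T => 1 : R) 1.
Proof. by have := bdm_cst 1; rewrite normr1. Qed.

Lemma bdmW f B C : bdm f B -> B <= C -> bdm f C.
Proof. by move=> [mf fB] BC; split=> // x; exact: le_trans BC. Qed.

Lemma bdmD f g B C : bdm f B -> bdm g C -> bdm (fun x => f x + g x) (B + C).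
Proof.
move=> [mf fB] [mg gC]; split; first exact: measurable_funD.
by move=> x; rewrite (le_trans (ler_normD _ _))// lerD.
Qed.

Lemma bdmN f B : bdm f B -> bdm (fun x => - f x) B.
Proof.
move=> [mf fB]; split; first exact: measurableT_comp.
by move=> x; rewrite normrN.
Qed.

Lemma bdmB f g B C : bdm f B -> bdm g C -> bdm (fun x => f x - g x) (B + C).
Proof. by move=> bf bg; apply: bdmD => //; exact: bdmN. Qed.

Lemma bdmM f g B C : bdm f B -> bdm g C -> bdm (fun x => f x * g x) (B * C).
Proof.
move=> [mf fB] [mg gC]; split; first exact: measurable_funM.
by move=> x; rewrite normrM ler_pM.
Qed.

Lemma bdmZ f B c : bdm f B -> bdm (fun x => c * f x) (`|c| * B).
Proof. by move=> bf; apply: bdmM => //; exact: bdm_cst. Qed.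

Lemma bdmX f B n : bdm f B -> bdm (fun x => f x ^+ n) (B ^+ n).
Proof.
move=> bf; elim: n => [|n IH]; first by under eq_fun do rewrite expr0; exact: bdm1.
by under eq_fun do rewrite exprS; rewrite exprS; exact: bdmM.
Qed.

Lemma bdm_exp f B : bdm f B -> bdm (fun x => expR (f x)) (expR B).
Proof.
move=> [mf fB]; split; first exact: measurableT_comp.
by move=> x; rewrite ger0_norm ?expR_ge0// ler_expR (le_trans (ler_norm _)).
Qed.

Lemma bdm_norm f B : bdm f B -> bdm (fun x => `|f x|) B.
Proof.
move=> [mf fB]; split; first exact: measurableT_comp.
by move=> x; rewrite normr_id.
Qed.

Lemma bdm_comp d' (T' : measurableType d') (h : T' -> T) f B :
  measurable_fun setT h -> bdm f B -> bdm (fun x => f (h x)) B.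
Proof. by move=> mh [mf fB]; split=> //; exact: measurableT_comp. Qed.

Lemma bdm_ge0 f B (x : T) : bdm f B -> 0 <= B.
Proof. by move=> [_ /(_ x)]; exact: le_trans. Qed.

End bdm.
Arguments bdm_cst {R d T} c.
Arguments bdm1 {R d T}.

Section bdm_integral.
Context (R : realType) d (T : measurableType d) (m : {measure set T -> \bar R}).
Variables (D : set T) (mD : measurable D) (Dfin : (m D < +oo)%E).
Implicit Types (f g : T -> R).

Lemma bdm_integrable f B : bdm f B -> m.-integrable D (EFin \o f).
Proof.
move=> [mf fB]; apply: measurable_bounded_integrable => //.
  exact: measurable_funTS.
exists B; split; first exact: num_real.
by move=> C BC x _ /=; rewrite (le_trans (fB x))// ltW.
Qed.

Lemma bintD f g B C : bdm f B -> bdm g C ->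
  \int[m]_(x in D) (f x + g x) = \int[m]_(x in D) f x + \int[m]_(x in D) g x.
Proof. by move=> bf bg; rewrite RintegralD//; apply: bdm_integrable; eassumption. Qed.

Lemma bintB f g B C : bdm f B -> bdm g C ->
  \int[m]_(x in D) (f x - g x) = \int[m]_(x in D) f x - \int[m]_(x in D) g x.
Proof. by move=> bf bg; rewrite RintegralB//; apply: bdm_integrable; eassumption. Qed.

Lemma bintZ c f B : bdm f B ->
  \int[m]_(x in D) (c * f x) = c * \int[m]_(x in D) f x.
Proof. by move=> bf; rewrite RintegralZl//; apply: bdm_integrable; eassumption. Qed.

Lemma le_bint f g B C : bdm f B -> bdm g C -> (forall x, D x -> f x <= g x) ->
  \int[m]_(x in D) f x <= \int[m]_(x in D) g x.
Proof. by move=> bf bg; apply: le_Rintegral => //; apply: bdm_integrable; eassumption. Qed.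

Lemma bint_norm f B : bdm f B ->
  `|\int[m]_(x in D) f x| <= \int[m]_(x in D) `|f x|.
Proof. by move=> bf; apply: le_normr_Rintegral => //; apply: bdm_integrable; eassumption. Qed.

Lemma bint_normW f g B C : bdm f B -> bdm g C ->
  (forall x, D x -> `|f x| <= g x) ->
  `|\int[m]_(x in D) f x| <= \int[m]_(x in D) g x.
Proof.
move=> bf bg fg; apply: (le_trans (bint_norm bf)).
exact: le_bint (bdm_norm bf) bg fg.
Qed.

Lemma bint_le_cst f B C : bdm f B -> (forall x, D x -> `|f x| <= C) ->
  `|\int[m]_(x in D) f x| <= C * fine (m D).
Proof.
move=> bf fC; rewrite -(Rintegral_cst m mD C).
exact: (bint_normW bf (bdm_cst C)).
Qed.

Lemma bint_cvg (F : nat -> T -> R) f B :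
  (forall n, bdm (F n) B) -> measurable_fun setT f ->
  (forall x, D x -> F n x @[n --> \oo] --> f x) ->
  \int[m]_(x in D) F n x @[n --> \oo] --> \int[m]_(x in D) f x.
Proof.
move=> bF mf cF.
have := @dominated_convergence _ _ _ m D mD (fun n x => (F n x)%:E) (EFin \o f)
  (fun=> B%:E).
case.
- by move=> n; apply/measurable_EFinP/measurable_funTS; case: (bF n).
- by apply/measurable_EFinP; exact: measurable_funTS.
- by apply/aeW => x Dx /=; apply/cvg_EFin; first (by apply: nearW); exact: cF.
- exact: bdm_integrable (bdm_cst B).
- by apply/aeW => x n Dx; rewrite lee_fin; case: (bF n).
move=> intf _ cv.
rewrite /Rintegral; apply: fine_cvg; rewrite fineK//.
exact: integrable_fin_num.
Qed.

End bdm_integral.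

Section bdm_param.
Context (R : realType) d1 d2 (T1 : measurableType d1) (T2 : measurableType d2).
Implicit Types f : T1 * T2 -> R.

Lemma bdm_pair1 f B x : bdm f B -> bdm (fun y => f (x, y)) B.
Proof.
move=> [mf fB]; split=> [|y]; last exact: fB.
exact: (measurableT_comp mf (pair1_measurable x)).
Qed.

Lemma bdm_pair2 f B y : bdm f B -> bdm (fun x => f (x, y)) B.
Proof.
move=> [mf fB]; split=> [|x]; last exact: fB.
exact: (measurableT_comp mf (pair2_measurable y)).
Qed.

Lemma bdm_swap f B : bdm f B -> bdm (fun z => f (z.2, z.1)) B.
Proof.
move=> [mf fB]; split=> [|z]; last exact: fB.
exact: (measurableT_comp mf (@measurable_swap _ _ _ _)).
Qed.

Lemma bint_EFin d (T : measurableType d) (m : {measure set T -> \bar R})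
    (D : set T) (g : T -> R) B :
  measurable D -> (m D < +oo)%E -> bdm g B ->
  (\int[m]_(x in D) g x)%:E = (\int[m]_(x in D) (g x)%:E)%E.
Proof.
move=> mD Dfin bg; rewrite /Rintegral fineK//.
apply: integrable_fin_num => //; exact: bdm_integrable bg.
Qed.

Lemma EFin_restrict d (T : measurableType d) (D : set T) (g : T -> R) :
  (fun x => (g x)%:E) \_ D = (fun x => (g x * \1_D x)%:E).
Proof.
apply/funext => x; rewrite patchE indicE.
by case: ifPn => _; rewrite ?mulr1 ?mulr0.
Qed.

Section fixed_measure.
Variables (m : {sigma_finite_measure set T2 -> \bar R}) (D : set T2).
Hypotheses (mD : measurable D) (Dfin : (m D < +oo)%E).

Let bdm_param_ge0 f B : bdm f B -> (forall z, 0 <= f z) ->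
  measurable_fun setT (fun x => \int[m]_(y in D) f (x, y)).
Proof.
move=> bf f0; apply/measurable_EFinP.
rewrite [X in measurable_fun _ X](_ : _ =
    fun x => (\int[m]_y (f (x, y) * \1_D y)%:E)%E); last first.
  apply/funext => x /=; rewrite (bint_EFin mD Dfin (bdm_pair1 x bf)).
  by rewrite integral_mkcond EFin_restrict.
apply: (measurable_fun_fubini_tonelli_F (fun z => (f z * \1_D z.2)%:E)).
  apply/measurable_EFinP/measurable_funM; first by case: bf.
  exact: (measurableT_comp (measurable_indic mD)).
by move=> z; rewrite lee_fin mulr_ge0.
Qed.

(** Tonelli's theorem gives measurability for nonnegative integrands. Adding the bound [B] makes [f]
    nonnegative, and the added constant integrates to [B * fine (m D)]. The same shift is used for
    kernels, for Fubini and for disintegration. *)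
Lemma bdm_param f B : bdm f B ->
  bdm (fun x => \int[m]_(y in D) f (x, y)) (B * fine (m D)).
Proof.
move=> bf; split=> [|x]; last first.
  by apply: bint_le_cst => //; [exact: bdm_pair1 bf|move=> y _; case: bf].
have bf' := bdmD bf (bdm_cst B).
rewrite [X in measurable_fun _ X](_ : _ =
    fun x => \int[m]_(y in D) (f (x, y) + B) - B * fine (m D)); last first.
  apply/funext => x.
  by rewrite (bintD mD Dfin (bdm_pair1 x bf) (bdm_cst B)) Rintegral_cst// addrK.
apply: measurable_funB => //; apply: (bdm_param_ge0 bf') => z.
case: bf => _ /(_ z); rewrite ler_norml => /andP[+ _].
by rewrite -subr_ge0 opprK.
Qed.

End fixed_measure.

Lemma bdm_kernel (k : R.-pker T1 ~> T2) f B : bdm f B ->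
  bdm (fun x => \int[k x]_y f (x, y)) B.
Proof.
move=> bf; have k1 x : (k x setT < +oo)%E by rewrite prob_kernel ltry.
split=> [|x]; last first.
  rewrite -[leRHS]mulr1; have -> : 1 = fine (k x setT) by rewrite prob_kernel.
  by apply: bint_le_cst => //; [exact: bdm_pair1 bf|move=> y _; case: bf].
have bf' := bdmD bf (bdm_cst B).
have f'0 z : 0 <= f z + B.
  case: bf => _ /(_ z); rewrite ler_norml => /andP[+ _].
  by rewrite -subr_ge0 opprK.
rewrite [X in measurable_fun _ X](_ : _ =
    fun x => \int[k x]_y (f (x, y) + B) - B); last first.
  apply/funext => x.
  rewrite (bintD measurableT (k1 x) (bdm_pair1 x bf) (bdm_cst B)).
  by rewrite Rintegral_cst// prob_kernel mulr1 addrK.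
apply: measurable_funB => //; apply/measurable_EFinP.
rewrite [X in measurable_fun _ X](_ : _ =
    fun x => (\int[k x]_y (f (x, y) + B)%:E)%E); last first.
  by apply/funext => x /=; rewrite (bint_EFin measurableT (k1 x) (bdm_pair1 x bf')).
apply: (measurable_fun_integral_finite_kernel (fun z => (f z + B)%:E) k) => //.
by apply/measurable_EFinP; case: bf'.
Qed.

End bdm_param.

Section fubini.
Context (R : realType) d1 d2 (T1 : measurableType d1) (T2 : measurableType d2).
Implicit Types f : T1 * T2 -> R.
Variables (m1 : {sigma_finite_measure set T1 -> \bar R}) (D1 : set T1).
Variables (m2 : {sigma_finite_measure set T2 -> \bar R}) (D2 : set T2).
Hypotheses (mD1 : measurable D1) (D1fin : (m1 D1 < +oo)%E).
Hypotheses (mD2 : measurable D2) (D2fin : (m2 D2 < +oo)%E).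

Let bint_fubini_ge0 f B : bdm f B -> (forall z, 0 <= f z) ->
  \int[m1]_(x in D1) \int[m2]_(y in D2) f (x, y) =
  \int[m2]_(y in D2) \int[m1]_(x in D1) f (x, y).
Proof.
move=> bf f0.
rewrite {1}/Rintegral [RHS]/Rintegral; congr fine.
under eq_integral do rewrite (bint_EFin mD2 D2fin (bdm_pair1 _ bf)).
under [RHS]eq_integral do rewrite (bint_EFin mD1 D1fin (bdm_pair2 _ bf)).
rewrite integral_mkcond [RHS]integral_mkcond.
pose g z := (f z * \1_D1 z.1 * \1_D2 z.2)%:E.
have g0 z : (0 <= g z)%E by rewrite lee_fin !mulr_ge0.
have mg : measurable_fun setT g.
  apply/measurable_EFinP/measurable_funM.
    apply: measurable_funM; first by case: bf.
    exact: (measurableT_comp (measurable_indic mD1)).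
  exact: (measurableT_comp (measurable_indic mD2)).
transitivity (\int[m1]_x \int[m2]_y g (x, y))%E.
  apply: eq_integral => x _; rewrite patchE.
  case: ifPn => xD; last first.
    rewrite integral0_eq// => y _.
    by rewrite /g/= [\1_D1 x]indicE (negbTE xD) mulr0 mul0r.
  rewrite integral_mkcond EFin_restrict; apply: eq_integral => y _.
  by rewrite /g/= [\1_D1 x]indicE xD mulr1.
rewrite fubini_tonelli//; apply: eq_integral => y _; rewrite patchE.
case: ifPn => yD; last first.
  rewrite integral0_eq// => x _.
  by rewrite /g/= [\1_D2 y]indicE (negbTE yD) mulr0.
rewrite integral_mkcond EFin_restrict; apply: eq_integral => x _.
by rewrite /g/= [\1_D2 y]indicE yD mulr1.
Qed.

Lemma bint_fubini f B : bdm f B ->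
  \int[m1]_(x in D1) \int[m2]_(y in D2) f (x, y) =
  \int[m2]_(y in D2) \int[m1]_(x in D1) f (x, y).
Proof.
move=> bf; have bf' := bdmD bf (bdm_cst B).
have f'0 z : 0 <= f z + B.
  case: bf => _ /(_ z); rewrite ler_norml => /andP[+ _].
  by rewrite -subr_ge0 opprK.
have := bint_fubini_ge0 bf' f'0.
under eq_Rintegral do
  rewrite (bintD mD2 D2fin (bdm_pair1 _ bf) (bdm_cst B)) Rintegral_cst//.
under [RHS]eq_Rintegral do
  rewrite (bintD mD1 D1fin (bdm_pair2 _ bf) (bdm_cst B)) Rintegral_cst//.
rewrite (bintD mD1 D1fin (bdm_param mD2 D2fin bf) (bdm_cst _)) Rintegral_cst//.
have bs := bdm_param mD1 D1fin (bdm_swap bf).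
rewrite (bintD mD2 D2fin bs (bdm_cst _)) Rintegral_cst//.
by rewrite -!mulrA [X in B * X]mulrC => /addIr.
Qed.

End fubini.

(** * Integrals over a time interval *)

Section time_integral.
Context (R : realType).
Notation leb := (@lebesgue_measure R).
Implicit Types (phi psi : measurableTypeR R -> R) (a b t B : R).

Definition tint t phi : R := \int[leb]_(s in `[0, t]) phi s.

Lemma lebesgue_measure0t t : 0 <= t -> leb `[0, t] = t%:E.
Proof.
move=> t0; rewrite lebesgue_measure_itv/= lte_fin.
by case: ltgtP t0 => // [_|<-] _; rewrite ?oppr0 ?adde0.
Qed.

Lemma lebesgue_measure_itv_fin a b : (leb `[a, b] < +oo)%E.
Proof. by rewrite lebesgue_measure_itv/=; case: ifP => _; rewrite ?ltry. Qed.

Lemma lebesgue_measure0t_fin t : (leb `[0%R, t] < +oo)%E.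
Proof. exact: lebesgue_measure_itv_fin. Qed.

(** Lebesgue measure is determined by its values on half-open intervals, and a translation preserves
    their lengths. *)
Lemma lebesgue_measureD a (A : set R) : measurable A ->
  pushforward leb (fun x : R => a + x : measurableTypeR R) A = leb A.
Proof.
have ma : measurable_fun [set: R] (fun x : R => a + x : measurableTypeR R).
  exact: measurable_funD.
move=> mA; apply/esym/lebesgue_measure_unique => //= _ [[u v]] _ <-.
rewrite /pushforward.
rewrite (_ : _ @^-1` _ = `]u - a, v - a]%classic); last first.
  by apply/seteqP; split=> x/=; rewrite !in_itv/= ltrBlDl lerBrDl.
rewrite !lebesgue_measure_itv/= !lte_fin ltrD2r.
by case: ifP => // _; rewrite -!EFinB opprB addrA subrK.
Qed.

Lemma bint_shift phi B a b : bdm phi B ->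
  \int[leb]_(s in `[a, a + b]) phi s = tint b (fun s => phi (a + s)).
Proof.
move=> [mphi phiB]; rewrite /tint /Rintegral; congr fine.
have ma : measurable_fun [set: R] (fun x : R => a + x : measurableTypeR R).
  exact: measurable_funD.
rewrite (_ : `[0, b]%classic =
    (fun x : R => a + x : measurableTypeR R) @^-1` `[a, a + b]); last first.
  by apply/seteqP; split=> x/=; rewrite !in_itv/= lerDl lerD2l.
rewrite -(@integral_pushforward _ _ (measurableTypeR R) (measurableTypeR R) R _ ma leb
  `[a, a + b]%classic (EFin \o phi))//.
- by apply: eq_measure_integral => //= A mA AS; exact/esym/lebesgue_measureD.
- exact/measurable_EFinP.
- apply: (@bdm_integrable R _ (measurableTypeR R) leb _ _ _ (phi \o (fun x => a + x)) B).
  + by rewrite -[X in measurable X]setTI; exact: ma.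
  + rewrite (_ : _ @^-1` _ = `[0, b]%classic); first exact: lebesgue_measure0t_fin.
    by apply/seteqP; split=> x/=; rewrite !in_itv/= lerDl lerD2l.
  + by split=> [|x]; [exact: (measurableT_comp mphi ma)|exact: phiB].
Qed.

Lemma tint_split phi B a b : bdm phi B -> 0 <= a -> 0 <= b ->
  tint (a + b) phi = tint a phi + tint b (fun s => phi (a + s)).
Proof.
move=> bphi a0 b0; rewrite -(bint_shift _ _ bphi).
have iphi c d : leb.-integrable `[c, d] (EFin \o phi).
  apply: (@bdm_integrable R _ (measurableTypeR R) leb _ _ _ phi B) => //.
  exact: lebesgue_measure_itv_fin.
(* Both closed intervals contain the point [a]; it is a null set and is removed from the second
   one. *)
rewrite -[X in _ = _ + X](@Rintegral_itv_obnd_cbnd _ a); last first.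
  by apply: integrableS (iphi a (a + b)) => //; exact: subset_itv_oc_cc.
rewrite -(@Rintegral_itvB _ phi (BLeft 0) (BRight (a + b)) a)//.
- by rewrite /tint addrCA subrr addr0.
- by rewrite bnd_simp lerDl.
Qed.

Lemma tintD phi psi B C t : bdm phi B -> bdm psi C ->
  tint t (fun s => phi s + psi s) = tint t phi + tint t psi.
Proof. by apply: bintD => //; exact: lebesgue_measure0t_fin. Qed.

Lemma tintB phi psi B C t : bdm phi B -> bdm psi C ->
  tint t (fun s => phi s - psi s) = tint t phi - tint t psi.
Proof. by apply: bintB => //; exact: lebesgue_measure0t_fin. Qed.

Lemma tintZ c phi B t : bdm phi B -> tint t (fun s => c * phi s) = c * tint t phi.
Proof. by apply: bintZ => //; exact: lebesgue_measure0t_fin. Qed.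

Lemma eq_tint phi psi t : (forall s, 0 <= s <= t -> phi s = psi s) ->
  tint t phi = tint t psi.
Proof.
by move=> eqs; apply: eq_Rintegral => s; rewrite inE/= in_itv; exact: eqs.
Qed.

Lemma tint_cst c t : 0 <= t -> tint t (fun=> c) = c * t.
Proof. by move=> t0; rewrite /tint Rintegral_cst// -[t in RHS]/(fine t%:E) -(lebesgue_measure0t t0). Qed.

Section random.
Context d (Om : measurableType d) (Q : probability Om R).
Implicit Type G : measurableTypeR R * Om -> R.

Lemma bdm_tint G B t : 0 <= t -> bdm G B ->
  bdm (fun w => tint t (fun s => G (s, w))) (B * t).
Proof.
move=> t0 bG.
have := bdm_param (m := leb) (D := `[0, t]) (measurable_itv _)
  (lebesgue_measure0t_fin t) (bdm_swap bG).
by rewrite (_ : fine _ = t)// -[RHS]/(fine t%:E) -(lebesgue_measure0t t0).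
Qed.

Lemma prob_fin : (Q setT < +oo)%E.
Proof. by rewrite probability_setT ltry. Qed.

Lemma tint_fubini G B t : bdm G B ->
  \int[Q]_w tint t (fun s => G (s, w)) = tint t (fun s => \int[Q]_w G (s, w)).
Proof.
move=> bG; apply/esym; apply: (bint_fubini (m1 := leb) (m2 := Q)) bG => //.
  exact: lebesgue_measure0t_fin.
exact: prob_fin.
Qed.

End random.

End time_integral.

(** * Markov processes *)

Section graph_kernel.
Context (R : realType) d1 d2 (N : measurableType d1) (E : measurableType d2).
Variable k : R.-pker N ~> E.

(** The law of the pair [(w, Y)] when [Y] has law [k w]. The dummy argument of type [unit] is there
    so that composing with the constant kernel of [Q] yields the measure [Q (dw) k (w, dy)] on the
    product. *)
Definition graph_kernel (z : unit * N) : set (N * E) -> \bar R :=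
  pushforward (k z.2) (pair z.2).

Let graph_kernel0 z : graph_kernel z set0 = 0%E.
Proof. by rewrite /graph_kernel /pushforward preimage_set0 measure0. Qed.

Let graph_kernel_ge0 z A : (0 <= graph_kernel z A)%E.
Proof. exact: measure_ge0. Qed.

Let graph_kernel_additive z : semi_sigma_additive (graph_kernel z).
Proof.
pose mf := isMeasurableFun.Build _ _ _ _ _ (@pair1_measurable _ _ N E z.2).
pose F := MeasurableFun.Pack (MeasurableFun.Class mf).
exact: (@measure_semi_sigma_additive _ _ _ (pushforward (k z.2) F)).
Qed.

HB.instance Definition _ z := isMeasure.Build _ _ _ (graph_kernel z)
  (graph_kernel0 z) (graph_kernel_ge0 z) (@graph_kernel_additive z).

Definition mgraph_kernel : (unit * N)%type -> {measure set (N * E) -> \bar R} :=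
  graph_kernel.

Let measurable_graph_kernel C : measurable C ->
  measurable_fun setT (mgraph_kernel ^~ C).
Proof.
move=> mC; rewrite (_ : _ ^~ C = (fun w => k w (xsection C w)) \o snd).
  apply: measurableT_comp => //; apply: measurable_fun_xsection_finite_kernel.
  by rewrite inE.
by apply/funext => z; rewrite /= /graph_kernel /pushforward xsectionE.
Qed.

HB.instance Definition _ :=
  isKernel.Build _ _ _ _ _ mgraph_kernel measurable_graph_kernel.

Let graph_kernel_prob z : mgraph_kernel z setT = 1%E.
Proof. by rewrite /mgraph_kernel/= /graph_kernel /pushforward preimage_setT prob_kernel. Qed.

HB.instance Definition _ :=
  Kernel_isProbability.Build _ _ _ _ _ mgraph_kernel graph_kernel_prob.

End graph_kernel.

Section const_kernel.
Context (R : realType) d1 (N : measurableType d1).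
Variable Q : probability N R.

Definition const_kernel (_ : unit) : {measure set N -> \bar R} := Q.

Let measurable_const_kernel C : measurable C ->
  measurable_fun setT (const_kernel ^~ C).
Proof. by move=> mC; exact: measurable_cst. Qed.

HB.instance Definition _ :=
  isKernel.Build _ _ _ _ _ const_kernel measurable_const_kernel.

Let const_kernel_prob z : const_kernel z setT = 1%E.
Proof. exact: probability_setT. Qed.

HB.instance Definition _ :=
  Kernel_isProbability.Build _ _ _ _ _ const_kernel const_kernel_prob.

End const_kernel.

Section disintegration.
Context (R : realType) d1 d2 (N : measurableType d1) (E : measurableType d2).
Variables (Q : probability N R) (k : R.-pker N ~> E).
Variable m : {measure set (N * E) -> \bar R}.

(* The right-hand side is the measure [Q (dw) k (w, dy)]: it suffices to test
   on rectangles. *)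
Lemma disintegration (f : N * E -> R) B : bdm f B ->
  (forall A C, measurable A -> measurable C ->
    m (A `*` C) = \int[Q]_(w in A) k w C)%E ->
  \int[m]_z f z = \int[Q]_w \int[k w]_y f (w, y).
Proof.
move=> bf mE.
pose m2 : {measure set (N * E) -> \bar R} :=
  kcomp (const_kernel Q) (mgraph_kernel k) tt.
have m12 : forall C, measurable C -> m C = m2 C.
  apply: (measure_unique [set A `*` B | A in measurable & B in measurable]
    (fun=> setT)) => //.
  - by rewrite measurable_prod_measurableType.
  - move=> _ _ [A1 mA1 [B1 mB1 <-]] [A2 mA2 [B2 mB2 <-]].
    exists (A1 `&` A2); first exact: measurableI.
    by exists (B1 `&` B2); [exact: measurableI|rewrite setXI].
  - by move=> _; exists setT => //; exists setT => //; rewrite setXTT.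
  - by rewrite bigcup_const//; exists 0%N.
  - move=> _ [A mA [C mC <-]]; rewrite mE// /m2/= /kcomp/=.
    rewrite integral_mkcond; apply: eq_integral => w _.
    rewrite patchE /graph_kernel /pushforward/=; case: ifPn => wA.
      congr (k w _); apply/seteqP; split=> [y Cy|y []//].
      by split=> //; rewrite inE in wA.
    rewrite (_ : _ @^-1` _ = set0) ?measure0//.
    by apply/seteqP; split=> // y [/= /mem_set]; rewrite (negbTE wA).
  - move=> _; rewrite -setXTT mE//.
    under eq_integral do rewrite prob_kernel.
    by rewrite integral_cst//= probability_setT mule1 ltry.
have m2T : m2 setT = 1%E.
  rewrite -m12// -setXTT mE//; under eq_integral do rewrite prob_kernel.
  by rewrite integral_cst//= probability_setT mule1.
have Q1 : (Q setT < +oo)%E by rewrite probability_setT ltry.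
have k1 w : (k w setT < +oo)%E by rewrite prob_kernel ltry.
have m21 : (m2 setT < +oo)%E by rewrite m2T ltry.
have ge0case g C : bdm g C -> (forall z, 0 <= g z) ->
    \int[m2]_z g z = \int[Q]_w \int[k w]_y g (w, y).
  move=> bg g0; rewrite {1}/Rintegral [in RHS]/Rintegral; congr fine.
  have mg : measurable_fun setT (EFin \o g) by apply/measurable_EFinP; case: bg.
  rewrite (integral_kcomp (const_kernel Q) (mgraph_kernel k))//=.
  apply: eq_integral => w _.
  rewrite (bint_EFin measurableT (k1 w) (bdm_pair1 w bg)).
  by rewrite (ge0_integral_pushforward (@pair1_measurable _ _ N E w))// => z _; rewrite lee_fin.
transitivity (\int[m2]_z f z).
  by congr fine; apply: eq_measure_integral => A mA _; exact: m12.
have bf' := bdmD bf (bdm_cst B).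
have f'0 z : 0 <= f z + B.
  case: bf => _ /(_ z); rewrite ler_norml => /andP[+ _].
  by rewrite -subr_ge0 opprK.
have := ge0case _ _ bf' f'0.
rewrite (bintD measurableT m21 bf (bdm_cst B)) Rintegral_cst// m2T mulr1.
under [RHS]eq_Rintegral do
  rewrite (bintD measurableT (k1 _) (bdm_pair1 _ bf) (bdm_cst B)) Rintegral_cst//
    prob_kernel mulr1.
rewrite (bintD measurableT Q1 (bdm_kernel k bf) (bdm_cst B)) Rintegral_cst//.
by rewrite /= probability_setT mulr1 => /addIr.
Qed.

End disintegration.

Section kernel_prob.
Context (R : realType) d1 d2 (N : measurableType d1) (E : measurableType d2).
Variable k : R.-pker N ~> E.

(** A copy of [k x] that carries the structure of a probability, so that the lemmas on expectations
    apply to a kernel at a fixed point. *)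
Definition kernel_prob (x : N) : set E -> \bar R := k x.

HB.instance Definition _ x := Measure.on (kernel_prob x).

Let kernel_prob_setT x : kernel_prob x setT = 1%E.
Proof. exact: prob_kernel. Qed.

HB.instance Definition _ x :=
  Measure_isProbability.Build _ _ _ (kernel_prob x) (kernel_prob_setT x).

Context d0 (N0 : measurableType d0) (h : N0 -> N).
Hypothesis mh : measurable_fun [set: N0] h.

(** The measurability proof is an argument of the term, so that the kernel structure can be inferred
    from it. *)
Definition pull_kernel of measurable_fun [set: N0] h :
  N0 -> {measure set E -> \bar R} := fun x => k (h x).

Let measurable_pull_kernel C : measurable C ->
  measurable_fun setT (pull_kernel mh ^~ C).
Proof.
by move=> mC; apply: (measurableT_comp (measurable_kernel k C mC) mh).
Qed.

HB.instance Definition _ :=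
  isKernel.Build _ _ _ _ _ (pull_kernel mh) measurable_pull_kernel.

Let pull_kernel_prob z : pull_kernel mh z setT = 1%E.
Proof. exact: prob_kernel. Qed.

HB.instance Definition _ :=
  Kernel_isProbability.Build _ _ _ _ _ (pull_kernel mh) pull_kernel_prob.

End kernel_prob.

Lemma bint_distribution (R : realType) d1 d2 (N : measurableType d1)
    (E : measurableType d2) (Q : probability N R) (h : {mfun N >-> E})
    (f : E -> R) B : bdm f B ->
  \int[distribution Q h]_y f y = \int[Q]_w f (h w).
Proof.
move=> bf; congr fine; rewrite integral_distribution//.
  by apply/measurable_EFinP; case: bf.
apply: (@bdm_integrable R _ N Q setT _ _ (f \o h) B) => //; first exact: prob_fin.
by apply: bdm_comp bf.
Qed.

Section markov.
Context (R : realType) (dO dE : measure_display).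
Context (Omega : measurableType dO) (E : measurableType dE).
Variables (X : R -> Omega -> E) (p : R -> R.-pker E ~> E).
Variable Px : R.-pker E ~> Omega.

Notation T1 := (measurableTypeR R).

(** Measurability is required over the whole time line, which holds once negative times are clamped
    to 0. [P] is absent: it enters later as one of the laws [Q] that have the Markov property. *)
Record markov_family : Prop := {
  family_measurable : measurable_fun setT (fun z : T1 * Omega => X z.1 z.2);
  family_start : forall x B, measurable B -> Px x (X 0 @^-1` B) = \d_x B;
  family_markov : forall x, markov_property X p (Px x) }.

Hypothesis mfam : markov_family.

Definition law (x : E) : probability Omega R := kernel_prob Px x.

(** [Omega] with the smaller sigma-algebra generated by the process up to [s]. As a separate type it
    turns adaptedness into plain measurability: [bdm (Y : past s -> R) B]. *)
Definition past (s : R) := g_sigma_algebraType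
  [set A | exists u B, [/\ 0 <= u, u <= s, measurable B & A = X u @^-1` B]].

Lemma measurable_time t : measurable_fun setT (X t).
Proof. exact: (measurableT_comp (family_measurable mfam) (pair1_measurable (t : T1))). Qed.

Lemma measurable_past_id s : measurable_fun setT (id : Omega -> past s).
Proof.
move=> _ A mA; rewrite setTI preimage_id.
suff : <<s [set A | exists u B,
    [/\ 0 <= u, u <= s, measurable B & A = X u @^-1` B]] >> `<=`
    (@measurable _ Omega) by apply.
apply: smallest_sub; first exact: sigma_algebra_measurable.
by move=> _ [u [B [_ _ mB ->]]]; rewrite -[X in measurable X]setTI;
  exact: measurable_time.
Qed.

Lemma measurable_past_le s t : s <= t ->
  measurable_fun setT (id : past t -> past s).
Proof.
move=> st _ A mA; rewrite setTI preimage_id.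
suff : <<s [set A | exists u B,
    [/\ 0 <= u, u <= s, measurable B & A = X u @^-1` B]] >> `<=`
    (@measurable _ (past t)) by apply.
apply: smallest_sub; first exact: sigma_algebra_measurable.
move=> _ [u [B [u0 us mB ->]]]; apply: sub_sigma_algebra.
by exists u, B; split => //; exact: le_trans st.
Qed.

Lemma measurable_past_time s t : 0 <= t -> t <= s ->
  measurable_fun setT (X t : past s -> E).
Proof.
by move=> t0 ts _ B mB; rewrite setTI; apply: sub_sigma_algebra; exists t, B.
Qed.

Lemma bdm_past s (Y : past s -> R) B : bdm Y B -> bdm (Y : Omega -> R) B.
Proof. by move=> bY; exact: (bdm_comp (@measurable_past_id s) bY). Qed.

Lemma bdm_past_le s t (Y : past s -> R) B : s <= t ->
  bdm Y B -> bdm (Y : past t -> R) B.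
Proof. by move=> st bY; exact: (bdm_comp (measurable_past_le st) bY). Qed.

(** This says that the conditional expectation of [D] given the past of [s] vanishes. *)
Definition orth (Q : probability Omega R) (s : R) (D : Omega -> R) :=
  forall (Y : past s -> R) B, bdm Y B -> \int[Q]_w (Y w * D w) = 0.

(** The Markov property gives the joint law of the past and of [X (s + u)] on rectangles;
    disintegration extends it to functions of the pair. *)
Lemma markov_past (Q : probability Omega R) s u (f : past s * E -> R) B :
  markov_property X p Q -> 0 <= s -> 0 <= u -> bdm f B ->
  \int[Q]_w f (w, X (s + u) w) = \int[Q]_w \int[p u (X s w)]_y f (w, y).
Proof.
move=> QM s0 u0 bf.
pose mid := isMeasurableFun.Build _ _ _ _ _ (@measurable_past_id s).
pose idp : {mfun Omega >-> past s} := MeasurableFun.Pack (MeasurableFun.Class mid).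
have mgr : measurable_fun setT (fun w : Omega => (idp w, X (s + u) w)).
  exact: (measurable_fun_pair (@measurable_past_id s) (@measurable_time (s + u))).
pose mgr' := isMeasurableFun.Build _ _ _ _ _ mgr.
pose gr : {mfun Omega >-> (past s * E)%type} :=
  MeasurableFun.Pack (MeasurableFun.Class mgr').
have mXs := measurable_past_time s0 (lexx s).
pose k := pull_kernel (p u) mXs.
have := @disintegration _ _ _ _ _ (distribution Q idp) k (distribution Q gr) f B bf.
rewrite !(bint_distribution _ _ (bf))//.
have bk := bdm_kernel k bf.
rewrite (bint_distribution Q idp bk) => -> // A C mA mC.
rewrite /distribution/= ge0_integral_pushforward//=; last 2 first.
- exact: measurable_past_id.
- exact/measurable_funTS/measurable_kernel.
by rewrite -(QM s u A C s0 u0 mA mC).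
Qed.

Lemma orth_markov (Q : probability Omega R) s u (f : past s * E -> R) B :
  markov_property X p Q -> 0 <= s -> 0 <= u -> bdm f B ->
  orth Q s (fun w => f (w, X (s + u) w) - \int[p u (X s w)]_y f (w, y)).
Proof.
move=> QM s0 u0 bf Y C bY.
have bYf : bdm (fun z : past s * E => Y z.1 * f z) (C * B).
  by apply: bdmM bf; apply: bdm_comp bY; exact: measurable_fst.
have mXs := measurable_past_time s0 (lexx s).
have bk := bdm_past (bdm_kernel (pull_kernel (p u) mXs) bf).
have bY' := bdm_past bY.
have bfX : bdm (fun w => f (w, X (s + u) w)) B.
  apply: (bdm_comp (h := fun w : Omega => (w : past s, X (s + u) w)) _ bf).
  exact: (measurable_fun_pair (@measurable_past_id s) (@measurable_time (s + u))).
under eq_Rintegral do rewrite mulrBr.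
rewrite (bintB measurableT (prob_fin Q) (bdmM bY' bfX) (bdmM bY' bk)).
rewrite (markov_past QM s0 u0 bYf).
apply/eqP; rewrite subr_eq0; apply/eqP.
apply: eq_Rintegral => w _.
have kfin : (p u (X s w) setT < +oo)%E by rewrite prob_kernel ltry.
exact: (bintZ measurableT kfin (Y w) (bdm_pair1 (w : past s) bf)).
Qed.

Lemma law_markov x : markov_property X p (law x).
Proof. exact: family_markov. Qed.

Lemma law_start (f : E -> R) B x : bdm f B -> \int[law x]_w f (X 0 w) = f x.
Proof.
move=> bf.
pose mX := isMeasurableFun.Build _ _ _ _ _ (measurable_time 0).
pose X0 : {mfun Omega >-> E} := MeasurableFun.Pack (MeasurableFun.Class mX).
rewrite -(bint_distribution (law x) X0 bf).
rewrite /Rintegral (eq_measure_integral \d_x); last first.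
  by move=> A mA _; exact: family_start.
rewrite integral_dirac// ?diracT ?mul1e//.
by apply/measurable_EFinP; case: bf.
Qed.

Lemma law_time (f : E -> R) B x u : 0 <= u -> bdm f B ->
  \int[law x]_w f (X u w) = \int[p u x]_y f y.
Proof.
move=> u0 bf.
have bf2 : bdm (fun z : past 0 * E => f z.2) B.
  by apply: bdm_comp bf; exact: measurable_snd.
have bf3 : bdm (fun z : E * E => f z.2) B.
  by apply: bdm_comp bf; exact: measurable_snd.
have := @markov_past (law x) 0 u _ B (family_markov mfam x) (lexx 0) u0 bf2.
by rewrite add0r => ->; rewrite (law_start x (bdm_kernel (p u) bf3)).
Qed.

End markov.

(** * Replacing an exponential by a product of factors close to 1 *)

Section exp_approx.
Context (R : realType).
Implicit Types a x y eta : R.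

(** The inequality [1 + x <= expR x] at [- a] gives [expR a <= (1 - a)^-1], and
    [(1 - a)^-1 - (1 + a) = a ^+ 2 / (1 - a)], where [1 - a] is at least one half. *)
Lemma expR_sub1D a eta : `|a| <= eta -> eta <= 2^-1 ->
  `|expR a - (1 + a)| <= 2 * eta ^+ 2.
Proof.
move=> ae e2.
have a2 : `|a| <= 2^-1 by exact: le_trans e2.
have [l1 l2] : - 2^-1 <= a /\ a <= 2^-1 by apply/andP; rewrite -ler_norml.
have h1 : 1 + a <= expR a by exact: expR_ge1Dx.
have h2 : 1 - a <= (expR a)^-1 by rewrite -expRN; exact: expR_ge1Dx.
have ea := expR_gt0 a.
have h3 : (1 - a) * expR a <= 1.
  by have := ler_wpM2r (ltW ea) h2; rewrite mulVf// gt_eqF.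
have aa : a ^+ 2 <= eta ^+ 2.
  by rewrite -(real_normK (num_real a)) ler_sqr// ?nnegrE// (le_trans _ ae).
rewrite ger0_norm ?subr_ge0//.
suff : expR a - (1 + a) <= 2 * a ^+ 2 by nra.
nra.
Qed.

Lemma exp_approx_step a x y eta : `|a| <= eta -> eta <= 2^-1 ->
  `|expR a * x - (1 + a) * y| <= 2 * eta ^+ 2 * `|x| + expR eta * `|x - y|.
Proof.
move=> ae e2.
have -> : expR a * x - (1 + a) * y = (expR a - (1 + a)) * x + (1 + a) * (x - y).
  by ring.
apply: (le_trans (ler_normD _ _)); rewrite !normrM; apply: lerD.
  by rewrite ler_wpM2r// expR_sub1D.
rewrite ler_wpM2r//.
have : `|a| <= 2^-1 by exact: le_trans e2.
rewrite ler_norml => /andP[h1 h2].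
rewrite ger0_norm; last lra.
apply: (le_trans (expR_ge1Dx _)); rewrite ler_expR.
exact: le_trans (ler_norm _) ae.
Qed.

Lemma exp_approx_pow a eta n : `|a| <= eta -> eta <= 2^-1 ->
  `|expR (a *+ n) - (1 + a) ^+ n| <= expR (eta *+ n) * (2 * eta ^+ 2) *+ n.
Proof.
move=> ae e2; have e0 : 0 <= eta by rewrite (le_trans _ ae).
elim: n => [|n IH]; first by rewrite !mulr0n expR0 expr0 subrr normr0.
rewrite mulrS expRD exprS.
apply: (le_trans (exp_approx_step _ _ ae e2)).
rewrite [X in _ <= X]mulrS; apply: lerD.
  rewrite mulrC ler_wpM2r ?mulr_ge0// ?sqr_ge0//.
  rewrite ger0_norm ?expR_ge0// ler_expR [eta *+ n.+1]mulrS.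
  have : a *+ n <= eta *+ n by rewrite lerMn2r (le_trans (ler_norm _) ae) orbT.
  by move/le_trans; apply; rewrite lerDr.
rewrite (le_trans (ler_wpM2l (expR_ge0 _) IH))//.
by rewrite [eta *+ n.+1]mulrS expRD -[X in _ * X <= _]mulr_natr -[leRHS]mulr_natr !mulrA.
Qed.

(* With step [c / n] the accumulated error is of order [1 / n]. *)
Lemma exp_error_small (B c eps : R) : 0 <= B -> 0 <= c -> 0 < eps ->
  exists n, [/\ (0 < n)%N, c / n%:R <= 2^-1 &
    B * (expR (c / n%:R *+ n) * (2 * (c / n%:R) ^+ 2) *+ n) <= eps].
Proof.
move=> B0 c0 e0.
pose K := B * expR c * 2 * c ^+ 2.
have K0 : 0 <= K by rewrite !mulr_ge0// ?expR_ge0// sqr_ge0.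
pose n := (Num.bound (2 * c + K / eps)).+1.
have n0 : 0 < n%:R :> R by rewrite ltr0n.
have nb : 2 * c + K / eps <= n%:R.
  have : 0 <= 2 * c + K / eps by apply: addr_ge0; [rewrite mulr_ge0|rewrite divr_ge0// ltW].
  move=> /archi_boundP /ltW /le_trans; apply.
  by rewrite ler_nat.
exists n; split=> //.
  rewrite ler_pdivrMr// mulrC ler_pdivlMr// mulrC (le_trans _ nb)// lerDl.
  by rewrite divr_ge0// ltW.
rewrite -[X in expR X]mulr_natr divfK ?gt_eqF//.
rewrite -mulr_natr.
have -> : B * (expR c * (2 * (c / n%:R) ^+ 2) * n%:R) = K / n%:R.
  by rewrite /K; field; rewrite gt_eqF.
rewrite ler_pdivrMr// mulrC -ler_pdivrMr// (le_trans _ nb)// lerDr.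
by rewrite mulr_ge0.
Qed.

End exp_approx.

(** * Variables orthogonal to the past *)

Section orth.
Context (R : realType) (dO dE : measure_display).
Context (Omega : measurableType dO) (E : measurableType dE).
Variables (X : R -> Omega -> E) (p : R -> R.-pker E ~> E).
Variable Px : R.-pker E ~> Omega.
Hypothesis mfam : markov_family X p Px.
Variables (Q : probability Omega R) (s : R).
Implicit Types (D : Omega -> R).

Notation orth := (orth X Q s).

Lemma orthD D1 D2 B1 B2 : bdm D1 B1 -> bdm D2 B2 -> orth D1 -> orth D2 ->
  orth (fun w => D1 w + D2 w).
Proof.
move=> b1 b2 o1 o2 Y B bY; have bY' := bdm_past mfam bY.
under eq_Rintegral do rewrite mulrDr.
rewrite (bintD measurableT (prob_fin Q) (bdmM bY' b1) (bdmM bY' b2)).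
by rewrite (o1 _ _ bY) (o2 _ _ bY) addr0.
Qed.

Lemma orthZ D B1 c : bdm D B1 -> orth D -> orth (fun w => c * D w).
Proof.
move=> b1 o1 Y B bY; have bY' := bdm_past mfam bY.
under eq_Rintegral do rewrite mulrCA.
by rewrite (bintZ measurableT (prob_fin Q) _ (bdmM bY' b1)) (o1 _ _ bY) mulr0.
Qed.

Lemma orth_unif D B : bdm D B ->
  (forall eps, 0 < eps -> exists D' C, [/\ bdm D' C, orth D' &
    forall w, `|D w - D' w| <= eps]) -> orth D.
Proof.
move=> bD lim Y C bY; have bY' := bdm_past mfam bY.
apply/normr0_eq0/eqP; rewrite eq_le normr_ge0 andbT.
apply/ler_addgt0Pr => e e0; rewrite add0r.
have C0 : 0 < `|C| + 1 by rewrite ltr_pwDr.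
have [D' [B' [bD' oD' DD']]] := lim (e / (`|C| + 1)) (divr_gt0 e0 C0).
have -> : \int[Q]_w (Y w * D w) = \int[Q]_w (Y w * (D w - D' w)).
  under [RHS]eq_Rintegral do rewrite mulrBr.
  rewrite (bintB measurableT (prob_fin Q) (bdmM bY' bD) (bdmM bY' bD')).
  by rewrite (oD' _ _ bY) subr0.
have := bint_le_cst (C := e) measurableT (prob_fin Q) (bdmM bY' (bdmB bD bD')).
rewrite /= probability_setT mulr1; apply => w _.
rewrite normrM (@le_trans _ _ ((`|C| + 1) * (e / (`|C| + 1))))//; last first.
  by rewrite mulrC divfK// gt_eqF.
apply: ler_pM => //; case: bY => _ /(_ w) /le_trans; apply.
by rewrite (le_trans (ler_norm C))// lerDl.
Qed.

Variables (G : measurableTypeR R * Omega -> R) (BG : R) (T : R).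
Hypotheses (bG : bdm G BG) (T0 : 0 <= T).
Hypothesis pG : forall t, 0 <= t <= T -> bdm (fun w : past X s => G (t, w)) BG.

Notation A := (fun w => tint T (fun t => G (t, w))).

Lemma orth_tint D B : bdm D B -> orth D -> orth (fun w => A w * D w).
Proof.
move=> bD oD Y C bY; have bY' := bdm_past mfam bY.
have bY2 : bdm (fun z : measurableTypeR R * Omega => Y z.2) C.
  by apply: bdm_comp bY'; exact: measurable_snd.
have bD2 : bdm (fun z : measurableTypeR R * Omega => D z.2) B.
  by apply: bdm_comp bD; exact: measurable_snd.
transitivity (\int[Q]_w tint T (fun t => (Y w * D w) * G (t, w))).
  apply: eq_Rintegral => w _.
  by rewrite (tintZ _ _ (bdm_pair2 w bG)) mulrCA mulrC.
rewrite (tint_fubini Q T (bdmM (bdmM bY2 bD2) bG))/=.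
rewrite (@eq_tint _ _ (fun=> 0)); last first.
  move=> t t0T; under eq_Rintegral do rewrite mulrAC.
  exact: oD (bdmM bY (pG t0T)).
by rewrite tint_cst// mul0r.
Qed.

(* Multiplying by [A] preserves orthogonality by Fubini, since [G (t, .)] depends
   on the past only; hence so does the limit of the [(1 + A / n) ^+ n]. *)
Lemma orth_exp D B : bdm D B -> orth D -> orth (fun w => expR (A w) * D w).
Proof.
move=> bD oD; have bA := bdm_tint T0 bG.
(* On an empty [Omega] all integrals vanish; otherwise a point yields the nonnegativity of the
   bounds, needed to choose [n]. *)
have [w0|noO] := pselect (exists w0 : Omega, True); last first.
  move=> Y C bY; rewrite /Rintegral integral0_eq// => w _.
  by exfalso; apply: noO; exists w.
have {w0} [w0 _] := w0.
have B0 := bdm_ge0 w0 bD.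
have BT0 := bdm_ge0 w0 bA.
apply: (orth_unif (bdmM (bdm_exp bA) bD)) => e e0.
have [n [n0 h1 h2]] := exp_error_small B0 BT0 e0.
have n0' : (n%:R : R) != 0 by rewrite pnatr_eq0 -lt0n.
pose a w := n%:R^-1 * A w.
have ba : bdm a (`|n%:R^-1| * (BG * T)) by exact: bdmZ.
have bP k : bdm (fun w => (1 + a w) ^+ k * D w) ((`|1| + `|n%:R^-1| * (BG * T)) ^+ k * B).
  by apply: bdmM bD; apply/bdmX/bdmD => //; exact: bdm_cst.
exists (fun w => (1 + a w) ^+ n * D w), ((`|1| + `|n%:R^-1| * (BG * T)) ^+ n * B).
split=> //.
  elim: (n in X in orth X) => [|k IH].
    by rewrite (_ : (fun w => _) = D)//; apply/funext => w; rewrite expr0 mul1r.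
  rewrite (_ : (fun w => _) = fun w => (1 + a w) ^+ k * D w
      + n%:R^-1 * (A w * ((1 + a w) ^+ k * D w))); last first.
    by apply/funext => w; rewrite exprS/a; ring.
  have oA := orth_tint (bP k) IH.
  have bAP := bdmM bA (bP k).
  apply: (orthD (bP k) (bdmZ _ bAP)) => //.
  exact: orthZ bAP oA.
move=> w; rewrite -mulrBl normrM.
have aw : `|a w| <= BG * T / n%:R.
  rewrite /a normrM [leRHS]mulrC [X in X * _]ger0_norm ?invr_ge0//.
  by rewrite ler_wpM2l ?invr_ge0//; case: bA.
have -> : A w = a w *+ n by rewrite /a -mulr_natr mulrAC mulVf// mul1r.
rewrite (le_trans _ h2)// mulrC; apply: ler_pM => //; first by case: bD.
exact: exp_approx_pow.
Qed.

End orth.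

(** * The Feynman-Kac semigroup *)

Section markovian_functionals.
Context (R : realType) (dO dE : measure_display).
Context (Omega : measurableType dO) (E : measurableType dE).
Variables (X : R -> Omega -> E) (p : R -> R.-pker E ~> E).
Variable Px : R.-pker E ~> Omega.
Hypothesis mfam : markov_family X p Px.
Implicit Types (Phi : R -> Omega -> R) (D : Omega -> R).
Notation T1 := (measurableTypeR R).

Definition mean D (x : E) : R := \int[law Px x]_w D w.

Lemma bdm_mean D B : bdm D B -> bdm (mean D) B.
Proof.
move=> bD; apply: (bdm_kernel Px (f := fun z => D z.2)).
by apply: bdm_comp bD; exact: measurable_snd.
Qed.

Lemma bdm_time (f : E -> R) B t : bdm f B -> bdm (fun w => f (X t w)) B.
Proof. by move=> bf; apply: bdm_comp bf; exact: (measurable_time mfam). Qed.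

Lemma measurable_process d (T : measurableType d) (h : T -> R) (g : T -> Omega) :
  measurable_fun setT (h : T -> T1) -> measurable_fun setT g ->
  measurable_fun setT (fun z => X (h z) (g z)).
Proof.
move=> mh mg.
exact: (measurableT_comp (family_measurable mfam) (measurable_fun_pair mh mg)).
Qed.

(* A functional [Phi s] of the path after time [s] is [markovian] when its
   conditional expectation given the past of [s] is the mean of [Phi 0] for the
   process started at [X s]. *)
Record markovian Phi B : Prop := {
  markovian_bdm : forall s, bdm (Phi s) B;
  markovian_orth : forall (Q : probability Omega R) s, markov_property X p Q ->
    0 <= s -> orth X Q s (fun w => Phi s w - mean (Phi 0) (X s w)) }.

Lemma markovian_eq Phi B (Q : probability Omega R) s (Y : past X s -> R) C :
  markovian Phi B -> markov_property X p Q -> 0 <= s -> bdm Y C ->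
  \int[Q]_w (Y w * Phi s w) = \int[Q]_w (Y w * mean (Phi 0) (X s w)).
Proof.
move=> [bPhi oPhi] QM s0 bY; have := oPhi Q s QM s0 Y C bY.
have bY' := bdm_past mfam bY.
under eq_Rintegral do rewrite mulrBr.
rewrite (bintB measurableT (prob_fin Q) (bdmM bY' (bPhi s))
  (bdmM bY' (bdm_time s (bdm_mean (bPhi 0))))).
by move/eqP; rewrite subr_eq0 => /eqP.
Qed.

Lemma markovian_orth_of_eq Phi B : (forall s, bdm (Phi s) B) ->
  (forall (Q : probability Omega R) s (Y : past X s -> R) C,
    markov_property X p Q -> 0 <= s -> bdm Y C ->
    \int[Q]_w (Y w * Phi s w) = \int[Q]_w (Y w * mean (Phi 0) (X s w))) ->
  markovian Phi B.
Proof.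
move=> bPhi ePhi; split=> // Q s QM s0 Y C bY.
have bY' := bdm_past mfam bY.
under eq_Rintegral do rewrite mulrBr.
rewrite (bintB measurableT (prob_fin Q) (bdmM bY' (bPhi s))
  (bdmM bY' (bdm_time s (bdm_mean (bPhi 0))))).
by rewrite (ePhi _ _ _ _ QM s0 bY) subrr.
Qed.

Lemma markovian_time (f : E -> R) B u : bdm f B -> 0 <= u ->
  markovian (fun s w => f (X (s + u) w)) B.
Proof.
move=> bf u0; split=> [s|Q s QM s0]; first exact: bdm_time.
have bf2 : bdm (fun z : past X s * E => f z.2) B.
  by apply: bdm_comp bf; exact: measurable_snd.
rewrite (_ : (fun w => _) = fun w =>
  f (X (s + u) w) - \int[p u (X s w)]_y f y).
  exact: (orth_markov mfam QM s0 u0 bf2).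
by apply/funext => w; rewrite /mean add0r (law_time mfam _ u0 bf).
Qed.

(** The tower property: condition at [s + u], where [g (X (s + u))] is part of the past, then at
    [s]. The mean of the result is identified by the Markov property under the law started at
    [X s w]. *)
Lemma markovian_shift Phi B (g : E -> R) C u : markovian Phi B -> bdm g C ->
  0 <= u -> markovian (fun s w => g (X (s + u) w) * Phi (s + u) w) (C * B).
Proof.
move=> gPhi bg u0; have [bPhi _] := gPhi.
have bgm : bdm (fun x => g x * mean (Phi 0) x) (C * B).
  by apply: bdmM => //; exact: bdm_mean.
apply: markovian_orth_of_eq => [s|Q s Y B' QM s0 bY].
  by apply: bdmM => //; exact: bdm_time.
have su0 : 0 <= s + u by exact: addr_ge0.
have ssu : s <= s + u by rewrite lerDl.
have bYg : bdm (fun w : past X (s + u) => Y w * g (X (s + u) w)) (B' * C).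
  apply: bdmM; first exact: bdm_past_le bY.
  by apply: bdm_comp bg; exact: measurable_past_time.
under eq_Rintegral do rewrite mulrA.
rewrite (markovian_eq gPhi QM su0 bYg).
under eq_Rintegral do rewrite -mulrA.
rewrite (markovian_eq (markovian_time bgm u0) QM s0 bY).
apply: eq_Rintegral => w _; congr (_ * _); rewrite /mean !add0r.
have bg0 : bdm (fun w : past X u => g (X u w)) C.
  by apply: bdm_comp bg; exact: measurable_past_time.
by rewrite (markovian_eq gPhi (law_markov mfam (X s w)) u0 bg0).
Qed.

Lemma markovianD Phi Psi B C : markovian Phi B -> markovian Psi C ->
  markovian (fun s w => Phi s w + Psi s w) (B + C).
Proof.
move=> gPhi gPsi; have [bPhi _] := gPhi; have [bPsi _] := gPsi.
apply: markovian_orth_of_eq => [s|Q s Y B' QM s0 bY]; first exact: bdmD.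
have bY' := bdm_past mfam bY.
under eq_Rintegral do rewrite mulrDr.
rewrite (bintD measurableT (prob_fin Q) (bdmM bY' (bPhi s)) (bdmM bY' (bPsi s))).
rewrite (markovian_eq gPhi QM s0 bY) (markovian_eq gPsi QM s0 bY).
rewrite -(bintD measurableT (prob_fin Q)
  (bdmM bY' (bdm_time s (bdm_mean (bPhi 0))))
  (bdmM bY' (bdm_time s (bdm_mean (bPsi 0))))).
apply: eq_Rintegral => w _; rewrite -mulrDr; congr (_ * _).
by rewrite /mean (bintD measurableT (prob_fin _) (bPhi 0) (bPsi 0)).
Qed.

Lemma markovian_tint (Phi : R -> R -> Omega -> R) B del : 0 <= del ->
  (forall s, bdm (fun z : T1 * Omega => Phi z.1 s z.2) B) ->
  (forall r, 0 <= r <= del -> markovian (Phi r) B) ->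
  markovian (fun s w => tint del (fun r => Phi r s w)) (B * del).
Proof.
move=> d0 bPhi gPhi.
have bE : bdm (fun z : T1 * E => mean (Phi z.1 0) z.2) B.
  apply: (bdm_kernel (pull_kernel Px (@measurable_snd _ _ T1 E))
    (f := fun z => Phi z.1.1 0 z.2)).
  apply: (bdm_comp (h := fun z : T1 * E * Omega => (z.1.1, z.2)) _ (bPhi 0)).
  apply: measurable_fun_pair => //.
  exact: (measurableT_comp (@measurable_fst _ _ _ _) (@measurable_fst _ _ _ _)).
apply: markovian_orth_of_eq => [s|Q s Y B' QM s0 bY].
  exact: (bdm_tint d0 (bPhi s)).
have bY' := bdm_past mfam bY.
have bY2 : bdm (fun z : T1 * Omega => Y z.2) B'.
  by apply: bdm_comp bY'; exact: measurable_snd.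
have bEX : bdm (fun z : T1 * Omega => mean (Phi z.1 0) (X s z.2)) B.
  apply: (bdm_comp (h := fun z : T1 * Omega => (z.1, X s z.2)) _ bE).
  apply: measurable_fun_pair => //.
  by apply: measurable_process => //; exact: measurable_cst.
under eq_Rintegral => w _.
  rewrite -(tintZ _ _ (bdm_pair2 w (bPhi s))) /=; over.
rewrite (tint_fubini Q del (bdmM bY2 (bPhi s)))/=.
transitivity (tint del (fun r => \int[Q]_w (Y w * mean (Phi r 0) (X s w)))).
  by apply: eq_tint => r r0; rewrite (markovian_eq (gPhi r r0) QM s0 bY).
rewrite -(tint_fubini Q del (bdmM bY2 bEX))/=.
apply: eq_Rintegral => w _.
rewrite (tintZ _ _ (bdm_pair2 w bEX)); congr (_ * _).
by rewrite /mean (tint_fubini (law Px (X s w)) del (bPhi 0)).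
Qed.

Lemma markovian_unif Phi B : (forall s, bdm (Phi s) B) ->
  (forall eps, 0 < eps -> exists Psi C, markovian Psi C /\
    forall s w, `|Phi s w - Psi s w| <= eps) -> markovian Phi B.
Proof.
move=> bPhi lim; split=> // Q s QM s0.
have bm t := bdm_time t (bdm_mean (bPhi 0)).
apply: (orth_unif mfam (bdmB (bPhi s) (bm s))) => e e0.
have e2 : 0 < e / 2 by rewrite divr_gt0.
have [Psi [C [gPsi close]]] := lim _ e2.
have [bPsi oPsi] := gPsi.
exists (fun w => Psi s w - mean (Psi 0) (X s w)), (C + C); split.
- by apply: bdmB => //; exact: bdm_time (bdm_mean (bPsi 0)).
- exact: oPsi.
move=> w; set x := X s w.
have -> : Phi s w - mean (Phi 0) x - (Psi s w - mean (Psi 0) x) =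
  (Phi s w - Psi s w) - (mean (Phi 0) x - mean (Psi 0) x) by ring.
rewrite (le_trans (ler_normB _ _))// [leRHS](splitr e) lerD//.
rewrite /mean -(bintB measurableT (prob_fin _) (bPhi 0) (bPsi 0)).
have := bint_le_cst (C := e / 2) measurableT (prob_fin (law Px x))
  (bdmB (bPhi 0) (bPsi 0)).
by rewrite /= probability_setT mulr1; apply.
Qed.

End markovian_functionals.

Section feynman_kac.
Context (R : realType) (dO dE : measure_display).
Context (Omega : measurableType dO) (E : measurableType dE).
Variables (X : R -> Omega -> E) (p : R -> R.-pker E ~> E).
Variable Px : R.-pker E ~> Omega.
Hypothesis mfam : markov_family X p Px.
Variables (alpha : R) (alpha0 : 0 <= alpha).
Notation T1 := (measurableTypeR R).
Implicit Types (f g : E -> R).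

Definition additive g s t w : R := tint t (fun r => g (X (s + alpha * r) w)).

Lemma bdm_rate g C s :
  bdm g C -> bdm (fun z : T1 * Omega => g (X (s + alpha * z.1) z.2)) C.
Proof.
move=> bg; apply: bdm_comp bg; apply: (measurable_process mfam) => //.
by apply: measurable_funD => //; apply: measurable_funM.
Qed.

Lemma bdm_additive g C s t : 0 <= t -> bdm g C ->
  bdm (additive g s t) (C * t).
Proof. by move=> t0 bg; exact: (bdm_tint t0 (bdm_rate s bg)). Qed.

Lemma additiveD g C s t u w : bdm g C -> 0 <= t -> 0 <= u ->
  additive g s (t + u) w = additive g s t w + additive g (s + alpha * t) u w.
Proof.
move=> bg t0 u0; rewrite /additive (tint_split (bdm_pair2 w (bdm_rate s bg)))//=.
by congr (_ + _); apply: eq_tint => r _; rewrite mulrDr addrA.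
Qed.

Definition fk g t f s w : R := expR (additive g s t w) * f (X (s + alpha * t) w).

Lemma bdm_fk g C t f B s : 0 <= t -> bdm g C -> bdm f B ->
  bdm (fk g t f s) (expR (C * t) * B).
Proof.
move=> t0 bg bf; apply: bdmM; last exact: (bdm_time mfam).
exact/bdm_exp/bdm_additive.
Qed.

(** On each of [n] blocks the exponential of the integral is replaced by 1 plus the integral. The
    product involves only values of the path and time integrals, for which [markovian] is known to
    be stable. *)
Fixpoint fk_approx g del f n s w : R :=
  if n is n'.+1 then
    (1 + additive g s del w) * fk_approx g del f n' (s + alpha * del) w
  else f (X s w).

Let markovian_fk_approx g C del f B n : bdm g C -> bdm f B -> 0 <= del ->
  markovian X p Px (fk_approx g del f n) ((1 + C * del) ^+ n * B).
Proof.
move=> bg bf d0; have ad0 : 0 <= alpha * del by exact: mulr_ge0.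
elim: n => [|n IH] /=.
  rewrite expr0 mul1r; have := markovian_time mfam bf (lexx 0).
  by under eq_fun do under eq_fun do rewrite addr0.
have b1 : bdm (fun _ : E => 1) (1 : R) by exact: bdm1.
have [bA _] := IH.
set B' := (1 + C * del) ^+ n * B.
rewrite (_ : _ * B = 1 * B' + (C * B') * del); last first.
  by rewrite /B' exprS; ring.
rewrite (_ : (fun s w => _) = fun s w => 1 * fk_approx g del f n (s + alpha * del) w
  + tint del (fun r => g (X (s + alpha * r) w) *
      fk_approx g del f n (s + alpha * del) w)); last first.
  apply/funext => s; apply/funext => w.
  rewrite mulrDl; congr (_ + _).
  rewrite /additive mulrC -(tintZ _ _ (bdm_pair2 w (bdm_rate s bg))).
  by apply: eq_tint => r _; rewrite mulrC.
apply: (markovianD mfam); first exact: (markovian_shift mfam IH b1 ad0).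
apply: (markovian_tint mfam d0) => [s|r /andP[r0 rd]].
  apply: bdmM; first exact: bdm_rate.
  by apply: bdm_comp (bA _); exact: measurable_snd.
(* The integrand at [r] is read as two successive shifts: by [alpha * r] to the time where [g] is
   evaluated, then by [alpha * (del - r)] to the end of the block. *)
have dr0 : 0 <= alpha * (del - r) by rewrite mulr_ge0// subr_ge0.
have ar0 : 0 <= alpha * r by exact: mulr_ge0.
have := markovian_shift mfam (markovian_shift mfam IH b1 dr0) bg ar0.
rewrite mul1r (_ : (fun s w => _) = fun s w =>
  g (X (s + alpha * r) w) * fk_approx g del f n (s + alpha * del) w)//.
apply/funext => s; apply/funext => w; rewrite mul1r; congr (_ * fk_approx _ _ _ _ _ _).
by rewrite -addrA -mulrDr addrC subrK || ring.
Qed.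

(** The error accumulates as in [exp_approx_pow], with a different increment on each block; the
    bound is uniform in the path and in [s], as [markovian_unif] requires. *)
Let fk_approxP g C del f B n s w : bdm g C -> bdm f B -> 0 <= del ->
  C * del <= 2^-1 ->
  `|fk g (del *+ n) f s w - fk_approx g del f n s w| <=
  B * (expR (C * del *+ n) * (2 * (C * del) ^+ 2) *+ n).
Proof.
move=> bg bf d0 Cd; elim: n s => [|n IH] s /=.
  rewrite /fk /additive !mulr0n mulr0 addr0 /tint set_itv1.
  by rewrite Rintegral_set1 expR0 mul1r subrr normr0 mulr0.
have n0 : 0 <= del *+ n by exact: mulrn_wge0.
rewrite /fk [del *+ n.+1]mulrS (additiveD _ _ bg d0 n0) expRD -mulrA.
rewrite -[X in f X]/(X _ w) [alpha * (_ + _)]mulrDr addrA.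
have aC : `|additive g s del w| <= C * del by case: (bdm_additive s d0 bg).
apply: (le_trans (exp_approx_step _ _ aC Cd)).
have e0 : 0 <= C * del by exact: le_trans aC.
have [_ bfk] := bdm_fk (s + alpha * del) n0 bg bf.
apply: (@le_trans _ _ (2 * (C * del) ^+ 2 * (expR (C * (del *+ n)) * B) +
  expR (C * del) * (B * (expR (C * del *+ n) * (2 * (C * del) ^+ 2) *+ n)))).
  apply: lerD; first by apply: ler_wpM2l; [rewrite mulr_ge0// sqr_ge0|exact: bfk].
  by rewrite ler_wpM2l ?expR_ge0//; exact: IH.
have B0 : 0 <= B by exact: (bdm_ge0 (X 0 w) bf).
rewrite [C * (del *+ n)]mulrnAr [C * del *+ n.+1]mulrS expRD.
set e := C * del; set x := expR (e *+ n); set y := expR e.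
rewrite -[x * _ *+ n]mulr_natr -[y * x * _ *+ n.+1]mulr_natr -natr1.
have y1 : 1 <= y by rewrite -expR0 ler_expR.
have x0 : 0 <= x by exact: expR_ge0.
rewrite [leLHS](_ : _ = B * (x * (2 * e ^+ 2)) * (1 + y * n%:R)); last by ring.
rewrite [leRHS](_ : _ = B * (x * (2 * e ^+ 2)) * (y + y * n%:R)); last by ring.
apply: ler_wpM2l; last by rewrite lerD2r.
  by rewrite mulr_ge0// mulr_ge0// mulr_ge0// sqr_ge0.
Qed.

Lemma markovian_fk g C t f B : bdm g C -> bdm f B -> 0 <= t ->
  markovian X p Px (fk g t f) (expR (C * t) * B).
Proof.
move=> bg bf t0; apply: (markovian_unif mfam) => [s|e e0]; first exact: bdm_fk.
have [[w0 _]|noO] := pselect (exists w0 : Omega, True); last first.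
  exists (fk_approx g 0 f 0), ((1 + C * 0) ^+ 0 * B); split.
    exact: markovian_fk_approx.
  by move=> s w; exfalso; apply: noO; exists w.
have B0 := bdm_ge0 (X 0 w0) bf; have C0 := bdm_ge0 (X 0 w0) bg.
have [n [n0 h1 h2]] := exp_error_small B0 (mulr_ge0 C0 t0) e0.
have d0 : 0 <= t / n%:R by exact: divr_ge0.
exists (fk_approx g (t / n%:R) f n), ((1 + C * (t / n%:R)) ^+ n * B); split.
  exact: markovian_fk_approx.
move=> s w; rewrite (le_trans _ h2)//.
have := @fk_approxP _ _ (t / n%:R) _ _ n s w bg bf d0.
rewrite (mulrA C t) => /(_ h1); rewrite -[t / n%:R *+ n]mulr_natr divfK//.
by rewrite pnatr_eq0 -lt0n.
Qed.

Definition fk_op g t f (x : E) : R := mean Px (fk g t f 0) x.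

Lemma bdm_fk_op g C t f B : 0 <= t -> bdm g C -> bdm f B ->
  bdm (fk_op g t f) (expR (C * t) * B).
Proof. by move=> t0 bg bf; apply: bdm_mean; exact: bdm_fk. Qed.

(** Conditioning at time 0. This transfers bounds uniform in the starting point to a Markov law with
    arbitrary initial distribution, such as [P]. *)
Lemma fk_op_start (Q : probability Omega R) g C t f B :
  markov_property X p Q -> 0 <= t -> bdm g C -> bdm f B ->
  \int[Q]_w fk g t f 0 w = \int[Q]_w fk_op g t f (X 0 w).
Proof.
move=> QM t0 bg bf.
have b1 : bdm (fun _ : past X 0 => 1 : R) `|1| by exact: bdm_cst.
have := markovian_eq mfam (markovian_fk bg bf t0) QM (lexx 0) b1.
by under eq_Rintegral do rewrite mul1r;
  under [in RHS]eq_Rintegral do rewrite mul1r.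
Qed.

(** The factor of the weight accumulated before [alpha * s] is the exponential of a time integral of
    past variables, so by [orth_exp] multiplying by it keeps the difference between the later
    functional and its conditional mean orthogonal to the past. *)
Lemma fk_opD g C s t f B x : bdm g C -> bdm f B -> 0 <= s -> 0 <= t ->
  fk_op g (s + t) f x = fk_op g s (fk_op g t f) x.
Proof.
move=> bg bf s0 t0; have as0 : 0 <= alpha * s by exact: mulr_ge0.
have gfk := markovian_fk bg bf t0; have [bfk ofk] := gfk.
have bop := bdm_fk_op t0 bg bf.
have o1 := ofk (law Px x) (alpha * s) (law_markov mfam x) as0.
have bG := bdm_rate 0 bg.
have pG r : 0 <= r <= s ->
    bdm (fun w : past X (alpha * s) => g (X (0 + alpha * r) w)) C.
  move=> /andP[r0 rs]; apply: bdm_comp bg; rewrite add0r.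
  by apply: measurable_past_time; [exact: mulr_ge0|exact: ler_wpM2l].
have := orth_exp mfam bG s0 pG (bdmB (bfk _) (bdm_time mfam _ bop)) o1.
have b1 : bdm (fun _ : past X (alpha * s) => 1 : R) `|1| by exact: bdm_cst.
move=> /(_ _ _ b1).
under eq_Rintegral do rewrite mul1r mulrBr.
have bA := bdm_exp (bdm_additive 0 s0 bg).
rewrite (bintB measurableT (prob_fin _) (bdmM bA (bfk _))
  (bdmM bA (bdm_time mfam (alpha * s) bop))) => /eqP; rewrite subr_eq0 => /eqP e.
rewrite /fk_op /mean; transitivity (\int[law Px x]_w
    (expR (additive g 0 s w) * fk g t f (alpha * s) w)).
  apply: eq_Rintegral => w _.
  by rewrite /fk (additiveD _ _ bg s0 t0) expRD mulrDr addrA add0r mulrA.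
rewrite e; apply: eq_Rintegral => w _.
by rewrite /fk add0r.
Qed.

End feynman_kac.

(** * Positive operators with a Doeblin bound *)

Definition bm (R : realType) d (T : measurableType d) (f : T -> R) :=
  exists B, bdm f B.

Section bm.
Context (R : realType) d (T : measurableType d).
Implicit Types (f g : T -> R).

Lemma bm_cst (c : R) : bm (fun _ : T => c).
Proof. by exists `|c|; exact: bdm_cst. Qed.

Lemma bmD f g : bm f -> bm g -> bm (fun x => f x + g x).
Proof. by move=> [B bf] [C bg]; exists (B + C); exact: bdmD. Qed.

Lemma bmB f g : bm f -> bm g -> bm (fun x => f x - g x).
Proof. by move=> [B bf] [C bg]; exists (B + C); exact: bdmB. Qed.

Lemma bmZ c f : bm f -> bm (fun x => c * f x).
Proof. by move=> [B bf]; exists (`|c| * B); exact: bdmZ. Qed.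

End bm.
Arguments bm_cst {R d T} c.

Section geometric.
Context (R : realType).

(** Each [u n - C * kappa ^+ n] lies below each [u m + C * kappa ^+ m], so the supremum of the
    former separates the two families. *)
Lemma geometric_lim (u : nat -> R) C kappa : 0 <= C -> 0 <= kappa ->
  (forall n k, `|u (n + k)%N - u n| <= C * kappa ^+ n) ->
  exists l, forall n, `|u n - l| <= C * kappa ^+ n.
Proof.
move=> C0 k0 uC.
have Ck0 n : 0 <= C * kappa ^+ n by rewrite mulr_ge0// exprn_ge0.
have up n m : u n - C * kappa ^+ n <= u m + C * kappa ^+ m.
  have [nm|mn] := leqP n m.
    have := uC n (m - n)%N; rewrite subnKC// ler_norml => /andP[+ _].
    by have := Ck0 m; lra.
  have := uC m (n - m)%N; rewrite subnKC ?(ltnW mn)// ler_norml => /andP[_ +].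
  by have := Ck0 n; lra.
pose S := range (fun n => u n - C * kappa ^+ n).
have S0 : S !=set0 by exists (u 0%N - C * kappa ^+ 0), 0%N.
have ubS m : ubound S (u m + C * kappa ^+ m) by move=> _ [n _ <-].
exists (sup S) => n; rewrite ler_norml; apply/andP; split.
  have : sup S <= u n + C * kappa ^+ n by apply: ge_sup S0 _; exact: ubS.
  by lra.
have : u n - C * kappa ^+ n <= sup S.
  by apply: ub_le_sup; [exists (u 0%N + C * kappa ^+ 0); exact: ubS|exists n].
by lra.
Qed.

Lemma geometric_small (C kappa eps : R) : 0 <= kappa -> kappa < 1 -> 0 < eps ->
  exists n, C * kappa ^+ n <= eps.
Proof.
move=> k0 k1 e0.
have : geometric C kappa @ \oo --> (0 : R).
  by apply: cvg_geometric; rewrite ger0_norm.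
move=> /cvgrPdist_le /(_ eps e0) [N _ /(_ N (leqnn N))] /=.
rewrite sub0r normrN => h; exists N; exact: le_trans (ler_norm _) h.
Qed.

Lemma geometric_eq (x y C kappa : R) : 0 <= kappa -> kappa < 1 ->
  (forall n : nat, `|x - y| <= C * kappa ^+ n) -> x = y.
Proof.
move=> k0 k1 h; apply/eqP; rewrite -subr_eq0 -normr_eq0 eq_le normr_ge0 andbT.
apply/ler_addgt0Pr => e e0; rewrite add0r.
by have [n Cn] := geometric_small C k0 k1 e0; exact: le_trans (h n) Cn.
Qed.

End geometric.

Section doeblin_operator.
Context (R : realType) d (E : measurableType d) (mu : probability E R).
Implicit Types (f g : E -> R).

Notation m f := (\int[mu]_x f x).

Record positive_operator (K : (E -> R) -> E -> R) : Prop := {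
  pos_bm : forall f, bm f -> bm (K f);
  posD : forall f g x, bm f -> bm g -> K (fun y => f y + g y) x = K f x + K g x;
  posZ : forall c f x, bm f -> K (fun y => c * f y) x = c * K f x;
  pos_ge0 : forall f x, bm f -> (forall y, 0 <= f y) -> 0 <= K f x }.

Section positive.
Variable K : (E -> R) -> E -> R.
Hypothesis hK : positive_operator K.

Lemma posB f g x : bm f -> bm g -> K (fun y => f y - g y) x = K f x - K g x.
Proof.
move=> bf bg; have bg' := bmZ (-1) bg.
have -> : (fun y => f y - g y) = (fun y => f y + -1 * g y).
  by apply/funext => y; rewrite mulN1r.
by rewrite (posD hK)// (posZ hK)// mulN1r.
Qed.

Lemma pos_le f g x : bm f -> bm g -> (forall y, f y <= g y) -> K f x <= K g x.
Proof.
move=> bf bg fg; rewrite -subr_ge0 -(posB x bg bf).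
by apply: (pos_ge0 hK) => [|y]; [exact: bmB|rewrite subr_ge0].
Qed.

Lemma pos_iter n : positive_operator (iter n K).
Proof.
elim: n => [|n IH]; first by split.
split=> /=.
- by move=> f bf; apply: (pos_bm hK); exact: (pos_bm IH).
- move=> f g x bf bg; rewrite -(posD hK) //; [|exact: (pos_bm IH)..].
  by congr (K _ x); apply/funext => y; exact: (posD IH).
- move=> c f x bf; rewrite -(posZ hK); last exact: (pos_bm IH).
  by congr (K _ x); apply/funext => y; exact: (posZ IH).
- move=> f x bf f0; apply: (pos_ge0 hK); first exact: (pos_bm IH).
  by move=> y; exact: (pos_ge0 IH).
Qed.

Lemma pos_norm_le f g x : bm f -> bm g -> (forall y, `|f y| <= g y) ->
  `|K f x| <= K g x.
Proof.
move=> bf bg fg; rewrite ler_norml; apply/andP; split.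
  rewrite -mulN1r -(posZ hK)//; apply: pos_le => //; first exact: bmZ.
  by move=> y; rewrite mulN1r; have := fg y; rewrite ler_norml => /andP[].
by apply: pos_le => // y; exact: le_trans (ler_norm _) (fg y).
Qed.

(** A Collatz-Wielandt bound: by positivity [K phi <= r * phi] iterates, and constants are compared
    with [phi] through [d1] and [d2]. Together with the reverse bound it locates a growth rate from
    an approximate eigenfunction. *)
Lemma pos_test_le phi r d1 d2 n x : bm phi -> 0 <= r ->
  0 < d1 -> (forall y, d1 <= phi y <= d2) -> (forall y, K phi y <= r * phi y) ->
  iter n K (fun=> 1) x <= d2 / d1 * r ^+ n.
Proof.
move=> bphi r0 d10 dphi Kphi.
have it k y : iter k K phi y <= r ^+ k * phi y.
  elim: k y => [|k IH] y /=; first by rewrite expr0 mul1r.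
  have := pos_le y (pos_bm (pos_iter k) bphi) (bmZ (r ^+ k) bphi) IH.
  move/le_trans; apply; rewrite (posZ hK)// exprSr -mulrA.
  by rewrite ler_wpM2l// exprn_ge0.
rewrite mulrAC ler_pdivlMr//.
have : iter n K (fun=> d1) x <= iter n K phi x.
  have [IHb IHD IHZ IHp] := pos_iter n.
  rewrite -subr_ge0 (_ : _ - _ = iter n K (fun y => phi y - d1) x).
    by apply: IHp => [|y]; [exact/bmB/bm_cst|case/andP: (dphi y); rewrite subr_ge0].
  have b1 := bmZ (-1) (bm_cst (T := E) d1).
  rewrite (_ : (fun y => phi y - d1) = (fun y => phi y + -1 * d1)); last first.
    by apply/funext => y; rewrite mulN1r.
  by rewrite IHD// IHZ ?mulN1r//; exact: bm_cst.
have -> : iter n K (fun=> d1) x = iter n K (fun=> 1) x * d1.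
  rewrite mulrC -(posZ (pos_iter n))//; last exact: bm_cst.
  by congr (iter n K _ x); apply/funext => y; rewrite mulr1.
move/le_trans; apply; apply: (le_trans (it n x)).
by rewrite mulrC ler_wpM2r ?exprn_ge0//; case/andP: (dphi x).
Qed.

Lemma pos_test_ge phi r d1 d2 n x : bm phi -> 0 <= r ->
  0 < d1 -> (forall y, d1 <= phi y <= d2) -> (forall y, r * phi y <= K phi y) ->
  d1 / d2 * r ^+ n <= iter n K (fun=> 1) x.
Proof.
move=> bphi r0 d10 dphi Kphi.
have d20 : 0 < d2 by case/andP: (dphi x) => /(lt_le_trans d10) /lt_le_trans; exact.
have it k y : r ^+ k * phi y <= iter k K phi y.
  elim: k y => [|k IH] y /=; first by rewrite expr0 mul1r.
  have := pos_le y (bmZ (r ^+ k) bphi) (pos_bm (pos_iter k) bphi) IH.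
  apply/le_trans; rewrite (posZ hK)// exprSr -mulrA.
  by rewrite ler_wpM2l// exprn_ge0.
rewrite mulrAC ler_pdivrMr//.
have : iter n K phi x <= iter n K (fun=> d2) x.
  have [IHb IHD IHZ IHp] := pos_iter n.
  rewrite -subr_ge0 (_ : _ - _ = iter n K (fun y => d2 - phi y) x).
    by apply: IHp => [|y]; [exact/bmB/bphi/bm_cst|case/andP: (dphi y); rewrite subr_ge0].
  rewrite (_ : (fun y => d2 - phi y) = (fun y => d2 + -1 * phi y)); last first.
    by apply/funext => y; rewrite mulN1r.
  by rewrite IHD ?IHZ ?mulN1r//; [exact: bm_cst|exact: bmZ].
have -> : iter n K (fun=> d2) x = iter n K (fun=> 1) x * d2.
  rewrite mulrC -(posZ (pos_iter n))//; last exact: bm_cst.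
  by congr (iter n K _ x); apply/funext => y; rewrite mulr1.
apply/le_trans; apply: (le_trans _ (it n x)).
by rewrite mulrC ler_wpM2l ?exprn_ge0//; case/andP: (dphi x).
Qed.

Variable c : R.
Hypothesis c1 : 1 <= c.
Hypothesis doeblin_lower : forall f x, bm f -> (forall y, 0 <= f y) ->
  c^-1 * m f <= K f x.
Hypothesis doeblin_upper : forall f x, bm f -> (forall y, 0 <= f y) ->
  K f x <= c * m f.

Let c0 : 0 < c. Proof. exact: lt_le_trans c1. Qed.

(** One factor [c^-1] comes from the lower bound on [K] of a nonnegative function, the other from
    the upper bound on [K g]: each application of [K] removes the fraction [c^-1 ^+ 2] of the
    oscillation of a ratio. *)
Definition contraction_rate := 1 - c^-1 ^+ 2.
Local Notation kappa := contraction_rate.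

Lemma contraction_rate_ge0 : 0 <= kappa.
Proof. by rewrite subr_ge0 expr_le1 ?invr_ge0 ?invf_le1// ltW. Qed.

Lemma contraction_rate_lt1 : kappa < 1.
Proof. by rewrite ltrBlDr ltrDl exprn_gt0// invr_gt0. Qed.

Let mB f g : bm f -> bm g -> m (fun x => f x - g x) = m f - m g.
Proof. by move=> [B bf] [C bg]; exact: (bintB measurableT (prob_fin mu) bf bg). Qed.

Let mZ a f : bm f -> m (fun x => a * f x) = a * m f.
Proof. by move=> [B bf]; exact: (bintZ measurableT (prob_fin mu) a bf). Qed.

Let m_ge0 f : (forall y, 0 <= f y) -> 0 <= m f.
Proof. by move=> f0; apply: Rintegral_ge0. Qed.

Let m_le f g : bm f -> bm g -> (forall y, f y <= g y) -> m f <= m g.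
Proof.
by move=> [B bf] [C bg] fg; apply: (le_bint measurableT (prob_fin mu) bf bg).
Qed.

Let m_cst a : m (fun=> a) = a.
Proof. by rewrite Rintegral_cst//= probability_setT mulr1. Qed.

(* The lower Doeblin bound is applied to [f - a * g] and to [b * g - f]. *)
Lemma doeblin_ratio f g a b delta : bm f -> bm g -> 0 < delta ->
  (forall y, delta <= g y) -> (forall y, a * g y <= f y <= b * g y) ->
  exists a' b', [/\ a <= a', b' <= b, b' - a' = kappa * (b - a) &
    forall y, a' * K g y <= K f y <= b' * K g y].
Proof.
move=> bf bg del0 gdel fg.
have mg0 : 0 < m g.
  by rewrite (lt_le_trans del0)// -[leLHS]m_cst; apply: m_le => //; exact: bm_cst.
have g0 y : 0 <= g y by rewrite (le_trans (ltW del0)).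
(* The integrals of [f - a * g] and [b * g - f] are [t] and [b - a - t] times that of [g]. The gains
   at the two ends of the interval thus add up to a fixed fraction of [b - a], whatever [t] is. *)
pose t := (m f - a * m g) / m g.
have tE : t * m g = m f - a * m g by rewrite /t divfK// gt_eqF.
have bfa : bm (fun y => f y - a * g y) by apply: bmB => //; exact: bmZ.
have bfb : bm (fun y => b * g y - f y) by apply: bmB => //; exact: bmZ.
have fa0 y : 0 <= f y - a * g y by rewrite subr_ge0; case/andP: (fg y).
have fb0 y : 0 <= b * g y - f y by rewrite subr_ge0; case/andP: (fg y).
have mfa : m (fun y => f y - a * g y) = t * m g.
  by rewrite mB ?mZ//; exact: bmZ.
have mfb : m (fun y => b * g y - f y) = (b - a - t) * m g.
  by rewrite mB ?mZ ?mulrBl ?tE//; [ring|exact: bmZ].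
have t0 : 0 <= t by rewrite -(pmulr_lge0 _ mg0) -mfa; exact: m_ge0.
have t1 : 0 <= b - a - t by rewrite -(pmulr_lge0 _ mg0) -mfb; exact: m_ge0.
have th0 : 0 <= c^-1 ^+ 2 by exact: sqr_ge0.
have low s y : 0 <= s -> c^-1 ^+ 2 * s * K g y <= c^-1 * (s * m g).
  move=> s0; have := doeblin_upper y bg g0.
  have ci0 : 0 <= c^-1 by rewrite invr_ge0 ltW.
  move=> /(ler_wpM2l (mulr_ge0 (sqr_ge0 c^-1) s0)) /le_trans; apply.
  by rewrite le_eqVlt; apply/orP; left; apply/eqP; field; rewrite gt_eqF.
exists (a + c^-1 ^+ 2 * t), (b - c^-1 ^+ 2 * (b - a - t)); split.
- by rewrite lerDl mulr_ge0.
- by rewrite lerBlDr lerDl mulr_ge0.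
- by rewrite /kappa; ring.
move=> y; apply/andP; split.
  have := doeblin_lower y bfa fa0; rewrite mfa (posB y bf (bmZ a bg)) (posZ hK)//.
  move=> /(le_trans (low t y t0)); lra.
have := doeblin_lower y bfb fb0; rewrite mfb (posB y (bmZ b bg) bf) (posZ hK)//.
by move=> /(le_trans (low _ y t1)); lra.
Qed.

Lemma doeblin_iter_lower g delta n : bm g -> 0 < delta ->
  (forall y, delta <= g y) ->
  exists2 delta', 0 < delta' & forall y, delta' <= iter n K g y.
Proof.
move=> bg d0 gd; elim: n => [|n [d' d'0 IH]] /=; first by exists delta.
exists (c^-1 * d'); first by rewrite mulr_gt0// invr_gt0.
have bn := pos_bm (pos_iter n) bg.
move=> y; apply: le_trans (doeblin_lower y bn _); last first.
  by move=> z; rewrite (le_trans (ltW d'0)).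
rewrite ler_wpM2l ?invr_ge0 ?(ltW c0)// -[leLHS]m_cst.
by apply: m_le => //; exact: bm_cst.
Qed.

Lemma doeblin_ratio_iter f g a b delta n : bm f -> bm g -> 0 < delta ->
  (forall y, delta <= g y) -> (forall y, a * g y <= f y <= b * g y) ->
  exists a' b', [/\ a <= a', b' <= b, b' - a' = kappa ^+ n * (b - a) &
    forall y, a' * iter n K g y <= iter n K f y <= b' * iter n K g y].
Proof.
move=> bf bg d0 gd fg; elim: n => [|n [a' [b' [aa bb e h]]]] /=.
  by exists a, b; rewrite expr0 mul1r.
have [d' d'0 gd'] := doeblin_iter_lower n bg d0 gd.
have [a2 [b2 [aa2 bb2 e2 h2]]] := doeblin_ratio (pos_bm (pos_iter n) bf)
  (pos_bm (pos_iter n) bg) d'0 gd' h.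
exists a2, b2; split=> //; first exact: le_trans aa2.
  exact: le_trans bb2 _.
by rewrite e2 e exprS mulrA.
Qed.

End positive.

End doeblin_operator.

(** * Perron eigenfunction and spectral gap *)

Section perron_frobenius.
Context (R : realType) d (E : measurableType d) (mu : probability E R).
Implicit Types (f g : E -> R).
Notation m f := (\int[mu]_x f x).

Variables (K : (E -> R) -> E -> R) (c : R) (x0 : E).
Hypotheses (hK : positive_operator K) (c1 : 1 <= c).
Hypothesis doeblin_lower : forall f x, bm f -> (forall y, 0 <= f y) ->
  c^-1 * m f <= K f x.
Hypothesis doeblin_upper : forall f x, bm f -> (forall y, 0 <= f y) ->
  K f x <= c * m f.

Let c0 : 0 < c. Proof. exact: lt_le_trans c1. Qed.
Local Notation kappa := (contraction_rate c).
Let k0 : 0 <= kappa. Proof. exact: contraction_rate_ge0. Qed.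
Let k1 : kappa < 1. Proof. exact: contraction_rate_lt1. Qed.

Let one : E -> R := fun=> 1.
Let bone : bm one. Proof. exact: bm_cst. Qed.
Let one0 y : 0 <= one y. Proof. exact: ler01. Qed.

Let bit n f : bm f -> bm (iter n K f). Proof. exact: (pos_bm (pos_iter hK n)). Qed.
Let it0 n f y : bm f -> (forall y, 0 <= f y) -> 0 <= iter n K f y.
Proof. exact: (pos_ge0 (pos_iter hK n)). Qed.

Let it_gt0 n y : 0 < iter n K one y.
Proof.
have [|d' d0 h] := doeblin_iter_lower hK c1 doeblin_lower n bone ltr01.
  by move=> z; exact: lexx.
exact: lt_le_trans d0 (h y).
Qed.

(** Both values are within a factor [c] of the integral of [f]. *)
Lemma doeblin_harnack f x y : bm f -> (forall y, 0 <= f y) ->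
  K f x <= c ^+ 2 * K f y.
Proof.
move=> bf f0; apply: (le_trans (doeblin_upper x bf f0)).
have := doeblin_lower y bf f0 => /(ler_wpM2l (sqr_ge0 c)); apply: le_trans.
by rewrite le_eqVlt; apply/orP; left; apply/eqP; field; rewrite gt_eqF.
Qed.

Lemma doeblin_harnack_iter n x y : iter n K one x <= c ^+ 2 * iter n K one y.
Proof.
case: n => [|n] /=; first by rewrite /one mulr1 expr_ge1// ltW.
by apply: doeblin_harnack => [|z]; [exact: bit|exact: it0].
Qed.

Let s n := iter n K one x0.
Let s0 n : 0 < s n. Proof. exact: it_gt0. Qed.
Let phi n x := iter n K one x / s n.

Let phi_le n x : phi n x <= c ^+ 2.
Proof. by rewrite /phi ler_pdivrMr//; exact: doeblin_harnack_iter. Qed.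

Let phi_ge n x : c^-1 ^+ 2 <= phi n x.
Proof.
rewrite /phi ler_pdivlMr// exprVn ler_pdivrMl ?exprn_gt0//.
exact: doeblin_harnack_iter.
Qed.

Let phi_ge0 n x : 0 <= phi n x.
Proof. by rewrite (le_trans _ (phi_ge n x))// sqr_ge0. Qed.

Let bphi n : bdm (phi n) (c ^+ 2).
Proof.
have [B [mB _]] := bit n bone; split; first exact: measurable_funM.
by move=> x; rewrite ger0_norm.
Qed.

(** The ratio of [iter k K one] to [one] lies in an interval of length at most [c ^+ 2 * s k], which
    [n] further steps contract by [kappa ^+ n]. The two other factors [c ^+ 2] come from the Harnack
    inequality at [x] and from [s k <= c ^+ 2 * r], where [r] is the ratio of the normalizations. *)
Let phi_cauchy x n k : `|phi (n + k)%N x - phi n x| <= c ^+ 6 * kappa ^+ n.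
Proof.
have hk y : c^-1 ^+ 2 * s k * one y <= iter k K one y <= c ^+ 2 * s k * one y.
  rewrite /one !mulr1; apply/andP; split; last exact: doeblin_harnack_iter.
  rewrite exprVn ler_pdivrMl ?exprn_gt0//; exact: doeblin_harnack_iter.
have [|a' [b' [aa bb e h]]] := doeblin_ratio_iter hK c1 doeblin_lower
  doeblin_upper n (bit k bone) bone ltr01 _ hk; first by move=> y; exact: lexx.
have hn y : a' * iter n K one y <= iter (n + k) K one y <= b' * iter n K one y.
  by rewrite iterD.
have [r sE] : exists r, s (n + k)%N = r * s n.
  by exists (s (n + k)%N / s n); rewrite divfK// gt_eqF.
have [ar rb] : a' <= r /\ r <= b'.
  by have := hn x0; rewrite -/(s n) -/(s (n + k)%N) sE !ler_pM2r// => /andP[].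
have a0 : c^-1 ^+ 2 * s k <= r by exact: le_trans ar.
have r0 : 0 < r by rewrite -(pmulr_lgt0 _ (s0 n)) -sE.
have ba : b' - a' <= kappa ^+ n * (c ^+ 2 * s k).
  rewrite e ler_wpM2l ?exprn_ge0// lerBlDr lerDl mulr_ge0 ?sqr_ge0//.
  exact: ltW.
have -> : phi (n + k)%N x - phi n x =
    (iter (n + k) K one x - r * iter n K one x) / (r * s n).
  by rewrite /phi sE; field; rewrite !gt_eqF.
have d1 : `|iter (n + k) K one x - r * iter n K one x| <=
    (b' - a') * iter n K one x.
  have /andP[h1 h2] := hn x; have := ltW (it_gt0 n x).
  rewrite ler_norml; nra.
rewrite normrM [X in _ * X]gtr0_norm ?invr_gt0 ?mulr_gt0//.
rewrite ler_pdivrMr ?mulr_gt0//; apply: (le_trans d1).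
have s0k := ltW (s0 k); have c20 : 0 <= c ^+ 2 by exact: sqr_ge0.
apply: (@le_trans _ _ (kappa ^+ n * (c ^+ 2 * s k) * (c ^+ 2 * s n))).
  apply: ler_pM => //; [by rewrite subr_ge0 (le_trans ar)|exact: ltW|].
  exact: doeblin_harnack_iter.
have : s k <= c ^+ 2 * r.
  by move: a0; rewrite exprVn ler_pdivrMl ?exprn_gt0.
have kn0 : 0 <= kappa ^+ n by exact: exprn_ge0.
have hc : 0 <= kappa ^+ n * c ^+ 2 * c ^+ 2 * s n.
  exact: mulr_ge0 (mulr_ge0 (mulr_ge0 kn0 c20) c20) (ltW (s0 n)).
move=> /(ler_wpM2l hc) h3.
apply: (@le_trans _ _ (kappa ^+ n * c ^+ 2 * c ^+ 2 * s n * s k)).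
  by rewrite le_eqVlt; apply/orP; left; apply/eqP; ring.
by apply: (le_trans h3); rewrite le_eqVlt; apply/orP; left; apply/eqP; ring.
Qed.

(* The iterates [K ^+ n 1], normalized at [x0], form a Cauchy sequence because the
   oscillation of their ratios contracts. *)
Lemma perron_eigenfunction : exists psi rho,
  [/\ bm psi, 0 < rho, (forall x, c^-1 ^+ 2 <= psi x <= c ^+ 2) &
      forall x, K psi x = rho * psi x].
Proof.
have c60 : 0 <= c ^+ 6 by rewrite exprn_ge0// ltW.
have /choice [psi psiP] : forall x, exists l, forall n,
    `|phi n x - l| <= c ^+ 6 * kappa ^+ n.
  by move=> x; apply: geometric_lim => // n k; exact: phi_cauchy.
have cphi x : phi n x @[n --> \oo] --> psi x.
  apply/cvgrPdist_le => e e0.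
  have [N hN] := geometric_small (c ^+ 6) k0 k1 e0.
  exists N => // n /= Nn; rewrite distrC (le_trans (psiP x n))//.
  apply: le_trans hN; rewrite ler_wpM2l//.
  by rewrite ler_wiXn2l// ltW.
have mpsi : measurable_fun setT psi.
  by apply: (measurable_fun_cvg (h := phi)) => [n|x _]; [case: (bphi n)|exact: cphi].
have psi_le x : c^-1 ^+ 2 <= psi x <= c ^+ 2.
  apply/andP; split.
    by apply: (cvgr_to_ge (cphi x)); apply: nearW => n; exact: phi_ge.
  by apply: (cvgr_to_le (cphi x)); apply: nearW => n; exact: phi_le.
have bpsi : bm psi.
  exists (c ^+ 2); split=> // x; have /andP[h1 h2] := psi_le x.
  by rewrite ger0_norm// (le_trans _ h1)// sqr_ge0.
(* Each [phi n] equals 1 at [x0], hence so does [psi], and this is the only possible eigenvalue. *)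
pose rho := K psi x0.
have psi0 y : 0 <= psi y by have /andP[/(le_trans _) + _] := psi_le y; apply; exact: sqr_ge0.
have rho0 : 0 < rho.
  have : K (fun=> c^-1 ^+ 2) x0 <= K psi x0.
    by apply: (pos_le hK) => // [|y]; [exact: bm_cst|case/andP: (psi_le y)].
  apply: lt_le_trans; have -> : (fun=> c^-1 ^+ 2) = (fun y => c^-1 ^+ 2 * one y).
    by apply/funext => y; rewrite mulr1.
  by rewrite (posZ hK)// mulr_gt0 ?exprn_gt0 ?invr_gt0//; exact: (it_gt0 1).
have Kone x : K one x <= c.
  apply: (le_trans (doeblin_upper x bone one0)).
  by rewrite /one Rintegral_cst//= probability_setT !mulr1.
have Kclose n x : `|K (phi n) x - K psi x| <= c ^+ 6 * kappa ^+ n * c.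
  have bphin : bm (phi n) by exists (c ^+ 2); exact: bphi.
  rewrite -(posB hK)//.
  have /(_ x) := pos_norm_le hK _ (bmB bphin bpsi)
    (bm_cst (c ^+ 6 * kappa ^+ n)) (psiP ^~ n).
  move/le_trans; apply.
  have -> : (fun=> c ^+ 6 * kappa ^+ n) = (fun y => c ^+ 6 * kappa ^+ n * one y).
    by apply/funext => y; rewrite mulr1.
  rewrite (posZ hK)//; apply: ler_wpM2l; last exact: Kone.
  by rewrite mulr_ge0// exprn_ge0.
have Kphi n x : K (phi n) x = s n.+1 / s n * phi n.+1 x.
  have -> : phi n = (fun y => (s n)^-1 * iter n K one y).
    by apply/funext => y; rewrite mulrC.
  rewrite (posZ hK); last exact: bit.
  have h1 := lt0r_neq0 (s0 n); have h2 := lt0r_neq0 (s0 n.+1).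
  rewrite /phi -/(iter n.+1 K one x); field; exact/andP.
have rn n : s n.+1 / s n = K (phi n) x0.
  by rewrite Kphi /phi divff ?mulr1// gt_eqF.
(* The relation [K (phi n) = s n.+1 / s n * phi n.+1] is exact. The three errors made in passing to
   the limit, in [K (phi n)], in the ratio and in [phi n.+1], are all of order [kappa ^+ n]. *)
exists psi, rho; split=> // x; apply: (@geometric_eq _ _ _
  (c ^+ 6 * c + (c ^+ 6 * c * c ^+ 2 + rho * c ^+ 6)) kappa) => // n.
have -> : K psi x - rho * psi x = - (K (phi n) x - K psi x) +
   ((s n.+1 / s n - rho) * phi n.+1 x + rho * (phi n.+1 x - psi x)).
  by rewrite Kphi; ring.
rewrite (le_trans (ler_normD _ _))// [leRHS]mulrDl; apply: lerD.
  by rewrite normrN mulrAC.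
rewrite (le_trans (ler_normD _ _))// [leRHS]mulrDl; apply: lerD.
  rewrite normrM mulrAC; apply: ler_pM => //.
    by rewrite rn mulrAC.
  by case: (bphi n.+1).
rewrite normrM (gtr0_norm rho0) -mulrA ler_wpM2l ?(ltW rho0)//.
rewrite (le_trans (psiP x n.+1))// ler_wpM2l// exprSr.
by rewrite ler_piMr ?exprn_ge0// ltW.
Qed.

Variables (psi : E -> R) (rho : R).
Hypotheses (bpsi : bm psi) (rho0 : 0 < rho).
Hypothesis psi_bounds : forall x, c^-1 ^+ 2 <= psi x <= c ^+ 2.
Hypothesis psi_eigen : forall x, K psi x = rho * psi x.

Let ci0 : 0 < c^-1 ^+ 2. Proof. by rewrite exprn_gt0// invr_gt0. Qed.

Lemma iter_eigen n x : iter n K psi x = rho ^+ n * psi x.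
Proof.
elim: n x => [|n IH] x /=; first by rewrite expr0 mul1r.
have -> : iter n K psi = (fun y => rho ^+ n * psi y) by apply/funext => y; exact: IH.
by rewrite (posZ hK)// psi_eigen mulrA exprSr.
Qed.

(** The ratio of [iter n K g] to [rho ^+ n * psi] stays in an interval of length
    [2 * B * kappa ^+ n], also for all later iterates, so it converges to a constant [l]. This is
    the rank-one part of [g] along [psi], with the spectral gap as rate. *)
Lemma perron_functional g B : bm g -> (forall x, `|g x| <= B * psi x) ->
  exists l, forall n x, `|iter n K g x - rho ^+ n * l * psi x| <=
    2 * B * (kappa * rho) ^+ n * psi x.
Proof.
move=> bg gB.
have psi0 x : 0 < psi x by have /andP[+ _] := psi_bounds x; exact: lt_le_trans.
have B0 : 0 <= B.
  by rewrite -(pmulr_lge0 _ (psi0 x0)); exact: le_trans (gB x0).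
have gab y : - B * psi y <= g y <= B * psi y by rewrite mulNr -ler_norml.
pose v n x := iter n K g x / (rho ^+ n * psi x).
have vE n x : iter n K g x = v n x * (rho ^+ n * psi x).
  by rewrite /v divfK// gt_eqF// mulr_gt0// exprn_gt0.
have close n : exists a b, b - a = 2 * B * kappa ^+ n /\
    forall k x, a <= v (n + k)%N x <= b.
  have psi_lb y : c^-1 ^+ 2 <= psi y by case/andP: (psi_bounds y).
  have [a [b [_ _ e h]]] := doeblin_ratio_iter hK c1 doeblin_lower doeblin_upper
    n bg bpsi ci0 psi_lb gab.
  exists a, b; split; first by rewrite e; ring.
  move=> k x; rewrite /v.
  have den : 0 < rho ^+ (n + k) * psi x by rewrite mulr_gt0// exprn_gt0.
  have bi : bm (iter n K psi) by exact: bit.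
  have ha y : a * iter n K psi y <= iter n K g y by case/andP: (h y).
  have hb y : iter n K g y <= b * iter n K psi y by case/andP: (h y).
  have Ez z : z * (rho ^+ (n + k) * psi x) = iter k K (fun y => z * iter n K psi y) x.
    by rewrite (posZ (pos_iter hK k))// -iterD addnC iter_eigen.
  rewrite ler_pdivlMr// ler_pdivrMr// !Ez [in iter (n + k)]addnC iterD.
  apply/andP; split; apply: (pos_le (pos_iter hK k)) => //;
    by [exact: bmZ|exact: bit].
have [|l hl] := @geometric_lim _ (v ^~ x0) (2 * B) kappa (mulr_ge0 (ler0n _ 2) B0) k0.
  move=> n k; have [a [b [e h]]] := close n; rewrite -e.
  have /andP[h1 h2] := h k x0; have /andP[] := h 0%N x0; rewrite addn0 => h3 h4.
  by rewrite ler_norml; lra.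
exists l => n x.
have [a [b [e h]]] := close n.
have [al lb] : a <= l /\ l <= b.
  split.
    apply/ler_addgt0Pr => eps eps0.
    have [N hN] := geometric_small (2 * B) k0 k1 eps0.
    have := hl (n + N)%N; have /andP[+ _] := h N x0.
    have : 2 * B * kappa ^+ (n + N) <= eps.
      apply: le_trans hN; rewrite ler_wpM2l ?mulr_ge0// exprD.
      by rewrite ler_piMl ?exprn_ge0// exprn_ile1// ltW.
    by rewrite ler_norml; lra.
  apply/ler_addgt0Pr => eps eps0.
  have [N hN] := geometric_small (2 * B) k0 k1 eps0.
  have := hl (n + N)%N; have /andP[_ +] := h N x0.
  have : 2 * B * kappa ^+ (n + N) <= eps.
    apply: le_trans hN; rewrite ler_wpM2l ?mulr_ge0// exprD.
    by rewrite ler_piMl ?exprn_ge0// exprn_ile1// ltW.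
  by rewrite ler_norml; lra.
rewrite vE (_ : _ - _ = (v n x - l) * (rho ^+ n * psi x)); last by ring.
have den : 0 < rho ^+ n * psi x by rewrite mulr_gt0// exprn_gt0.
rewrite normrM (gtr0_norm den) [leRHS](_ : _ =
  2 * B * kappa ^+ n * (rho ^+ n * psi x)); last by rewrite exprMn; ring.
apply: ler_wpM2r; first exact: ltW.
rewrite -e.
have := h 0%N x; rewrite addn0 => /andP[h1 h2].
by rewrite ler_norml; lra.
Qed.

End perron_frobenius.

(** * Mixing and exponential growth *)

Lemma bint_dominated (R : realType) d (T : measurableType d)
    (m1 m2 : probability T R) (C : R) (f : T -> R) : 0 <= C ->
  (forall A, measurable A -> (m1 A <= C%:E * m2 A)%E) ->
  bm f -> (forall x, 0 <= f x) -> \int[m1]_x f x <= C * \int[m2]_x f x.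
Proof.
move=> C0 m12 [B bf] f0.
rewrite -lee_fin EFinM (bint_EFin measurableT (prob_fin m1) bf).
rewrite (bint_EFin measurableT (prob_fin m2) bf).
have mf : measurable_fun setT (EFin \o f) by apply/measurable_EFinP; case: bf.
have fe0 x : (0 <= (EFin \o f) x)%E by rewrite lee_fin.
rewrite -[C]/((NngNum C0)%:num).
rewrite -(ge0_integral_mscale m2 measurableT (NngNum C0))//; last first.
  by move=> x _; rewrite lee_fin.
exact: ge0_le_measure_integral.
Qed.

(** * Invariant measure and mixing of the transition semigroup *)

Section semigroup.
Context (R : realType) (dO dE : measure_display).
Context (Omega : measurableType dO) (E : measurableType dE).
Variables (X : R -> Omega -> E) (p : R -> R.-pker E ~> E).
Variable Px : R.-pker E ~> Omega.
Hypothesis mfam : markov_family X p Px.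
Implicit Types (f g : E -> R).

Definition semigroup t f (x : E) : R := \int[p t x]_y f y.

Lemma bdm_semigroup t f B : bdm f B -> bdm (semigroup t f) B.
Proof.
move=> bf; apply: (bdm_kernel (p t) (f := fun z => f z.2)).
by apply: bdm_comp bf; exact: measurable_snd.
Qed.

Lemma pos_semigroup t : positive_operator (semigroup t).
Proof.
have fin x : (p t x setT < +oo)%E by rewrite prob_kernel ltry.
split.
- by move=> f [B bf]; exists B; exact: bdm_semigroup.
- by move=> f g x [B bf] [C bg]; exact: (bintD measurableT (fin x) bf bg).
- by move=> c f x [B bf]; exact: (bintZ measurableT (fin x) c bf).
- by move=> f x _ f0; exact: Rintegral_ge0.
Qed.

Lemma semigroup_cst t (c : R) x : semigroup t (fun=> c) x = c.
Proof. by rewrite /semigroup Rintegral_cst// prob_kernel mulr1. Qed.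

Lemma semigroupD s t f x : 0 <= s -> 0 <= t -> bm f ->
  semigroup (s + t) f x = semigroup s (semigroup t f) x.
Proof.
move=> s0 t0 [B bf].
have bf2 : bdm (fun z : past X s * E => f z.2) B.
  by apply: bdm_comp bf; exact: measurable_snd.
rewrite /semigroup -(law_time mfam _ (addr_ge0 s0 t0) bf).
rewrite (markov_past mfam (law_markov mfam x) s0 t0 bf2).
by rewrite (law_time mfam _ s0 (bdm_semigroup t bf)).
Qed.

Lemma semigroup_iter t f n x : 0 <= t -> bm f ->
  iter n (semigroup t) f x = semigroup (t *+ n) f x.
Proof.
move=> t0 bf; elim: n x => [|n IH] x.
  have [B bB] := bf; rewrite mulr0n /semigroup -(law_time mfam _ (lexx 0) bB).
  by rewrite (law_start mfam x bB).
rewrite mulrS semigroupD ?mulrn_wge0//=.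
by congr (semigroup t _ x); apply/funext => y.
Qed.

Variable mu : probability E R.
Hypothesis inv_mu : invariant_measure p mu.

Let semigroup_invariant_ge0 t f B : 0 <= t -> bdm f B -> (forall x, 0 <= f x) ->
  \int[mu]_x semigroup t f x = \int[mu]_x f x.
Proof.
move=> t0 bf f0.
pose k := pull_kernel (p t) (@measurable_snd _ _ unit E).
pose m2 : {measure set E -> \bar R} := kcomp (const_kernel mu) k tt.
have e A : measurable A -> mu A = m2 A by move=> mA; rewrite -(inv_mu t0 mA).
have mf : measurable_fun setT (EFin \o f) by apply/measurable_EFinP; case: bf.
rewrite [RHS](_ : _ = \int[m2]_x f x); last first.
  by congr fine; apply: eq_measure_integral => A mA _; exact: e.
rewrite [RHS]/Rintegral (integral_kcomp (const_kernel mu) k)//=.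
congr fine; apply: eq_integral => x _.
by rewrite /semigroup (bint_EFin measurableT _ bf)// prob_kernel ltry.
Qed.

Lemma semigroup_invariant t f : 0 <= t -> bm f ->
  \int[mu]_x semigroup t f x = \int[mu]_x f x.
Proof.
move=> t0 [B bf]; have bf' := bdmD bf (bdm_cst B).
have f'0 z : 0 <= f z + B.
  case: bf => _ /(_ z); rewrite ler_norml => /andP[+ _].
  by rewrite -subr_ge0 opprK.
have := semigroup_invariant_ge0 t0 bf' f'0.
have -> : \int[mu]_x semigroup t (fun y => f y + B) x =
    \int[mu]_x (semigroup t f x + B).
  apply: eq_Rintegral => x _.
  rewrite (posD (pos_semigroup t)) ?semigroup_cst//; last exact: bm_cst.
  by exists B.
rewrite (bintD measurableT (prob_fin mu) (bdm_semigroup t bf) (bdm_cst B)).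
by rewrite (bintD measurableT (prob_fin mu) bf (bdm_cst B)) => /addIr.
Qed.

Hypothesis doeblin : strong_doeblin p.

(** Integrating the Doeblin inequalities against the invariant [mu] shows that [nu] and [mu] are
    comparable up to the factor [C]; replacing [nu] by [mu] then costs a second factor, whence the
    constant [C ^+ 2]. *)
Lemma doeblin_invariant : exists t0 c, [/\ 0 < t0, 1 <= c &
  forall f x, bm f -> (forall y, 0 <= f y) ->
    c^-1 * \int[mu]_y f y <= semigroup t0 f x /\
    semigroup t0 f x <= c * \int[mu]_y f y].
Proof.
have [t0 [C [nu [t00 C0 dC]]]] := doeblin.
have C00 := ltW C0.
have low A : measurable A -> (nu A <= C%:E * mu A)%E.
  move=> mA; rewrite -(inv_mu (ltW t00) mA).
  rewrite -ge0_integralZl//; last exact: measurable_kernel.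
  rewrite -[leLHS]mule1 -(probability_setT mu) -integral_cst//.
  apply: ge0_le_integral => //.
    by apply: measurable_funeM; exact: measurable_kernel.
  move=> x _; have [+ _] := dC x A mA.
  move=> /(lee_wpmul2l (_ : (0%:E <= C%:E)%E)) -/(_ C00).
  by rewrite muleA -EFinM divff ?mul1e// gt_eqF.
have up A : measurable A -> (mu A <= C%:E * nu A)%E.
  move=> mA; rewrite -(inv_mu (ltW t00) mA).
  rewrite -[leRHS]mule1 -(probability_setT mu) -integral_cst//.
  apply: ge0_le_integral => //.
    exact: measurable_kernel.
  by move=> x _; have [] := dC x A mA.
have C1 : 1 <= C.
  have := up _ (@measurableT _ E); rewrite !probability_setT mule1.
  by rewrite lee_fin.
exists t0, (C ^+ 2); split=> //; first by rewrite expr_ge1.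
move=> f x bf f0.
have h1 : \int[kernel_prob (p t0) x]_y f y <= C * \int[nu]_y f y.
  by apply: bint_dominated => // A mA; have [] := dC x A mA.
have h2 := bint_dominated C00 low bf f0.
have h3 := bint_dominated C00 up bf f0.
have h4 : \int[nu]_y f y <= C * \int[kernel_prob (p t0) x]_y f y.
  apply: bint_dominated => // A mA; have [+ _] := dC x A mA.
  move=> /(lee_wpmul2l (_ : (0%:E <= C%:E)%E)) -/(_ C00).
  by rewrite muleA -EFinM divff ?mul1e// gt_eqF.
split.
  rewrite ler_pdivrMl ?exprn_gt0//.
  rewrite expr2 -mulrA (le_trans h3)// ler_wpM2l//.
by rewrite expr2 -mulrA (le_trans h1)// ler_wpM2l.
Qed.

(** Ratio contraction is applied with the constant 1, which the semigroup fixes: after [n] steps all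
    values of [f] averaged lie in a short interval. Further averaging keeps them there, and by
    invariance the integral of [f] lies there too. *)
Lemma semigroup_mixing eps : 0 < eps -> exists t1, 0 <= t1 /\
  forall t f B x, t1 <= t -> bdm f B ->
    `|semigroup t f x - \int[mu]_y f y| <= eps * B.
Proof.
move=> e0; have [t0 [c [t00 c1 dc]]] := doeblin_invariant.
pose kappa := contraction_rate c.
have [n hn] := geometric_small 2 (contraction_rate_ge0 c1)
  (contraction_rate_lt1 c1) e0.
have tn0 : 0 <= t0 *+ n by rewrite mulrn_wge0// ltW.
exists (t0 *+ n); split=> // t f B x tt bf.
have B0 := bdm_ge0 x bf.
have bmf : bm f by exists B.
have b1 : bm (fun _ : E => (1 : R)) by exact: bm_cst.
have h y : - B * 1 <= f y <= B * 1 by rewrite !mulr1 -ler_norml; case: bf.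
have lower g z (bg : bm g) (g0 : forall y, 0 <= g y) :
    c^-1 * \int[mu]_y g y <= semigroup t0 g z by have [] := dc _ z bg g0.
have upper g z (bg : bm g) (g0 : forall y, 0 <= g y) :
    semigroup t0 g z <= c * \int[mu]_y g y by have [] := dc _ z bg g0.
have [a [b [_ _ eab hab]]] := doeblin_ratio_iter (pos_semigroup t0) c1
  lower upper n bmf b1 ltr01 (fun y => lexx _) h.
have one_iter y : iter n (semigroup t0) (fun=> 1) y = 1.
  by rewrite semigroup_iter ?(ltW t00)// semigroup_cst.
have {}hab y : a <= semigroup (t0 *+ n) f y <= b.
  have := hab y; rewrite one_iter !mulr1 semigroup_iter//; exact: ltW.
have bS : bdm (semigroup (t0 *+ n) f) B by exact: bdm_semigroup.
have bmS : bm (semigroup (t0 *+ n) f) by exists B.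
have s0 : 0 <= t - t0 *+ n by rewrite subr_ge0.
have -> : t = (t - t0 *+ n) + t0 *+ n by rewrite subrK.
rewrite semigroupD//.
have h1 : a <= semigroup (t - t0 *+ n) (semigroup (t0 *+ n) f) x <= b.
  rewrite -{1}(semigroup_cst (t - t0 *+ n) a x) -(semigroup_cst (t - t0 *+ n) b x).
  by apply/andP; split; apply: (pos_le (pos_semigroup _)) => //;
    (try exact: bm_cst) => y; case/andP: (hab y).
have h2 : a <= \int[mu]_y f y <= b.
  rewrite -(semigroup_invariant tn0 bmf).
  have ic (z : R) : \int[mu]_y z = z.
    by rewrite Rintegral_cst//= probability_setT mulr1.
  rewrite -{1}(ic a) -(ic b); apply/andP; split.
    apply: (le_bint measurableT (prob_fin mu) (bdm_cst a) bS) => y _.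
    by case/andP: (hab y).
  apply: (le_bint measurableT (prob_fin mu) bS (bdm_cst b)) => y _.
  by case/andP: (hab y).
have : b - a <= eps * B.
  rewrite eab opprK; have := ler_wpM2r B0 hn; lra.
by move: h1 h2 => /andP[? ?] /andP[? ?] ?; rewrite ler_norml; lra.
Qed.

End semigroup.

Lemma le0_of_mulrn_bounded (R : realType) (a b : R) :
  (forall n, a *+ n <= b) -> a <= 0.
Proof.
move=> h; rewrite leNgt; apply/negP => a0.
have := h (Num.bound (`|b| / a)); apply/negP; rewrite -ltNge.
have /archi_boundP : 0 <= `|b| / a by rewrite divr_ge0// ltW.
rewrite ltr_pdivrMr// mulr_natl; apply: le_lt_trans; exact: ler_norm.
Qed.

Lemma expR_mulrn (R : realType) (x : R) n : expR (x *+ n) = expR x ^+ n.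
Proof. by rewrite -mulr_natl expRM_natl. Qed.

(** * Exponential growth rate of the Feynman-Kac semigroup *)

Section growth.
Context (R : realType) (dO dE : measure_display).
Context (Omega : measurableType dO) (E : measurableType dE).
Variables (X : R -> Omega -> E) (p : R -> R.-pker E ~> E).
Variable Px : R.-pker E ~> Omega.
Hypothesis mfam : markov_family X p Px.
Variables (alpha : R) (alpha0 : 0 < alpha).
Implicit Types (f g v w : E -> R).

Notation fk_op := (fk_op X Px alpha).
Notation fk := (fk X alpha).
Notation additive := (additive X alpha).
Let a0 : 0 <= alpha. Proof. exact: ltW. Qed.

Lemma pos_fk g t : 0 <= t -> bm g -> positive_operator (fk_op g t).
Proof.
move=> t0 [C bg]; split.
- by move=> f [B bf]; eexists; exact: (bdm_fk_op mfam alpha t0 bg bf).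
- move=> f1 f2 x [B1 b1] [B2 b2]; rewrite /fk_op /mean.
  rewrite -(bintD measurableT (prob_fin _) (bdm_fk mfam alpha 0 t0 bg b1)
    (bdm_fk mfam alpha 0 t0 bg b2)).
  by apply: eq_Rintegral => om _; rewrite /fk mulrDr.
- move=> c f x [B bf]; rewrite /fk_op /mean.
  rewrite -(bintZ measurableT (prob_fin _) c (bdm_fk mfam alpha 0 t0 bg bf)).
  by apply: eq_Rintegral => om _; rewrite /fk mulrCA.
- move=> f x _ f0; apply: Rintegral_ge0 => om _.
  by rewrite mulr_ge0 ?expR_ge0.
Qed.

Lemma fk_op0 g f x : bm f -> fk_op g 0 f x = f x.
Proof.
move=> [B bf]; rewrite -[RHS](law_start mfam x bf) /fk_op /mean.
apply: eq_Rintegral => om _; rewrite /fk /additive /tint set_itv1.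
by rewrite Rintegral_set1 expR0 mul1r mulr0 addr0.
Qed.

Lemma fk_iter g t f n x : 0 <= t -> bm g -> bm f ->
  iter n (fk_op g t) f x = fk_op g (t *+ n) f x.
Proof.
move=> t0 [C bg] [B bf]; elim: n x => [|n IH] x.
  by rewrite mulr0n fk_op0//; exists B.
rewrite mulrS (fk_opD mfam a0 x bg bf) ?mulrn_wge0//=.
by congr (fk_op g t _ x); apply/funext => y.
Qed.

Lemma fk_bounds g C t f x : 0 <= t -> bdm g C -> bm f -> (forall y, 0 <= f y) ->
  expR (- (C * t)) * semigroup p (alpha * t) f x <= fk_op g t f x /\
  fk_op g t f x <= expR (C * t) * semigroup p (alpha * t) f x.
Proof.
move=> t0 bg [B bf] f0.
have at0 : 0 <= alpha * t by exact: mulr_ge0.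
have bX := bdm_time mfam (alpha * t) bf.
have bfk := bdm_fk mfam alpha 0 t0 bg bf.
rewrite /semigroup -(law_time mfam x at0 bf).
rewrite -!(bintZ measurableT (prob_fin (law Px x)) _ bX).
have h om : `|additive g 0 t om| <= C * t by case: (bdm_additive mfam alpha 0 t0 bg).
split; [apply: (le_bint measurableT (prob_fin _) (bdmZ _ bX) bfk)|
        apply: (le_bint measurableT (prob_fin _) bfk (bdmZ _ bX))] => om _;
  rewrite /fk add0r ler_wpM2r// ler_expR; have := h om;
  by rewrite ler_norml => /andP[].
Qed.

Variable mu : probability E R.
Variables (t0 c : R).
Hypotheses (t00 : 0 < t0) (c1 : 1 <= c).
Hypothesis dc : forall f x, bm f -> (forall y, 0 <= f y) ->
    c^-1 * \int[mu]_y f y <= semigroup p t0 f x /\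
    semigroup p t0 f x <= c * \int[mu]_y f y.

(** The process runs at speed [alpha], so after time [tau] its own clock shows the Doeblin time
    [t0]. *)
Let tau := t0 / alpha.

Lemma tau_gt0 : 0 < tau. Proof. exact: divr_gt0. Qed.

Let tau0 : 0 <= tau. Proof. exact: ltW tau_gt0. Qed.

Let atau : alpha * tau = t0.
Proof. by rewrite /tau mulrC divfK// gt_eqF. Qed.

(** The Doeblin constant of the weighted operator at time [tau] when the potential is bounded by
    [C]: the weight lies within a factor [expR (C * tau)] of 1. *)
Definition fk_const C := c * expR (C * tau).

Lemma fk_const_ge1 C : 0 <= C -> 1 <= fk_const C.
Proof.
by move=> C0; rewrite /fk_const mulr_ege1// -expR0 ler_expR mulr_ge0.
Qed.

Lemma fk_lower g C f x : bdm g C -> bm f -> (forall y, 0 <= f y) ->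
  (fk_const C)^-1 * \int[mu]_y f y <= fk_op g tau f x.
Proof.
move=> bg bf f0; have [+ _] := fk_bounds x tau0 bg bf f0; rewrite atau.
apply: le_trans; rewrite /fk_const invfM -expRN [leLHS]mulrAC [leLHS]mulrC.
by rewrite ler_wpM2l ?expR_ge0//; have [] := dc x bf f0.
Qed.

Lemma fk_upper g C f x : bdm g C -> bm f -> (forall y, 0 <= f y) ->
  fk_op g tau f x <= fk_const C * \int[mu]_y f y.
Proof.
move=> bg bf f0; have [_] := fk_bounds x tau0 bg bf f0; rewrite atau.
move/le_trans; apply; rewrite /fk_const [leRHS]mulrAC [leRHS]mulrC.
by rewrite ler_wpM2l ?expR_ge0//; have [] := dc x bf f0.
Qed.

(** Stronger than convergence of the logarithms: the constant serves all times and all starting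
    points, so the bounds may be integrated against any initial law. *)
Definition growth g Lam := exists2 C, 0 < C & forall t x, 0 <= t ->
  C^-1 * expR (Lam * t) <= fk_op g t (fun=> 1) x <= C * expR (Lam * t).

Lemma fk_one_bounds g C t x : 0 <= t -> bdm g C ->
  expR (- (C * t)) <= fk_op g t (fun=> 1) x <= expR (C * t).
Proof.
move=> t00' bg.
have := fk_bounds x t00' bg (bm_cst 1) (fun=> ler01).
by rewrite semigroup_cst !mulr1 => -[-> ->].
Qed.

(** Write [t] as a multiple of [tau] plus a remainder in [[0, tau]]. The remainder costs at most
    [expR (]|C| * tau)[in the operator and]expR ([|Lam| * tau)] in the exponential. *)
Lemma growth_of_iter g r D : bm g -> 0 < r -> 0 < D ->
  (forall n x, D^-1 * r ^+ n <= iter n (fk_op g tau) (fun=> 1) x <= D * r ^+ n) ->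
  growth g (ln r / tau).
Proof.
move=> [C bg] r0 D0 h.
have bmg : bm g by exists C.
set Lam := ln r / tau.
have e1 n s : expR (Lam * (tau *+ n + s)) = r ^+ n * expR (Lam * s).
  rewrite mulrDr expRD; congr (_ * _).
  rewrite mulrnAr /Lam divfK ?gt_eqF ?tau_gt0//.
  by rewrite expR_mulrn lnK.
pose A := D * expR (`|C| * tau) * expR (`|Lam| * tau).
have A0 : 0 < A by rewrite !mulr_gt0// expR_gt0.
exists A => // t x t0'.
pose n := Num.truncn (t / tau).
pose s := t - tau *+ n.
have /andP[hn1 hn2] : n%:R <= t / tau < n.+1%:R.
  by apply: truncn_itv; rewrite divr_ge0.
have s0 : 0 <= s.
  by rewrite /s subr_ge0 -mulr_natl -ler_pdivlMr ?tau_gt0.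
have st : s <= tau.
  rewrite /s lerBlDr -mulrS -mulr_natl -ler_pdivrMr ?tau_gt0//; exact: ltW.
have tE : t = tau *+ n + s by rewrite /s addrC subrK.
have tn0 : 0 <= tau *+ n by rewrite mulrn_wge0.
have hs y : expR (- (`|C| * tau)) <= fk_op g s (fun=> 1) y <= expR (`|C| * tau).
  have /andP[h1 h2] := fk_one_bounds y s0 bg.
  have cs : C * s <= `|C| * tau by apply: (le_trans (ler_wpM2r s0 (ler_norm C))); rewrite ler_wpM2l.
  apply/andP; split.
    by apply: le_trans h1; rewrite ler_expR lerN2.
  by apply: (le_trans h2); rewrite ler_expR.
have bone : bdm (fun _ : E => 1 : R) `|1| := bdm_cst 1.
have fkE : fk_op g t (fun=> 1) x = iter n (fk_op g tau) (fk_op g s (fun=> 1)) x.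
  rewrite fk_iter//; last by eexists; exact: (bdm_fk_op mfam alpha s0 bg bone).
  by rewrite [in LHS]tE (fk_opD mfam a0 x bg bone tn0 s0).
have bms : bm (fk_op g s (fun=> 1)) by eexists; exact: (bdm_fk_op mfam alpha s0 bg bone).
have pit := pos_iter (pos_fk tau0 bmg) n.
have hc (z : R) : iter n (fk_op g tau) (fun=> z) x = z * iter n (fk_op g tau) (fun=> 1) x.
  rewrite -(posZ pit); last exact: bm_cst.
  by congr (iter n _ _ x); apply/funext => y; rewrite mulr1.
have lo : expR (- (`|C| * tau)) * iter n (fk_op g tau) (fun=> 1) x <= fk_op g t (fun=> 1) x.
  rewrite fkE -hc; apply: (pos_le pit) => // [|y]; first exact: bm_cst.
  by case/andP: (hs y).
have up : fk_op g t (fun=> 1) x <= expR (`|C| * tau) * iter n (fk_op g tau) (fun=> 1) x.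
  rewrite fkE -hc; apply: (pos_le pit) => // [|y]; first exact: bm_cst.
  by case/andP: (hs y).
have /andP[i1 i2] := h n x.
have rn0 : 0 <= r ^+ n by rewrite exprn_ge0// ltW.
have Ls : `|Lam * s| <= `|Lam| * tau by rewrite normrM (ger0_norm s0) ler_wpM2l.
have Ls1 : expR (Lam * s) <= expR (`|Lam| * tau).
  by rewrite ler_expR (le_trans (ler_norm _)).
have Ls2 : 1 <= expR (`|Lam| * tau) * expR (Lam * s).
  rewrite -expRD -[leLHS]expR0 ler_expR -lerBlDr sub0r.
  by rewrite (le_trans _ Ls)// -normrN ler_norm.
have -> : expR (Lam * t) = r ^+ n * expR (Lam * s) by rewrite -e1 -tE.
apply/andP; split.
  apply: le_trans lo.
  apply: (@le_trans _ _ (expR (- (`|C| * tau)) * (D^-1 * r ^+ n))); last first.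
    by rewrite ler_wpM2l ?expR_ge0.
  rewrite /A !invfM -!expRN.
  rewrite [leLHS](_ : _ = expR (- (`|C| * tau)) * (D^-1 * r ^+ n) *
    (expR (- (`|Lam| * tau)) * expR (Lam * s))); last by ring.
  rewrite ler_piMr// ?mulr_ge0 ?expR_ge0 ?invr_ge0 ?(ltW D0)//.
  by rewrite -expRD -[leRHS]expR0 ler_expR addrC subr_le0 (le_trans (ler_norm _)).
apply: (le_trans up).
apply: (@le_trans _ _ (expR (`|C| * tau) * (D * r ^+ n))).
  by rewrite ler_wpM2l ?expR_ge0.
rewrite /A [leRHS](_ : _ = expR (`|C| * tau) * (D * r ^+ n) *
    (expR (`|Lam| * tau) * expR (Lam * s))); last by ring.
by rewrite ler_peMr// !mulr_ge0 ?expR_ge0 ?(ltW D0).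
Qed.

Lemma growth_le g Lam r D (x : E) : bm g -> growth g Lam -> 0 < r -> 0 < D ->
  (forall n, iter n (fk_op g tau) (fun=> 1) x <= D * r ^+ n) ->
  Lam <= ln r / tau.
Proof.
move=> bg [C C0 hC] r0 D0 h.
rewrite ler_pdivlMr ?tau_gt0// -subr_le0.
apply: (@le0_of_mulrn_bounded _ _ (ln (C * D))) => n.
have := h n; rewrite fk_iter//; last exact: bm_cst.
have /(_ (mulrn_wge0 n tau0)) /andP[+ _] := hC (tau *+ n) x.
move=> /le_trans /[apply].
rewrite ler_pdivrMl// mulrA => h2.
rewrite -ler_expR lnK ?posrE ?mulr_gt0// mulrnDl mulNrn expRD expRN.
rewrite ler_pdivrMr ?expR_gt0// -mulrnAr.
by rewrite expR_mulrn lnK// ?posrE// -[X in X <= _]/(expR _).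
Qed.

Lemma growth_ge g Lam r D (x : E) : bm g -> growth g Lam -> 0 < r -> 0 < D ->
  (forall n, D * r ^+ n <= iter n (fk_op g tau) (fun=> 1) x) ->
  ln r / tau <= Lam.
Proof.
move=> bg [C C0 hC] r0 D0 h.
rewrite ler_pdivrMr ?tau_gt0// -subr_le0.
apply: (@le0_of_mulrn_bounded _ _ (ln (C / D))) => n.
have := h n; rewrite fk_iter//; last exact: bm_cst.
have /(_ (mulrn_wge0 n tau0)) /andP[_ +] := hC (tau *+ n) x.
move=> /[swap] /le_trans /[apply].
rewrite mulrC -ler_pdivlMr// => h2.
rewrite -ler_expR lnK ?posrE ?divr_gt0// mulrnDl mulNrn expRD expRN.
rewrite ler_pdivrMr ?expR_gt0// -mulrnAr.
by rewrite expR_mulrn lnK// mulrAC.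
Qed.

Lemma growth_eigen g C psi rho : bdm g C -> 0 <= C -> bm psi -> 0 < rho ->
  (forall x, (fk_const C)^-1 ^+ 2 <= psi x <= fk_const C ^+ 2) ->
  (forall x, fk_op g tau psi x = rho * psi x) -> growth g (ln rho / tau).
Proof.
move=> bg C0 bpsi rho0 hpsi eig.
have bmg : bm g by exists C.
have c0 : 0 < fk_const C by exact: lt_le_trans (fk_const_ge1 C0).
have ci0 : 0 < (fk_const C)^-1 ^+ 2 by rewrite exprn_gt0// invr_gt0.
have c20 : 0 < fk_const C ^+ 2 by rewrite exprn_gt0.
apply: (@growth_of_iter _ _ (fk_const C ^+ 2 / (fk_const C)^-1 ^+ 2)) => //.
  by rewrite divr_gt0.
move=> n x; apply/andP; split.
  rewrite invf_div.
  apply: (pos_test_ge (pos_fk tau0 bmg) n x bpsi (ltW rho0) ci0 hpsi).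
  by move=> y; rewrite eig.
apply: (pos_test_le (pos_fk tau0 bmg) n x bpsi (ltW rho0) ci0 hpsi).
by move=> y; rewrite eig.
Qed.

Lemma growth_exists g (x0 : E) : bm g -> exists Lam, growth g Lam.
Proof.
move=> [C0 bg0].
have bg : bdm g `|C0| by apply: bdmW bg0 _; exact: ler_norm.
have bmg : bm g by exists `|C0|.
have [psi [rho [bpsi rho0 hpsi eig]]] := perron_eigenfunction x0
  (pos_fk tau0 bmg) (fk_const_ge1 (normr_ge0 C0))
  (fun f x => @fk_lower _ _ f x bg) (fun f x => @fk_upper _ _ f x bg).
by exists (ln rho / tau); exact: growth_eigen bg (normr_ge0 _) bpsi rho0 hpsi eig.
Qed.

End growth.

(** * Differentiability of the growth rate *)

(** Applying the concavity bound to [(1 + x)^-1] gives [x / (1 + x) <= ln (1 + x)]. *)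
Lemma ln1D_lower (R : realType) (x : R) : `|x| <= 2^-1 ->
  x - 2 * x ^+ 2 <= ln (1 + x).
Proof.
rewrite ler_norml => /andP[x1 x2].
have x0 : 0 < 1 + x by lra.
have : ln ((1 + x)^-1) <= (1 + x)^-1 - 1.
  have := @le_ln1Dx R ((1 + x)^-1 - 1).
  have -> : 1 + ((1 + x)^-1 - 1) = (1 + x)^-1 by ring.
  have i0 : 0 < (1 + x)^-1 by rewrite invr_gt0.
  by apply; lra.
rewrite lnV ?posrE// lerNl; apply: le_trans.
have -> : - ((1 + x)^-1 - 1) = x / (1 + x) by field; rewrite gt_eqF.
rewrite ler_pdivlMr// -subr_ge0.
have -> : x - (x - 2 * x ^+ 2) * (1 + x) = x ^+ 2 * (1 + 2 * x) by ring.
by rewrite mulr_ge0 ?sqr_ge0//; lra.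
Qed.

Section perturbation.
Context (R : realType) (dO dE : measure_display).
Context (Omega : measurableType dO) (E : measurableType dE).
Variables (X : R -> Omega -> E) (p : R -> R.-pker E ~> E).
Variable Px : R.-pker E ~> Omega.
Hypothesis mfam : markov_family X p Px.
Variables (alpha : R) (alpha0 : 0 < alpha).
Implicit Types (f g v w : E -> R).

Notation fk_op := (fk_op X Px alpha).
Notation fk := (fk X alpha).
Notation additive := (additive X alpha).
Let a0 : 0 <= alpha. Proof. exact: ltW. Qed.
Notation growth := (growth X Px alpha).

Lemma growth_uniq g L1 L2 (x : E) : growth g L1 -> growth g L2 -> L1 = L2.
Proof.
suff h L L' : growth g L -> growth g L' -> L <= L'.
  by move=> h1 h2; apply/eqP; rewrite eq_le !h.
move=> [C C0 hC] [D D0 hD]; rewrite -subr_le0.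
apply: (@le0_of_mulrn_bounded _ _ (ln (C * D))) => n.
have n0 : 0 <= n%:R :> R by exact: ler0n.
have /andP[h1 _] := hC n%:R x n0; have /andP[_ h2] := hD n%:R x n0.
have := le_trans h1 h2; rewrite ler_pdivrMl// mulrA => h3.
rewrite -ler_expR lnK ?posrE ?mulr_gt0// -mulr_natr mulrBl expRD expRN.
by rewrite ler_pdivrMr ?expR_gt0.
Qed.

Section derivative_operator.
Variables (t : R) (t_ge0 : 0 <= t).
Variables (w : E -> R) (C : R) (bw : bdm w C).

Definition fk_deriv v f x : R :=
  mean Px (fun om => additive v 0 t om * fk w t f 0 om) x.

Lemma bdm_fk_deriv v V f B : bdm v V -> bdm f B ->
  bdm (fun om => additive v 0 t om * fk w t f 0 om) (V * t * (expR (C * t) * B)).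
Proof.
move=> bv bf; apply: bdmM; first exact: (bdm_additive mfam alpha 0 t_ge0 bv).
exact: (bdm_fk mfam alpha 0 t_ge0 bw bf).
Qed.

Lemma bm_fk_deriv v f : bm v -> bm f -> bm (fk_deriv v f).
Proof.
by move=> [V bv] [B bf]; eexists; apply: bdm_mean; exact: (bdm_fk_deriv bv bf).
Qed.

Lemma fk_derivD v f g c x : bm v -> bm f -> bm g ->
  fk_deriv v (fun y => f y + c * g y) x = fk_deriv v f x + c * fk_deriv v g x.
Proof.
move=> [V bv] [B bf] [D bg]; rewrite /fk_deriv /mean.
have b1 := bdm_fk_deriv bv bf; have b2 := bdm_fk_deriv bv bg.
rewrite -(bintZ measurableT (prob_fin _) c b2).
rewrite -(bintD measurableT (prob_fin _) b1 (bdmZ c b2)).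
by apply: eq_Rintegral => om _; rewrite /fk /=; ring.
Qed.

Lemma additiveB v1 v2 V1 V2 s om : bdm v1 V1 -> bdm v2 V2 ->
  additive (fun y => v1 y - v2 y) s t om =
  additive v1 s t om - additive v2 s t om.
Proof.
move=> b1 b2; rewrite /additive.
exact: (tintB _ (bdm_pair2 om (bdm_rate mfam alpha s b1))
  (bdm_pair2 om (bdm_rate mfam alpha s b2))).
Qed.

Lemma additiveDZ v1 v2 V1 V2 h s om : bdm v1 V1 -> bdm v2 V2 ->
  additive (fun y => v1 y + h * v2 y) s t om =
  additive v1 s t om + h * additive v2 s t om.
Proof.
move=> b1 b2; rewrite /additive.
have c1 := bdm_pair2 om (bdm_rate mfam alpha s b1).
have c2 := bdm_pair2 om (bdm_rate mfam alpha s b2).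
by rewrite (tintD _ c1 (bdmZ h c2)) (tintZ _ _ c2).
Qed.

Lemma fk_derivB v1 v2 f x : bm v1 -> bm v2 -> bm f ->
  fk_deriv (fun y => v1 y - v2 y) f x = fk_deriv v1 f x - fk_deriv v2 f x.
Proof.
move=> [V1 b1] [V2 b2] [B bf]; rewrite /fk_deriv /mean.
rewrite -(bintB measurableT (prob_fin _) (bdm_fk_deriv b1 bf) (bdm_fk_deriv b2 bf)).
apply: eq_Rintegral => om _.
by rewrite (additiveB _ _ b1 b2) mulrBl.
Qed.

Lemma fk_deriv_le v V f g x : bdm v V -> bm f -> bm g ->
  (forall y, `|f y| <= g y) -> `|fk_deriv v f x| <= V * t * fk_op w t g x.
Proof.
move=> bv [B bf] [D bg] fg; rewrite /fk_deriv /fk_op /mean.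
have b2 := bdm_fk mfam alpha 0 t_ge0 bw bg.
rewrite -(bintZ measurableT (prob_fin _) _ b2).
apply: (bint_normW measurableT (prob_fin _) (bdm_fk_deriv bv bf) (bdmZ _ b2)).
move=> om _; rewrite normrM.
apply: ler_pM => //; first by case: (bdm_additive mfam alpha 0 t_ge0 bv).
by rewrite /fk normrM ger0_norm ?expR_ge0// ler_wpM2l ?expR_ge0.
Qed.

(** The factor [expR (h * b)] is expanded inside the mean, [b] being the integral of [v] along the
    path. The remainder is bounded by the operator applied to a dominating [g], so that with a
    multiple of the eigenfunction for [g] the error becomes relative. *)
Lemma fk_expand v V h f g x : bdm v V -> bm f -> bm g ->
  (forall y, `|f y| <= g y) -> `|h| * (V * t) <= 2^-1 ->
  `|fk_op (fun y => w y + h * v y) t f x - (fk_op w t f x + h * fk_deriv v f x)|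
   <= 2 * (`|h| * (V * t)) ^+ 2 * fk_op w t g x.
Proof.
move=> bv [B bf] [D bg] fg hV; rewrite /fk_op /fk_deriv /mean.
have bwh := bdmD bw (bdmZ h bv).
have b1 := bdm_fk mfam alpha 0 t_ge0 bwh bf.
have b2 := bdm_fk mfam alpha 0 t_ge0 bw bf.
have b3 := bdm_fk_deriv bv bf.
have b4 := bdm_fk mfam alpha 0 t_ge0 bw bg.
rewrite -(bintZ measurableT (prob_fin (law Px x)) h b3).
have bs := bdmD b2 (bdmZ h b3).
rewrite -[X in _ - X](bintD measurableT (prob_fin (law Px x)) b2 (bdmZ h b3)).
rewrite -[X in `|X|](bintB measurableT (prob_fin (law Px x)) b1 bs).
rewrite -[leRHS](bintZ measurableT (prob_fin (law Px x)) _ b4).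
apply: (bint_normW measurableT (prob_fin (law Px x))
  (bdmB b1 bs) (bdmZ _ b4)) => om _.
rewrite /fk (additiveDZ _ _ _ bw bv) expRD.
set a := additive w 0 t om; set b := additive v 0 t om; set z := f _.
have -> : expR a * expR (h * b) * z - (expR a * z + h * (b * (expR a * z))) =
  (expR (h * b) - (1 + h * b)) * (expR a * z) by ring.
rewrite normrM; apply: ler_pM => //.
  apply: expR_sub1D => //; rewrite normrM ler_wpM2l//.
  exact: (bdm_additive mfam alpha 0 t_ge0 bv).2.
rewrite normrM ger0_norm ?expR_ge0//.
by apply: ler_wpM2l; [exact: expR_ge0|exact: fg].
Qed.

End derivative_operator.

Variable mu : probability E R.
Variables (t0 c : R).
Hypotheses (t00 : 0 < t0) (c1 : 1 <= c).
Hypothesis dc : forall f x, bm f -> (forall y, 0 <= f y) ->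
    c^-1 * \int[mu]_y f y <= semigroup p t0 f x /\
    semigroup p t0 f x <= c * \int[mu]_y f y.
Hypothesis inv_mu : invariant_measure p mu.

Let tau := t0 / alpha.
Let tau_pos : 0 < tau. Proof. exact: tau_gt0. Qed.
Let tau0 : 0 <= tau. Proof. exact: ltW. Qed.

Variables (w : E -> R) (C : R) (bw : bdm w C) (C0 : 0 <= C) (x0 : E).
Let bmw : bm w. Proof. by exists C. Qed.
Let k := fk_const alpha t0 c C.
Let K := fk_op w tau.
Let hK : positive_operator K. Proof. exact: (pos_fk mfam alpha tau0 bmw). Qed.
Let k1 : 1 <= k. Proof. exact: fk_const_ge1. Qed.
Let k0 : 0 < k. Proof. exact: lt_le_trans k1. Qed.
Let low f x : bm f -> (forall y, 0 <= f y) -> k^-1 * \int[mu]_y f y <= K f x.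
Proof. exact: (fk_lower mfam alpha0 t00 dc x bw). Qed.
Let up f x : bm f -> (forall y, 0 <= f y) -> K f x <= k * \int[mu]_y f y.
Proof. exact: (fk_upper mfam alpha0 t00 dc x bw). Qed.
Let kappa := contraction_rate k.
Let kap0 : 0 <= kappa. Proof. exact: contraction_rate_ge0. Qed.
Let kap1 : kappa < 1. Proof. exact: contraction_rate_lt1. Qed.

Variables (psi : E -> R) (rho : R).
Hypotheses (bpsi : bm psi) (rho0 : 0 < rho).
Hypothesis psi_bounds : forall x, k^-1 ^+ 2 <= psi x <= k ^+ 2.
Hypothesis psi_eigen : forall x, K psi x = rho * psi x.

Let ki0 : 0 < k^-1 ^+ 2. Proof. by rewrite exprn_gt0// invr_gt0. Qed.
Let psi0 x : 0 < psi x.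
Proof. by have /andP[+ _] := psi_bounds x; exact: lt_le_trans. Qed.

Variables (V : R) (V0 : 0 <= V).
Let eta := V * tau.
Let eta0 : 0 <= eta. Proof. exact: mulr_ge0. Qed.
Let eta3 : 0 <= 3 * eta. Proof. exact: mulr_ge0. Qed.
Let L v := fk_deriv tau w v.

Let bL v f : bdm v V -> bm f -> bm (L v f).
Proof. by move=> bv bf; apply: (bm_fk_deriv tau0 bw) => //; exists V. Qed.

(* [L v] is the derivative of the operator of [w + h * v] at [h = 0], so that
   [l] is that of its Perron eigenvalue [rho]. *)
Definition response v l := forall n x,
  `|iter n K (L v psi) x - rho ^+ n * l * psi x| <=
    2 * (eta * rho) * (kappa * rho) ^+ n * psi x.

Let Lpsi v x : bdm v V -> `|L v psi x| <= eta * rho * psi x.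
Proof.
move=> bv; rewrite -mulrA -psi_eigen.
apply: (fk_deriv_le tau0 bw x bv bpsi bpsi) => y.
by rewrite ger0_norm// ltW.
Qed.

Lemma response_exists v : bdm v V -> exists l, response v l.
Proof.
move=> bv.
exact: (perron_functional x0 hK k1 low up bpsi rho0 psi_bounds psi_eigen
  (bL bv bpsi) (fun x => Lpsi x bv)).
Qed.

(** The case [n = 0] of [response]: [eta * rho] from the size of [L v psi] and twice that from the
    error term. *)
Let response_le v l : bdm v V -> response v l -> `|l| <= 3 * eta * rho.
Proof.
move=> bv /(_ 0%N x0); rewrite /= !expr0 mul1r mulr1 => h1.
have h2 := Lpsi x0 bv; have h3 := psi0 x0.
rewrite -(ler_pM2r h3) -{1}(gtr0_norm h3) -normrM.
have -> : l * psi x0 = L v psi x0 - (L v psi x0 - l * psi x0) by ring.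
apply: (le_trans (ler_normB _ _)); lra.
Qed.

Let iterK n f : bm f -> bm (iter n K f).
Proof. exact: (pos_bm (pos_iter hK n)). Qed.

Let iter_Lpsi v n x : bdm v V -> `|iter n K (L v psi) x| <= eta * rho * rho ^+ n * psi x.
Proof.
move=> bv; rewrite -mulrA -(iter_eigen hK bpsi psi_eigen).
rewrite -(posZ (pos_iter hK n))//.
apply: (pos_norm_le (pos_iter hK n)); [exact: bL|exact: bmZ|].
by move=> y; exact: Lpsi.
Qed.

(* [psi + h * corrector v n] is an approximate eigenfunction of the operator of
   [w + h * v], up to [o(h)] as [h] tends to 0 and then [n] to infinity. *)
Fixpoint corrector v n x : R :=
  if n is n'.+1 then corrector v n' x + (rho ^+ n)^-1 * iter n' K (L v psi) x
  else 0.

Let bcorr v n : bdm v V -> bm (corrector v n).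
Proof.
move=> bv; elim: n => [|n IH] /=; first exact: bm_cst.
by apply: bmD => //; apply: bmZ; apply: iterK; exact: bL.
Qed.

(** The bound grows with [n] because every term may contain a component along [psi], which does not
    decay. This is why [n] must be fixed before [h] tends to 0. *)
Let corr_le v n x : bdm v V -> `|corrector v n x| <= n%:R * eta * psi x.
Proof.
move=> bv; elim: n => [|n IH] /=; first by rewrite normr0 !mul0r.
rewrite (le_trans (ler_normD _ _))// -natr1 mulrDl mul1r mulrDl lerD//.
have rn : 0 < rho ^+ n.+1 by exact: exprn_gt0.
rewrite normrM gtr0_norm ?invr_gt0// ler_pdivrMl//.
by rewrite (le_trans (iter_Lpsi n x bv))// exprS le_eqVlt; apply/orP; left;
  apply/eqP; ring.
Qed.

(** [corrector v n] is a truncated Neumann series for the equation [(rho - K) chi = L v psi]. The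
    sum telescopes, and the remainder is the normalized iterate that [response] compares with
    [l * psi]. *)
Let K_corr v n x : bdm v V ->
  K (corrector v n) x = rho * corrector v n x - L v psi x
    + (rho ^+ n)^-1 * iter n K (L v psi) x.
Proof.
move=> bv; elim: n x => [|n IH] x /=.
  have -> : (fun=> 0) = (fun y => 0 * psi y) by apply/funext => y; rewrite mul0r.
  by rewrite (posZ hK)// expr0 invr1; ring.
have bi := iterK n (bL bv bpsi).
rewrite (posD hK) ?(posZ hK)//; [|exact: bcorr|exact: bmZ].
rewrite IH exprS; field.
by rewrite expf_neq0 ?gt_eqF.
Qed.

Let err_ge0 h n : 0 <= 4 * `|h| * eta * kappa ^+ n + 8 * h ^+ 2 * eta ^+ 2 * n.+1%:R.
Proof.
have kn : 0 <= kappa ^+ n by exact: exprn_ge0.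
have h2 : 0 <= h ^+ 2 by exact: sqr_ge0.
have e2 : 0 <= eta ^+ 2 by exact: sqr_ge0.
by apply: addr_ge0; do ?[done|apply: mulr_ge0].
Qed.

Let test_error v l n h x (phi := fun y => psi y + h * corrector v n y) :
  bdm v V -> response v l ->
  `|h| * (n%:R * eta) <= 2^-1 -> `|h| * eta <= 2^-1 ->
  `|fk_op (fun y => w y + h * v y) tau phi x - (rho + h * l) * phi x| <=
  rho * (4 * `|h| * eta * kappa ^+ n + 8 * h ^+ 2 * eta ^+ 2 * n.+1%:R) * phi x.
Proof.
move=> bv rl hn he.
have bc := bcorr n bv.
have bphi : bm phi by apply: bmD => //; exact: bmZ.
have hc y : `|h * corrector v n y| <= 2^-1 * psi y.
  rewrite normrM (le_trans (ler_wpM2l (normr_ge0 h) (corr_le n y bv)))//.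
  by rewrite mulrA ler_wpM2r// ltW.
have phi_lo y : 2^-1 * psi y <= phi y.
  by have := hc y; rewrite ler_norml /phi => /andP[]; lra.
have phi_up y : phi y <= 2 * psi y.
  by have := hc y; have := psi0 y; rewrite ler_norml /phi => ? /andP[]; lra.
have phi_n y : `|phi y| <= 2 * psi y.
  rewrite ger0_norm//; apply: le_trans (phi_lo y).
  by rewrite mulr_ge0// ltW.
have b2psi : bm (fun y => 2 * psi y) by exact: bmZ.
have e1 := fk_expand tau0 bw x bv bphi b2psi phi_n he.
rewrite -/K (posZ hK)// psi_eigen -/(L v phi) in e1.
have Kphi : K phi x = rho * phi x - h * L v psi x
    + h * ((rho ^+ n)^-1 * iter n K (L v psi) x).
  by rewrite /phi (posD hK) ?(posZ hK)//; [rewrite psi_eigen K_corr//; ring|exact: bmZ].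
have Lphi : L v phi x = L v psi x + h * L v (corrector v n) x.
  by rewrite /L /phi (fk_derivD tau0 bw)//; exists V.
have Lcorr : `|L v (corrector v n) x| <= n%:R * eta ^+ 2 * rho * psi x.
  have := fk_deriv_le tau0 bw x bv bc (bmZ (n%:R * eta) bpsi) (fun y => corr_le n y bv).
  rewrite -/K (posZ hK)// psi_eigen => /le_trans; apply.
  by rewrite le_eqVlt; apply/orP; left; apply/eqP; rewrite /eta; ring.
have rn : 0 < rho ^+ n by exact: exprn_gt0.
have e2 : `|(rho ^+ n)^-1 * iter n K (L v psi) x - l * psi x| <=
    2 * eta * rho * kappa ^+ n * psi x.
  have -> : (rho ^+ n)^-1 * iter n K (L v psi) x - l * psi x =
    (rho ^+ n)^-1 * (iter n K (L v psi) x - rho ^+ n * l * psi x).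
    by field; rewrite gt_eqF.
  rewrite normrM gtr0_norm ?invr_gt0// ler_pdivrMl//.
  rewrite (le_trans (rl n x))// exprMn le_eqVlt; apply/orP; left; apply/eqP; ring.
have e3 : `|l * corrector v n x| <= 3 * eta * rho * (n%:R * eta * psi x).
  by rewrite normrM ler_pM//; [exact: response_le rl|exact: corr_le].
set Kh := fk_op _ tau phi x in e1 *.
set Z1 := Kh - _ in e1; set Z2 := _ - l * psi x in e2.
have -> : Kh - (rho + h * l) * phi x = Z1 + h * Z2 +
    (h ^+ 2 * L v (corrector v n) x - h ^+ 2 * (l * corrector v n x)).
  by rewrite /Z1 /Z2 Lphi Kphi /phi; ring.
have h20 : 0 <= h ^+ 2 by exact: sqr_ge0.
have b1 : `|h * Z2| <= `|h| * (2 * eta * rho * kappa ^+ n * psi x).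
  by rewrite normrM ler_wpM2l.
have b2 : `|h ^+ 2 * L v (corrector v n) x| <= h ^+ 2 * (n%:R * eta ^+ 2 * rho * psi x).
  by rewrite normrM ger0_norm// ler_wpM2l.
have b3 : `|h ^+ 2 * (l * corrector v n x)| <= h ^+ 2 * (3 * eta * rho * (n%:R * eta * psi x)).
  by rewrite normrM [X in X * _]ger0_norm// ler_wpM2l.
have hh : `|h| ^+ 2 = h ^+ 2 by rewrite real_normK ?num_real.
apply: (le_trans (ler_normD _ _)).
apply: (@le_trans _ _ ((2 * h ^+ 2 * eta ^+ 2 * (rho * (2 * psi x)) +
  `|h| * (2 * eta * rho * kappa ^+ n * psi x)) +
  (h ^+ 2 * (n%:R * eta ^+ 2 * rho * psi x) +
   h ^+ 2 * (3 * eta * rho * (n%:R * eta * psi x))))).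
  apply: lerD.
    rewrite (le_trans (ler_normD _ _))// lerD//.
    rewrite (le_trans e1)// le_eqVlt; apply/orP; left; apply/eqP.
    by rewrite -/eta exprMn hh; ring.
  by rewrite (le_trans (ler_normB _ _))// lerD.
set A := 4 * `|h| * eta * kappa ^+ n + 8 * h ^+ 2 * eta ^+ 2 * n.+1%:R.
have A0 : 0 <= A by exact: err_ge0.
(* The second-order terms add up to [4 * (n + 1)] times [h ^+ 2 * eta ^+ 2 * rho * psi]: 4 from the
   expansion, [n] and [3 * n] from the corrector. Comparing with [phi], which is only known to be at
   least [psi / 2], doubles all the coefficients. *)
apply: (@le_trans _ _ (rho * A * (2^-1 * psi x))); last first.
  by rewrite ler_wpM2l// mulr_ge0// ltW.
rewrite /A -natr1 le_eqVlt; apply/orP; left; apply/eqP; by field.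
Qed.

Let Lam := ln rho / tau.

(** The corrected eigenfunction is a test function from both sides, with the rates
    [rho * (1 + h * l / rho + e)] and [rho * (1 + h * l / rho - e)]; their logarithms, divided by
    [tau], enclose [Lamh]. *)
Let response_growth v l n h Lamh
  (e := 4 * `|h| * eta * kappa ^+ n + 8 * h ^+ 2 * eta ^+ 2 * n.+1%:R) :
  bdm v V -> response v l ->
  growth (fun y => w y + h * v y) Lamh ->
  `|h| * (n%:R * eta) <= 2^-1 -> `|h| * eta <= 2^-1 ->
  `|h| * (3 * eta) + e <= 2^-1 ->
  `|Lamh - Lam - h * (l / rho / tau)| <=
    (e + 2 * (`|h| * (3 * eta) + e) ^+ 2) / tau.
Proof.
move=> bv rl gh hn he hs.
have bwh : bm (fun y => w y + h * v y) by apply: bmD => //; apply: bmZ; exists V.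
pose phi y := psi y + h * corrector v n y.
have te x := test_error x bv rl hn he.
have bphi : bm phi by apply: bmD => //; apply: bmZ; exact: bcorr.
have e0 : 0 <= e by exact: err_ge0.
have hc y : `|h * corrector v n y| <= 2^-1 * psi y.
  rewrite normrM (le_trans (ler_wpM2l (normr_ge0 h) (corr_le n y bv)))//.
  by rewrite mulrA ler_wpM2r// ltW.
have phib y : 2^-1 * k^-1 ^+ 2 <= phi y <= 2 * k ^+ 2.
  have := hc y; have := psi0 y; have /andP[h1 h2] := psi_bounds y.
  by rewrite ler_norml /phi => ? /andP[? ?]; apply/andP; split; lra.
have d10 : 0 < 2^-1 * k^-1 ^+ 2 by rewrite mulr_gt0.
have d20 : 0 < 2 * k ^+ 2 by rewrite mulr_gt0// exprn_gt0.
have phi0 y : 0 < phi y by case/andP: (phib y) => /(lt_le_trans d10).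
pose l' := l / rho.
have l'le : `|h * l'| <= `|h| * (3 * eta).
  rewrite normrM ler_wpM2l// /l' normrM [X in _ * X]gtr0_norm ?invr_gt0//.
  by rewrite ler_pdivrMr//; exact: response_le rl.
have lE : l = rho * l' by rewrite /l' mulrC divfK// gt_eqF.
have /andP[l1 l2] : - (`|h| * (3 * eta)) <= h * l' <= `|h| * (3 * eta).
  by rewrite -ler_norml.
have Kup y : fk_op (fun y => w y + h * v y) tau phi y <= rho * (1 + (h * l' + e)) * phi y.
  have := te y; rewrite -/e -/(phi y) ler_norml lE => /andP[_].
  have -> : rho * (1 + (h * l' + e)) * phi y =
    (rho + h * (rho * l')) * phi y + rho * e * phi y by ring.
  lra.
have Klo y : rho * (1 + (h * l' - e)) * phi y <= fk_op (fun y => w y + h * v y) tau phi y.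
  have := te y; rewrite -/e -/(phi y) ler_norml lE => /andP[+ _].
  have -> : rho * (1 + (h * l' - e)) * phi y =
    (rho + h * (rho * l')) * phi y - rho * e * phi y by ring.
  lra.
have hKh := pos_fk mfam alpha tau0 bwh.
have r1 : 0 < rho * (1 + (h * l' + e)) by rewrite mulr_gt0//; lra.
have r2 : 0 < rho * (1 + (h * l' - e)) by rewrite mulr_gt0//; lra.
have up1 : Lamh <= ln (rho * (1 + (h * l' + e))) / tau.
  apply: (growth_le mfam alpha0 t00 (D := 2 * k ^+ 2 / (2^-1 * k^-1 ^+ 2)) (x := x0) bwh gh r1).
    by rewrite divr_gt0.
  by move=> m; exact: (pos_test_le hKh m x0 bphi (ltW r1) d10 phib Kup).
have lo1 : ln (rho * (1 + (h * l' - e))) / tau <= Lamh.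
  apply: (growth_ge mfam alpha0 t00 (D := 2^-1 * k^-1 ^+ 2 / (2 * k ^+ 2)) (x := x0) bwh gh r2).
    by rewrite divr_gt0.
  by move=> m; exact: (pos_test_ge hKh m x0 bphi (ltW r2) d10 phib Klo).
rewrite !lnM ?posrE// in up1 lo1; try lra.
have u2 : ln (1 + (h * l' + e)) <= h * l' + e by apply: le_ln1Dx; lra.
have x2 : `|h * l' - e| <= 2^-1 by rewrite ler_norml; lra.
have := ln1D_lower x2.
set z := h * l' - e => lo2.
have z2 : z ^+ 2 <= (`|h| * (3 * eta) + e) ^+ 2.
  have b0 : 0 <= `|h| * (3 * eta) + e by exact: addr_ge0 (mulr_ge0 (normr_ge0 h) eta3) e0.
  rewrite -[z ^+ 2]real_normK ?num_real// ler_sqr ?nnegrE//.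
  by rewrite /z ler_norml; lra.
have sq0 : 0 <= (`|h| * (3 * eta) + e) ^+ 2 by exact: sqr_ge0.
rewrite [X in `|X| <= _](_ : _ = (Lamh * tau - ln rho - h * l') / tau); last first.
  by rewrite /Lam /l'; field; rewrite !gt_eqF.
rewrite normrM [X in _ * X]gtr0_norm ?invr_gt0// ler_wpM2r ?invr_ge0//.
move: up1 lo1; rewrite ler_pdivlMr// ler_pdivrMr// => up1 lo1.
by rewrite ler_norml; apply/andP; split; move: lo2 z2; rewrite /z; lra.
Qed.

(** First [n] is chosen so that [kappa ^+ n] is small, then [h] is made small against constants
    depending on [n]. The radius [del] depends on the bound [V] but not on [v], so the direction may
    vary with [h]. *)
Lemma response_derivative eps : 0 < eps -> exists2 del, 0 < del &
  forall v l h Lamh, bdm v V -> response v l -> `|h| <= del ->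
  growth (fun y => w y + h * v y) Lamh ->
  `|Lamh - Lam - h * (l / rho / tau)| <= eps * `|h|.
Proof.
move=> eps0; pose s := eps * tau.
have s0 : 0 < s by exact: mulr_gt0.
have s4 : 0 < s / 4 by rewrite divr_gt0.
have [n hn] := geometric_small (4 * eta) kap0 kap1 s4.
pose A := 3 * eta + s / 2.
have A0 : 0 <= A by apply: (addr_ge0 eta3); rewrite divr_ge0// ltW.
pose m := Num.min (2^-1) (s / 4).
have m0 : 0 < m by rewrite lt_min s4 invr_gt0 ltr0n.
have [m1 m2] : m <= 2^-1 /\ m <= s / 4 by rewrite /m !ge_min !lexx orbT.
have n0 : 0 <= n%:R :> R by exact: ler0n.
have nn0 : 0 <= n.+1%:R :> R by exact: ler0n.
pose M := 1 + n%:R * eta + eta + 8 * eta ^+ 2 * n.+1%:R + 2 * A ^+ 2 + A.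
have ne0 : 0 <= n%:R * eta by exact: mulr_ge0.
have e20 : 0 <= 8 * eta ^+ 2 * n.+1%:R.
  exact: mulr_ge0 (mulr_ge0 (ler0n _ 8) (sqr_ge0 eta)) nn0.
have A20 : 0 <= 2 * A ^+ 2 by rewrite mulr_ge0// sqr_ge0.
have eta0' := eta0.
have M0 : 0 < M by rewrite /M; lra.
exists (m / M); first exact: divr_gt0.
move=> v l h Lamh bv rl hd gh.
have hb z : z <= M -> `|h| * z <= m.
  move=> zM; have : `|h| * z <= `|h| * M by rewrite ler_wpM2l.
  move/le_trans; apply; by rewrite -ler_pdivlMr.
have b1 : `|h| * (n%:R * eta) <= m by apply: hb; rewrite /M; lra.
have b2 : `|h| * eta <= m by apply: hb; rewrite /M; lra.
have b3 : `|h| * (8 * eta ^+ 2 * n.+1%:R) <= m by apply: hb; rewrite /M; lra.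
have b4 : `|h| * (2 * A ^+ 2) <= m by apply: hb; rewrite /M; lra.
have b5 : `|h| * A <= m by apply: hb; rewrite /M; lra.
have h0 : 0 <= `|h| by [].
have hh : h ^+ 2 = `|h| * `|h| by rewrite -expr2 real_normK ?num_real.
pose e := 4 * `|h| * eta * kappa ^+ n + 8 * h ^+ 2 * eta ^+ 2 * n.+1%:R.
have eE : e = `|h| * (4 * eta * kappa ^+ n + `|h| * (8 * eta ^+ 2 * n.+1%:R)).
  by rewrite /e hh; ring.
have ee : e <= `|h| * (s / 2).
  rewrite eE ler_wpM2l//; lra.
have e0 : 0 <= e by exact: err_ge0.
have b6 : `|h| * (3 * eta) + e <= `|h| * A by rewrite /A mulrDr lerD2l.
have b7 : `|h| * (3 * eta) + e <= 2^-1 by lra.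
have b8 : 0 <= `|h| * (3 * eta) + e by exact: addr_ge0 (mulr_ge0 (normr_ge0 h) eta3) e0.
have := response_growth bv rl gh (le_trans b1 m1) (le_trans b2 m1) b7.
move/le_trans; apply; rewrite ler_pdivrMr// -/e.
have b9 : (`|h| * (3 * eta) + e) ^+ 2 <= (`|h| * A) ^+ 2.
  by rewrite ler_sqr ?nnegrE// mulr_ge0.
have b10 : 2 * (`|h| * A) ^+ 2 <= `|h| * (s / 4).
  have -> : 2 * (`|h| * A) ^+ 2 = `|h| * (`|h| * (2 * A ^+ 2)) by ring.
  by rewrite ler_wpM2l// (le_trans b4).
have -> : eps * `|h| * tau = `|h| * s by rewrite /s; ring.
have hs0 : 0 <= `|h| * s by rewrite mulr_ge0// ltW.
lra.
Qed.

Let occupation v x := mean Px (additive v 0 tau) x.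

Let occupation_bdm v W : bdm v W -> bdm (occupation v) (W * tau).
Proof. by move=> bv; apply: bdm_mean; exact: (bdm_additive mfam alpha 0 tau0 bv). Qed.

Let occupation_mean v W : bdm v W ->
  \int[mu]_x occupation v x = tau * \int[mu]_x v x.
Proof.
move=> bv; have bmv : bm v by exists W.
have bE : bdm (fun z : measurableTypeR R * E =>
    mean Px (fun om => v (X (0 + alpha * z.1) om)) z.2) W.
  apply: (bdm_kernel (pull_kernel Px (@measurable_snd _ _ (measurableTypeR R) E))
    (f := fun z => v (X (0 + alpha * z.1.1) z.2))).
  apply: (bdm_comp (h := fun z : measurableTypeR R * E * Omega => (z.1.1, z.2)) _
    (bdm_rate mfam alpha 0 bv)).
  apply: measurable_fun_pair => //.
  exact: (measurableT_comp (@measurable_fst _ _ _ _) (@measurable_fst _ _ _ _)).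
transitivity (\int[mu]_x tint tau (fun r =>
    mean Px (fun om => v (X (0 + alpha * r) om)) x)).
  apply: eq_Rintegral => x _.
  exact: (tint_fubini (law Px x) tau (bdm_rate mfam alpha 0 bv)).
rewrite (tint_fubini mu tau bE)/= mulrC -(tint_cst _ tau0).
apply: eq_tint => r /andP[r0 _].
have ar0 : 0 <= alpha * r by exact: mulr_ge0.
rewrite -(semigroup_invariant inv_mu ar0 bmv).
apply: eq_Rintegral => x _.
by rewrite /mean add0r (law_time mfam x ar0 bv).
Qed.

Let fk_deriv_occupation v W x : bdm v W ->
  `|L v psi x| <= expR (C * tau) * k ^+ 2 * occupation (fun y => `|v y|) x.
Proof.
move=> bv; have [B bp] := bpsi.
have bo := bdm_additive mfam alpha 0 tau0 (bdm_norm bv).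
rewrite /L /fk_deriv /occupation /mean.
rewrite -(bintZ measurableT (prob_fin (law Px x)) _ bo).
apply: (bint_normW measurableT (prob_fin _) (bdm_fk_deriv tau0 bw bv bp) (bdmZ _ bo)).
move=> om _; rewrite normrM mulrC; apply: ler_pM => //.
  rewrite /fk normrM; apply: ler_pM => //.
    rewrite ger0_norm ?expR_ge0// ler_expR (le_trans (ler_norm _))//.
    exact: (bdm_additive mfam alpha 0 tau0 bw).2.
  by rewrite ger0_norm ?(ltW (psi0 _))//; case/andP: (psi_bounds (X (0 + alpha * tau) om)).
have br := bdm_pair2 om (bdm_rate mfam alpha 0 bv).
exact: (bint_norm (m := lebesgue_measure) (measurable_itv _) (lebesgue_measure0t_fin tau) br).
Qed.

(** One application of [K] smooths: by the upper Doeblin bound it controls [L v psi] uniformly by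
    the [mu]-integral of the occupation of [v], which by invariance is [tau] times the L1 norm.
    Positivity propagates this bound through the iterates defining [l]. *)
Lemma response_continuous : exists2 M, 0 <= M & forall v1 v2 l1 l2,
  bdm v1 V -> bdm v2 V -> response v1 l1 -> response v2 l2 ->
  `|l1 - l2| <= M * \int[mu]_x `|v1 x - v2 x|.
Proof.
pose M0 := expR (C * tau) * k ^+ 2 * (k * tau) * k ^+ 2.
have k20 : 0 <= k ^+ 2 by exact: sqr_ge0.
have kt0 : 0 <= k * tau by rewrite mulr_ge0// ltW.
have ek0 : 0 <= expR (C * tau) * k ^+ 2 by rewrite mulr_ge0// expR_ge0.
have M00 : 0 <= M0 by exact: mulr_ge0 (mulr_ge0 ek0 kt0) k20.
exists (M0 / rho); first by rewrite divr_ge0// ltW.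
move=> v1 v2 l1 l2 b1 b2 r1 r2.
have bv := bdmB b1 b2; have bnv := bdm_norm bv.
pose v y := v1 y - v2 y; pose nv := \int[mu]_x `|v1 x - v2 x|.
have nv0 : 0 <= nv by apply: Rintegral_ge0.
have bLv : bm (L v psi) by apply: (bm_fk_deriv tau0 bw) => //; exists (V + V).
have bo : bm (occupation (fun y => `|v y|)) by eexists; exact: (occupation_bdm bnv).
have o0 y : 0 <= occupation (fun y => `|v y|) y.
  by apply: Rintegral_ge0 => om _; apply: Rintegral_ge0.
have KL x : `|K (L v psi) x| <= M0 * nv * psi x.
  have h1 := pos_norm_le hK x bLv (bmZ (expR (C * tau) * k ^+ 2) bo)
    (fun y => fk_deriv_occupation y bv).
  rewrite (le_trans h1)// (posZ hK)//.
  have h2 := up x bo o0; rewrite (occupation_mean bnv) -/nv in h2.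
  apply: (le_trans (ler_wpM2l ek0 h2)).
  have h3 : 1 <= k ^+ 2 * psi x.
    by have /andP[+ _] := psi_bounds x; rewrite exprVn -[X in X <= psi x]mulr1 ler_pdivrMl ?exprn_gt0.
  have -> : M0 * nv * psi x =
    expR (C * tau) * k ^+ 2 * (k * (tau * nv)) * (k ^+ 2 * psi x).
    by rewrite /M0; ring.
  by rewrite ler_peMr// mulr_ge0// mulrA mulr_ge0.
have itL n x : `|iter n.+1 K (L v psi) x| <= M0 * nv * rho ^+ n * psi x.
  rewrite iterSr -mulrA -(iter_eigen hK bpsi psi_eigen) -(posZ (pos_iter hK n))//.
  apply: (pos_norm_le (pos_iter hK n)) => //; [exact: (pos_bm hK)|exact: bmZ].
have dL n x : iter n K (L v psi) x = iter n K (L v1 psi) x - iter n K (L v2 psi) x.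
  rewrite -(posB (pos_iter hK n) x (bL b1 bpsi) (bL b2 bpsi)).
  congr (iter n K _ x); apply/funext => y.
  by rewrite /L (fk_derivB tau0 bw)//; [exists V|exists V].
apply/ler_addgt0Pr => eps eps0.
have [n hn] := geometric_small (4 * (eta * rho) * kappa) kap0 kap1 eps0.
have rn : 0 < rho ^+ n.+1 by exact: exprn_gt0.
have px := psi0 x0.
have q1 := r1 n.+1 x0; have q2 := r2 n.+1 x0; have q3 := itL n x0.
rewrite dL in q3.
move: q1 q2 q3; rewrite -/nv.
move: (iter n.+1 K (L v1 psi) x0) (iter n.+1 K (L v2 psi) x0) => i1 i2 q1 q2 q3.
have den : 0 < rho ^+ n.+1 * psi x0 by exact: mulr_gt0.
rewrite -(ler_pM2r den) -{1}(gtr0_norm den) -normrM.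
have -> : (l1 - l2) * (rho ^+ n.+1 * psi x0) =
  (i1 - i2) - (i1 - rho ^+ n.+1 * l1 * psi x0)
  + (i2 - rho ^+ n.+1 * l2 * psi x0) by ring.
apply: (le_trans (ler_normD _ _)).
apply: (le_trans (lerD (ler_normB _ _) (lexx _))).
apply: (le_trans (lerD (lerD q3 q1) q2)).
rewrite -/nv [leRHS](_ : _ = M0 * nv * rho ^+ n * psi x0 +
  eps * (rho ^+ n.+1 * psi x0)); last first.
  by rewrite exprS; field; rewrite gt_eqF.
rewrite -addrA lerD2l [leLHS](_ : _ =
    4 * (eta * rho) * kappa * kappa ^+ n * (rho ^+ n.+1 * psi x0)); last first.
  by rewrite exprMn exprS; ring.
by apply: ler_wpM2r => //; exact: ltW.
Qed.

End perturbation.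

Section growth_differentiable.
Context (R : realType) (dO dE : measure_display).
Context (Omega : measurableType dO) (E : measurableType dE).
Variables (X : R -> Omega -> E) (p : R -> R.-pker E ~> E).
Variable Px : R.-pker E ~> Omega.
Hypothesis mfam : markov_family X p Px.
Variables (alpha : R) (alpha0 : 0 < alpha).
Notation growth := (growth X Px alpha).
Variable mu : probability E R.
Hypotheses (doeblin : strong_doeblin p) (inv_mu : invariant_measure p mu).
Variable x0 : E.

Lemma growth_total (g : E -> R) : bm g -> exists Lam, growth g Lam.
Proof.
have [t0 [c [t00 c1 dc]]] := doeblin_invariant inv_mu doeblin.
exact: (growth_exists mfam alpha0 t00 c1 dc x0).
Qed.

Lemma growth_perturbation (w : E -> R) (Lam V : R) : bm w -> 0 <= V ->
  growth w Lam -> exists (l : (E -> R) -> R) (M : R), [/\ 0 <= M,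
  forall eps, 0 < eps -> exists2 del, 0 < del &
    forall v h Lamh, bdm v V -> `|h| <= del ->
    growth (fun y => w y + h * v y) Lamh ->
    `|Lamh - Lam - h * l v| <= eps * `|h| &
  forall v1 v2, bdm v1 V -> bdm v2 V ->
    `|l v1 - l v2| <= M * \int[mu]_x `|v1 x - v2 x|].
Proof.
move=> [C' bw'] V0 gLam.
have [t0 [c [t00 c1 dc]]] := doeblin_invariant inv_mu doeblin.
pose C := `|C'|; have C0 : 0 <= C by exact: normr_ge0.
have bw : bdm w C by apply: bdmW bw' _; exact: ler_norm.
have bmw : bm w by exists C.
pose tau := t0 / alpha; have tau_pos : 0 < tau by exact: divr_gt0.
have tau0 := ltW tau_pos.
have hK := pos_fk mfam alpha tau0 bmw.
have k1 := fk_const_ge1 alpha0 t00 c1 C0.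
have low f x : bm f -> (forall y, 0 <= f y) -> _ :=
  fk_lower mfam alpha0 t00 dc x bw.
have up f x : bm f -> (forall y, 0 <= f y) -> _ :=
  fk_upper mfam alpha0 t00 dc x bw.
have [psi [rho [bpsi rho0 hpsi eig]]] := perron_eigenfunction x0 hK k1 low up.
have LamE : Lam = ln rho / tau.
  apply: (growth_uniq x0 gLam).
  exact: (growth_eigen mfam alpha0 t00 c1 bw C0 bpsi rho0 hpsi eig).
have [M M0 hM] := response_continuous mfam alpha0 t00 c1 dc inv_mu bw C0 x0 bpsi
  rho0 hpsi eig V.
have /choice [l0 hl0] : forall v, exists l, bdm v V ->
    response X Px alpha t0 c w C psi rho V v l.
  move=> v; have [bv|nbv] := pselect (bdm v V); last by exists 0.
  have [l hl] := response_exists mfam alpha0 t00 c1 dc bw C0 x0 bpsi rho0 hpsi eig bv.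
  by exists l.
have d0 : 0 < rho * tau by exact: mulr_gt0.
exists (fun v => l0 v / rho / tau), (M / (rho * tau)); split.
- by rewrite divr_ge0// ltW.
- move=> eps eps0.
  have [del del0 hdel] := response_derivative mfam alpha0 t00 c1 bw C0 x0 bpsi
    rho0 hpsi eig V0 eps0.
  exists del => // v h Lamh bv hh gh; rewrite LamE.
  by apply: (hdel v) => //; exact: hl0.
move=> v1 v2 b1 b2.
have -> : l0 v1 / rho / tau - l0 v2 / rho / tau = (l0 v1 - l0 v2) / (rho * tau).
  by field; rewrite !gt_eqF.
rewrite normrM [X in _ * X]gtr0_norm ?invr_gt0// mulrAC ler_wpM2r ?invr_ge0 ?(ltW d0)//.
exact: hM (hl0 _ b1) (hl0 _ b2).
Qed.

Lemma derivable_growth (w : R -> E -> R) (Lam : R -> R) (lam del C : R)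
    (v : R -> E -> R) : 0 < del -> 0 <= C ->
  (forall h, bdm (v h) C) -> (forall c, bm (w c)) ->
  (forall h, `|h| <= del -> w (lam + h) = fun x => w lam x + h * v h x) ->
  (forall u : nat -> R, u n @[n --> \oo] --> 0 ->
    forall x, v (u n) x @[n --> \oo] --> v 0 x) ->
  (forall c, growth (w c) (Lam c)) ->
  derivable Lam lam 1.
Proof.
move=> del0 C0 bv bw wE cv gLam.
have [l [M [M0 hl hM]]] := growth_perturbation (bw lam) C0 (gLam lam).
have cl : l (v h) @[h --> (0 : R)] --> l (v 0).
  apply/(@cvg_nbhsP _ R^o) => u u0; apply/cvgrPdist_le => e e0.
  have c1 : \int[mu]_x `|v (u n) x - v 0 x| @[n --> \oo] --> \int[mu]_x (0 : R).
    apply: (bint_cvg (m := mu) (D := setT) measurableT (prob_fin mu) (B := C + C)) => //.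
      by move=> n; apply/bdm_norm/bdmB.
    move=> x _; apply/cvgrPdist_le => r r0.
    move/cvgrPdist_le : (cv _ u0 x) => /(_ r r0); apply: filterS => n.
    by rewrite sub0r normrN normr_id distrC.
  rewrite Rintegral_cst// mul0r in c1.
  have eM : 0 < e / (M + 1) by rewrite divr_gt0// ltr_wpDl.
  move/cvgrPdist_le : c1 => /(_ _ eM); apply: filterS => n /=.
  rewrite sub0r normrN => hn; rewrite distrC (le_trans (hM _ _ (bv _) (bv _)))//.
  apply: (@le_trans _ _ ((M + 1) * (e / (M + 1)))); last first.
    by rewrite mulrC divfK// gt_eqF// ltr_wpDl.
  apply: ler_pM => //; [by apply: Rintegral_ge0|by rewrite lerDl|].
  exact: le_trans (ler_norm _) hn.
apply/cvg_ex; exists (l (v 0)); apply/cvgrPdist_le => e e0.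
have e2 : 0 < e / 2 by rewrite divr_gt0.
have [d1 d10 hd1] := hl _ e2.
move/cvgrPdist_le : cl => /(_ _ e2) cl.
have n1 : \forall h \near (0 : R)^', `|l (v 0) - l (v h)| <= e / 2.
  exact: cvg_within cl.
have n2 : \forall h \near (0 : R)^', `|h| <= Num.min d1 del.
  have m0 : 0 < Num.min d1 del by rewrite lt_min d10.
  near=> h; rewrite -[h]subr0 distrC; apply: ltW.
  near: h; apply: cvg_within; exact: nbhsx_ballx.
near=> h.
have h0 : h != 0 by near: h; exact: nbhs_dnbhs_neq.
have hm : `|h| <= Num.min d1 del by near: h.
have hle1 : `|h| <= d1 by rewrite (le_trans hm)// ge_min lexx.
have hle2 : `|h| <= del by rewrite (le_trans hm)// ge_min lexx orbT.
have gh := gLam (lam + h); rewrite (wE _ hle2) in gh.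
have := hd1 _ _ _ (bv h) hle1 gh => k1.
have k2 : `|l (v 0) - l (v h)| <= e / 2 by near: h.
rewrite /= [_ *: 1]mulr1 [h + lam]addrC.
set D := Lam (lam + h) - Lam lam in k1 *.
have hn0 : 0 < `|h| by rewrite normr_gt0.
have k3 : `|h^-1 * D - l (v h)| <= e / 2.
  have -> : h^-1 * D - l (v h) = h^-1 * (D - h * l (v h)) by field.
  by rewrite normrM normfV ler_pdivrMl// [leRHS]mulrC.
rewrite -[_ *: D]/(h^-1 * D).
have -> : l (v 0) - h^-1 * D = (l (v 0) - l (v h)) - (h^-1 * D - l (v h)) by ring.
by rewrite (le_trans (ler_normB _ _))// [leRHS]splitr lerD.
Unshelve. all: by end_near. Qed.

End growth_differentiable.

(** * Averaging out the fast coordinates *)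

Section log_ratio.
Context (R : realType).
Implicit Types x a b : R.

Lemma ln_dist a b x : 0 < a -> 0 < b -> 0 <= x -> x <= 2^-1 ->
  `|b - a| <= x * a -> `|ln b - ln a| <= 2 * x.
Proof.
move=> a0 b0 x0 x2; rewrite ler_norml => /andP[h1 h2].
pose y := (b - a) / a.
have [y1 y2] : - x <= y /\ y <= x.
  by rewrite /y ler_pdivrMr// ler_pdivlMr// mulNr.
have e : ln b - ln a = ln (1 + y).
  have yE : 1 + y = b / a by rewrite /y; field; rewrite gt_eqF.
  by rewrite yE ln_div// posrE.
have u1 : ln (1 + y) <= y by apply: le_ln1Dx; lra.
have yn : `|y| <= x by rewrite ler_norml y1.
have u2 := ln1D_lower (le_trans yn x2).
have u3 : y ^+ 2 <= x * 2^-1.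
  have : y ^+ 2 <= x ^+ 2 by rewrite -[y ^+ 2]real_normK ?num_real// ler_sqr ?nnegrE.
  by move/le_trans; apply; rewrite expr2 ler_wpM2l.
by rewrite e ler_norml; lra.
Qed.

Lemma ln_dist_exp a b x : 0 < a -> 0 < b ->
  b <= expR x * a -> a <= expR x * b -> `|ln b - ln a| <= x.
Proof.
move=> a0 b0 ba ab.
have h u v : 0 < u -> 0 < v -> u <= expR x * v -> ln u - ln v <= x.
  move=> u0 v0 uv; rewrite lerBlDr -[x]expRK -lnM ?posrE ?expR_gt0//.
  by rewrite ler_ln ?posrE// mulr_gt0// expR_gt0.
by rewrite ler_norml lerNl opprB !h.
Qed.

Lemma expR_sub1 x eta : `|x| <= eta -> eta <= 2^-1 -> `|expR x - 1| <= 2 * eta.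
Proof.
move=> xe e2; have e0 : 0 <= eta by exact: le_trans xe.
have := expR_sub1D xe e2.
have : eta ^+ 2 <= eta * 2^-1 by rewrite expr2 ler_wpM2l.
by move: xe; rewrite !ler_norml => /andP[? ?] ? /andP[? ?]; apply/andP; split; lra.
Qed.

Lemma norm_le_dist a b x y : `|a - b| <= x -> `|b| <= y -> `|a| <= x + y.
Proof. by move=> ab bx; rewrite -(subrK b a) (le_trans (ler_normD _ _))// lerD. Qed.

End log_ratio.

Section coordinates.
Context (R : realType) d (E : measurableType d) (mu : probability E R) (l : nat).
Notation tupE := (l.+1.-tuple E).
Implicit Types (W : tupE -> R) (z : tupE) (j : 'I_l.+1).

Definition update z j (y : E) : tupE :=
  [tuple if i == j then y else tnth z i | i < l.+1].

Definition average j W z : R := \int[mu]_y W (update z j y).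

Definition depends_upto (m : nat) W := forall z z',
  (forall i : 'I_l.+1, (i <= m)%N -> tnth z i = tnth z' i) -> W z = W z'.

Lemma measurable_mktuple d' (T : measurableType d') (f : 'I_l.+1 -> T -> E) :
  (forall i, measurable_fun setT (f i)) ->
  measurable_fun setT (fun w => [tuple f i w | i < l.+1]).
Proof.
move=> mf; apply/measurable_fun_tnthP => i.
rewrite (_ : _ \o _ = f i)//; apply/funext => w /=.
by rewrite tnth_mktuple.
Qed.

Lemma measurable_update j :
  measurable_fun setT (fun z : tupE * E => update z.1 j z.2).
Proof.
rewrite /update.
apply: (measurable_mktuple (f := fun i (z : tupE * E) => if i == j then z.2 else tnth z.1 i)).
move=> i; case: eqP => _; first exact: measurable_snd.
exact: (measurableT_comp (@measurable_tnth _ E l.+1 i) (@measurable_fst _ _ _ _)).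
Qed.

Lemma bdm_update j W B : bdm W B -> bdm (fun z : tupE * E => W (update z.1 j z.2)) B.
Proof. by move=> bW; apply: bdm_comp bW; exact: measurable_update. Qed.

Lemma bdm_average j W B : bdm W B -> bdm (average j W) B.
Proof.
move=> bW; have := bdm_param (m := mu) (D := setT) measurableT (prob_fin mu) (bdm_update j bW).
by rewrite /= probability_setT mulr1.
Qed.

Lemma depends_average j W : depends_upto j W -> depends_upto j.-1 (average j W).
Proof.
move=> dW z z' zz'; apply: eq_Rintegral => y _; apply: dW => i ij.
rewrite !tnth_mktuple; case: eqP => // /eqP nij; apply: zz'.
by rewrite -ltnS (leq_trans _ (leqSpred _))// ltn_neqAle nij.
Qed.

Lemma depends_all W : depends_upto l W.
Proof. by move=> z z' zz'; congr W; apply: eq_from_tnth => i; apply: zz'; exact: leq_ord. Qed.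

End coordinates.

Section averaging.
Context (R : realType) (dO dE : measure_display).
Context (Omega : measurableType dO) (E : measurableType dE).
Variables (X : R -> Omega -> E) (p : R -> R.-pker E ~> E).
Variable Px : R.-pker E ~> Omega.
Hypothesis mfam : markov_family X p Px.
Variable mu : probability E R.
Hypotheses (doeblin : strong_doeblin p) (inv_mu : invariant_measure p mu).
Variables (Q : probability Omega R) (QM : markov_property X p Q).
Variables (l : nat) (q : 'I_l.+1 -> R -> R).
Notation T1 := (measurableTypeR R).
Notation tupE := (l.+1.-tuple E).
Hypothesis q_ge0 : forall i t, 0 <= q i t.
Hypothesis q_mono : forall i s t, s <= t -> q i s <= q i t.

Definition rate (W : tupE -> R) (z : T1 * Omega) : R :=
  W [tuple X (q i z.1) z.2 | i < l.+1].

Let mq i : measurable_fun setT (q i : T1 -> T1).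
Proof. by apply: nondecreasing_measurable => // s t; exact: q_mono. Qed.

Lemma bdm_rate_tuple W B : bdm W B -> bdm (rate W) B.
Proof.
move=> bW; apply: (bdm_comp _ bW).
apply: measurable_mktuple => i; apply: (measurable_process mfam) => //.
exact: (measurableT_comp (mq i)).
Qed.

Lemma bdm_rate_past W B (m : nat) t s : depends_upto m W -> bdm W B -> 0 <= s ->
  (forall i : 'I_l.+1, (i <= m)%N -> q i t <= s) ->
  bdm (fun w : past X s => rate W (t, w)) B.
Proof.
move=> dW bW s0 qs.
(* Coordinates beyond [m] may be read at times after [s]; as [W] ignores them, they are filled with
   [X 0], which belongs to every past. *)
pose f (i : 'I_l.+1) (w : past X s) := if (i <= m)%N then X (q i t) w else X 0 w.
rewrite (_ : (fun w => _) = fun w => W [tuple f i w | i < l.+1]); last first.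
  apply/funext => w; apply: dW => i im.
  by rewrite !tnth_mktuple /f im.
apply: (bdm_comp _ bW); apply: measurable_mktuple => i; rewrite /f.
by case: (boolP (i <= m)%N) => im; apply: measurable_past_time => //; exact: qs.
Qed.

Variables (W : tupE -> R) (B : R) (j : 'I_l.+1).
Hypotheses (bW : bdm W B) (B1 : 1 <= B) (dW : depends_upto j W).
Hypothesis j_gt0 : (0 < j)%N.

Let V := average mu j W.
Let bV : bdm V B. Proof. exact: bdm_average. Qed.
Let G := rate W.
Let H := rate V.
Let bG : bdm G B. Proof. exact: bdm_rate_tuple. Qed.
Let bH : bdm H B. Proof. exact: bdm_rate_tuple. Qed.
Let B0 : 0 <= B. Proof. exact: le_trans B1. Qed.

Variables (eps t1 : R).
Hypothesis mixing : forall t f C x, t1 <= t -> bdm f C ->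
  `|semigroup p t f x - \int[mu]_y f y| <= eps * C.
Hypothesis eps0 : 0 <= eps.

Section grid.
Variables (T del gam : R).
Hypotheses (T0 : 0 <= T) (del0 : 0 < del) (gam0 : 0 < gam) (gam1 : gam <= 1).
Hypothesis q_before : forall i : 'I_l.+1, (i < j)%N -> q i T <= q j (gam * T).
Hypothesis q_gap : forall t, gam * T <= t -> t1 <= q j (t + del) - q j t.

Let grid (k : nat) : R := k%:R * del.
Let A k : set T1 := `]-oo, grid k[%classic.
Let block k : set T1 := `[grid k, grid k.+1[%classic.

(* Passing from [hybrid 0] to [hybrid N] replaces [V] by [W] one block at a time. *)
Let hybrid k (z : T1 * Omega) : R := H z + \1_(A k) z.1 * (G z - H z).

Let bindic (S : set R) : measurable S -> bdm (fun z : T1 * Omega => \1_S z.1 : R) 1.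
Proof.
move=> mS; split; first exact: (measurableT_comp (measurable_indic mS)).
by move=> z; rewrite indicE ger0_norm// lern1 leq_b1.
Qed.

Let hybridE k z : hybrid k z = if z.1 < grid k then G z else H z.
Proof.
rewrite /hybrid indicE.
have -> : (z.1 \in A k) = (z.1 < grid k).
  by apply/idP/idP => h; [move: (set_mem h)|apply/mem_set]; rewrite /A /= in_itv.
by case: ifP => _; rewrite ?mul1r ?mul0r ?addr0// addrC subrK.
Qed.

Let bhybrid k : bdm (hybrid k) B.
Proof.
split; last by move=> z; rewrite hybridE; case: ifP => _; [case: bG|case: bH].
have [m1 _] := bG; have [m2 _] := bH.
have [mI _] := bindic (measurable_itv `]-oo, grid k[).
by apply: measurable_funD => //; apply: measurable_funM => //; exact: measurable_funB.
Qed.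

Let hybridS k z : hybrid k.+1 z = hybrid k z + \1_(block k) z.1 * (G z - H z).
Proof.
have gg : grid k <= grid k.+1 by rewrite /grid ler_wpM2r ?ler_nat// ltW.
rewrite !hybridE indicE.
have -> : (z.1 \in block k) = (grid k <= z.1 < grid k.+1).
  by apply/idP/idP => h; [move: (set_mem h)|apply/mem_set]; rewrite /block /= in_itv.
have [h1|h1] := ltP z.1 (grid k).
  by rewrite (lt_le_trans h1 gg)/= mul0r addr0.
by case: ifP => _; rewrite /= ?mul1r ?mul0r ?addr0// addrC subrK.
Qed.

Let Act k w := tint T (fun t => hybrid k (t, w)).
Let bAct k : bdm (Act k) (B * T). Proof. exact: (bdm_tint T0 (bhybrid k)). Qed.

Let incr k w := tint T (fun t => \1_(block k) t * (G (t, w) - H (t, w))).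

Let bincr_rate k : bdm (fun z : T1 * Omega => \1_(block k) z.1 * (G z - H z)) (1 * (B + B)).
Proof. by apply: bdmM; [exact: bindic (measurable_itv _)|exact: bdmB]. Qed.

Let bincr k : bdm (incr k) (1 * (B + B) * T).
Proof. exact: (bdm_tint T0 (bincr_rate k)). Qed.

Let ActS k w : Act k.+1 w = Act k w + incr k w.
Proof.
rewrite /Act /incr -(tintD _ (bdm_pair2 w (bhybrid k)) (bdm_pair2 w (bincr_rate k))).
by apply: eq_tint => t _; rewrite hybridS.
Qed.

Let block_length k : tint T (fun t => \1_(block k) t) <= del.
Proof.
rewrite /tint /Rintegral.
rewrite integral_indic//=; last exact: measurable_itv.
have h : (lebesgue_measure (block k `&` `[0%R, T]%classic) <= del%:E)%E.
  apply: (@le_trans _ _ (lebesgue_measure (block k))).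
    apply: le_measure; rewrite ?inE; last exact: subIsetl.
      by apply: measurableI; exact: measurable_itv.
    exact: measurable_itv.
  rewrite /block lebesgue_measure_itv/= lte_fin.
  case: ifP => _; last by rewrite lee_fin ltW.
  by rewrite -EFinB lee_fin /grid -natr1 mulrDl mul1r addrAC subrr add0r.
by rewrite -[leRHS]/(fine del%:E) fine_le// ge0_fin_numE// (le_lt_trans h)// ltry.
Qed.

Let incr_weighted k (phi : R -> R) C D : 0 <= C -> bdm (phi : T1 -> R) D ->
  (forall t, 0 <= t <= T -> t \in block k -> `|phi t| <= C) ->
  `|tint T (fun t => \1_(block k) t * phi t)| <= C * del.
Proof.
move=> C0 bphi hphi.
have bi : bdm (fun t : T1 => \1_(block k) t : R) 1.
  split; first exact: (measurable_indic (measurable_itv _)).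
  by move=> z; rewrite indicE ger0_norm// lern1 leq_b1.
apply: (@le_trans _ _ (tint T (fun t => C * \1_(block k) t))).
  apply: (bint_normW (m := lebesgue_measure) (measurable_itv _)
    (lebesgue_measure0t_fin T) (bdmM bi bphi) (bdmZ C bi)).
  move=> t /=; rewrite in_itv/= => t0T; rewrite normrM indicE.
  have [tb|tb] := boolP (t \in block k); last by rewrite normr0 mul0r mulr0.
  by rewrite normr1 mul1r mulr1; exact: hphi.
by rewrite (tintZ C T bi) ler_wpM2l// block_length.
Qed.

Let eta := 2 * B * del.

Let incr_le k w : `|incr k w| <= eta.
Proof.
apply: (incr_weighted (C := 2 * B) _ (bdm_pair2 w (bdmB bG bH))).
  by rewrite mulr_ge0.
move=> t _ _; rewrite (le_trans (ler_normB _ _))//.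
have -> : 2 * B = B + B by ring.
by apply: lerD; [case: bG|case: bH].
Qed.

Let Z k := \int[Q]_w expR (Act k w).

Let bZ k : bdm (fun w => expR (Act k w)) (expR (B * T)).
Proof. by apply: bdm_exp; exact: bAct. Qed.

Let Z_gt0 k : 0 < Z k.
Proof.
apply: (lt_le_trans (expR_gt0 (- (B * T)))).
have -> : expR (- (B * T)) = \int[Q]_w expR (- (B * T)).
  by rewrite Rintegral_cst//= probability_setT mulr1.
apply: (le_bint measurableT (prob_fin Q) (bdm_cst _) (bZ k)) => w _.
by rewrite ler_expR; have [_ /(_ w)] := bAct k; rewrite ler_norml => /andP[].
Qed.

Let Z_scale k k' x : (forall w, Act k w <= x + Act k' w) -> Z k <= expR x * Z k'.
Proof.
move=> h; rewrite -(bintZ measurableT (prob_fin Q) _ (bZ k')).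
apply: (le_bint measurableT (prob_fin Q) (bZ k) (bdmZ _ (bZ k'))) => w _.
by rewrite -expRD ler_expR.
Qed.

Let Z_step k : Z k.+1 <= expR eta * Z k /\ Z k <= expR eta * Z k.+1.
Proof.
split; apply: Z_scale => w; have := incr_le k w; rewrite ler_norml => /andP[? ?];
  rewrite ActS; lra.
Qed.

Let ln_step k : `|ln (Z k.+1) - ln (Z k)| <= eta.
Proof. by have [h1 h2] := Z_step k; exact: ln_dist_exp (Z_gt0 k) (Z_gt0 k.+1) h1 h2. Qed.

(* Over a block lying after [gam T] the slow coordinates and the past of the
   fast one are known, and the fast coordinate has had time to equilibrate. *)
Let fresh_mean k t : gam * T <= grid k -> 0 <= t <= T -> t \in block k.+1 ->
  `|\int[Q]_w (expR (Act k w) * (G (t, w) - H (t, w)))| <= eps * B * Z k.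
Proof.
move=> gk /andP[t0 tT] /set_mem; rewrite /block /= in_itv => /andP[kt _].
have gT0 : 0 <= gam * T by rewrite mulr_ge0// ltW.
have gT : gam * T <= T by rewrite ler_piMl.
(* [s] is the time at which the fast coordinate is read at the end of the known past. Since [t] lies
   in the block after next, it exceeds [grid k] by at least [del], and the gap condition makes [u]
   at least the mixing time. *)
pose s := q j (grid k); pose u := q j t - s.
have s0 : 0 <= s by exact: q_ge0.
have gd : grid k + del <= t.
  by apply: le_trans kt; rewrite /grid -[in leRHS]natr1 mulrDl mul1r.
have ut : t1 <= u.
  apply: (le_trans (q_gap gk)); rewrite lerD2r; exact: q_mono.
have u0 : 0 <= u.
  rewrite subr_ge0; apply: q_mono; apply: le_trans gd; by rewrite lerDl ltW.
have su : s + u = q j t by rewrite /u addrC subrK.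
have qis (i : 'I_l.+1) t' : (i < j)%N -> t' <= T -> q i t' <= s.
  move=> ij t'T; apply: le_trans (q_mono _ gk).
  by apply: le_trans (q_before ij); exact: q_mono.
pose fi (i : 'I_l.+1) (w : past X s) := if (i < j)%N then X (q i t) w else X 0 w.
pose ft (w : past X s) : tupE := [tuple fi i w | i < l.+1].
have mft : measurable_fun setT ft.
  apply: measurable_mktuple => i; rewrite /fi.
  by case: (boolP (i < j)%N) => ij; apply: measurable_past_time => //; exact: qis.
pose f (z : past X s * E) := W (update (ft z.1) j z.2).
have bf : bdm f B.
  apply: (bdm_comp (h := fun z : past X s * E => (ft z.1, z.2)) _ (bdm_update j bW)).
  apply: measurable_fun_pair => //.
  exact: (measurableT_comp mft (@measurable_fst _ _ _ _)).
have fG w : f (w, X (s + u) w) = G (t, w).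
  rewrite su; apply: dW => i ij; rewrite !tnth_mktuple /=.
  case: eqP => [->//|/eqP nij]; rewrite /fi.
  by rewrite ltn_neqAle nij ij.
have fH w : \int[mu]_y f (w, y) = H (t, w).
  apply: eq_Rintegral => y _; apply: dW => i ij; rewrite !tnth_mktuple /=.
  case: eqP => // /eqP nij; rewrite ?tnth_mktuple /fi.
  by rewrite ltn_neqAle nij ij.
pose P w := semigroup p u (fun y => f (w, y)) (X s w).
have mXs : measurable_fun setT (X s : past X s -> E) by exact: measurable_past_time.
have bP : @bdm R _ Omega P B.
  have bP : bdm (P : past X s -> R) B.
    exact: (bdm_kernel (pull_kernel (p u) mXs) bf).
  exact: (bdm_past mfam bP).
(* Before [grid k] the fast coordinate is read before [s]. After it only the averaged [V] occurs,
   whose slow coordinates are read before [q j (gam * T)], hence before [s], up to the final time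
   [T]. *)
have pastA t' : 0 <= t' <= T -> bdm (fun w : past X s => hybrid k (t', w)) B.
  move=> /andP[t'0 t'T].
  rewrite (_ : (fun w => _) = fun w : past X s =>
    if t' < grid k then G (t', w) else H (t', w)); last first.
    by apply/funext => w; rewrite hybridE.
  case: (ltP t' (grid k)) => h.
    apply: (bdm_rate_past dW bW s0) => i; rewrite leq_eqVlt => /orP[/eqP/val_inj ->|ij].
      by apply: q_mono; exact: ltW.
    exact: qis.
  have dV : depends_upto j.-1 V by exact: depends_average.
  apply: (bdm_rate_past dV bV s0) => i ij; apply: qis => //.
  by rewrite (leq_ltn_trans ij)// prednK.
have bfX : bdm (fun w => f (w, X (s + u) w)) B.
  by rewrite (_ : (fun w => _) = fun w => G (t, w)); [exact: (bdm_pair1 (t : T1) bG)|apply/funext].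
have o := orth_exp mfam (bhybrid k) T0 pastA (bdmB bfX bP)
  (orth_markov mfam QM s0 u0 bf).
have b1 : bdm (fun _ : past X s => 1 : R) `|1| := bdm_cst 1.
have := o _ _ b1; under eq_Rintegral do rewrite mul1r; move=> {}o.
have bGt := bdm_pair1 (t : T1) bG; have bHt := bdm_pair1 (t : T1) bH.
have e1 : \int[Q]_w (expR (Act k w) * (G (t, w) - H (t, w))) =
    \int[Q]_w (expR (Act k w) * (P w - H (t, w))).
  apply/eqP; rewrite -subr_eq0; apply/eqP.
  rewrite -(bintB measurableT (prob_fin Q) (bdmM (bZ k) (bdmB bGt bHt))
    (bdmM (bZ k) (bdmB bP bHt))) -[RHS]o.
  apply: eq_Rintegral => w _; rewrite fG -mulrBr; congr (_ * _).
  by rewrite /P /semigroup; ring.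
rewrite e1 -(bintZ measurableT (prob_fin Q) _ (bZ k)).
apply: (bint_normW measurableT (prob_fin Q) (bdmM (bZ k) (bdmB bP bHt)) (bdmZ _ (bZ k))).
move=> w _; rewrite normrM ger0_norm ?expR_ge0// mulrC ler_wpM2r ?expR_ge0//.
by rewrite -fH; apply: mixing => //; exact: (bdm_pair1 (w : past X s) bf).
Qed.

Hypotheses (eta_small : 12 * eta ^+ 2 + eps * eta <= 2^-1) (eta2 : eta <= 2^-1).

Let eta0 : 0 <= eta. Proof. by rewrite !mulr_ge0// ltW. Qed.

Let correlation k : gam * T <= grid k ->
  `|\int[Q]_w (expR (Act k w) * incr k.+1 w)| <= eps * B * Z k * del.
Proof.
move=> gk.
have bf : bdm (fun z : T1 * Omega =>
    expR (Act k z.2) * (\1_(block k.+1) z.1 * (G z - H z))) (expR (B * T) * (1 * (B + B))).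
  exact: (bdmM (bdm_comp (@measurable_snd _ _ _ _) (bZ k)) (bincr_rate k.+1)).
have -> : \int[Q]_w (expR (Act k w) * incr k.+1 w) =
    tint T (fun t => \1_(block k.+1) t *
      \int[Q]_w (expR (Act k w) * (G (t, w) - H (t, w)))).
  transitivity (\int[Q]_w tint T (fun t =>
      expR (Act k w) * (\1_(block k.+1) t * (G (t, w) - H (t, w))))).
    apply: eq_Rintegral => w _.
    by rewrite (tintZ _ T (bdm_pair2 w (bincr_rate k.+1))).
  rewrite (tint_fubini Q T bf); apply: eq_tint => t _ /=.
  rewrite -(bintZ measurableT (prob_fin Q) (\1_(block k.+1) t)
    (bdmM (bZ k) (bdmB (bdm_pair1 (t : T1) bG) (bdm_pair1 (t : T1) bH)))).
  by apply: eq_Rintegral => w _; rewrite mulrCA.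
have bphi : bdm (fun t : T1 => \int[Q]_w (expR (Act k w) * (G (t, w) - H (t, w))))
    (expR (B * T) * (B + B) * 1).
  have := bdm_param (m := Q) measurableT (prob_fin Q)
    (bdmM (bdm_comp (@measurable_snd _ _ T1 Omega) (bZ k)) (bdmB bG bH)).
  by rewrite /= probability_setT.
apply: incr_weighted bphi _; first by rewrite !mulr_ge0// ltW.
by move=> t tT tb; exact: fresh_mean.
Qed.

(** With [y] and [u] the increments over blocks [k] and [k.+1], the term [expR (Act k) * u] is the
    correlation already bounded. What is left is [(expR y - 1) * (expR u - 1)] plus
    [expR u - (1 + u)], of size [6 * eta ^+ 2]. Going from [Z k] to [Z k.+1] at most doubles the
    constants. *)
Let fine_step k : gam * T <= grid k ->
  `|Z k.+2 - Z k.+1| <= (12 * eta ^+ 2 + eps * eta) * Z k.+1.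
Proof.
move=> gk.
have eta_exp : expR eta <= 2.
  have := @expR_sub1 _ eta eta; rewrite ger0_norm// => /(_ (lexx _) eta2).
  by rewrite ler_norml => /andP[_ ?]; have := eta2; lra.
have fin a b : a <= 2 * b ->
    6 * eta ^+ 2 * a + eps * B * a * del <= (12 * eta ^+ 2 + eps * eta) * b.
  move=> h3; have c0 : 0 <= 6 * eta ^+ 2 + eps * eta / 2.
    apply: addr_ge0; first by apply: mulr_ge0 => //; exact: sqr_ge0.
    by rewrite divr_ge0// mulr_ge0.
  have -> : 6 * eta ^+ 2 * a + eps * B * a * del = (6 * eta ^+ 2 + eps * eta / 2) * a.
    by rewrite /eta; field.
  have -> : (12 * eta ^+ 2 + eps * eta) * b = (6 * eta ^+ 2 + eps * eta / 2) * (2 * b) by field.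
  exact: ler_wpM2l.
have b2 := bZ k.+2; have b1 := bZ k.+1; have b0 := bZ k.
have bU := bdmM b0 (bincr k.+1).
have e : Z k.+2 - Z k.+1 - \int[Q]_w (expR (Act k w) * incr k.+1 w) =
    \int[Q]_w (expR (Act k.+2 w) - expR (Act k.+1 w) - expR (Act k w) * incr k.+1 w).
  by rewrite (bintB measurableT (prob_fin Q) (bdmB b2 b1) bU)
    (bintB measurableT (prob_fin Q) b2 b1).
have h1 : `|Z k.+2 - Z k.+1 - \int[Q]_w (expR (Act k w) * incr k.+1 w)| <=
    6 * eta ^+ 2 * Z k.
  rewrite e -(bintZ measurableT (prob_fin Q) _ b0).
  apply: (bint_normW measurableT (prob_fin Q) (bdmB (bdmB b2 b1) bU) (bdmZ _ b0)).
  move=> w _; rewrite !ActS !expRD.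
  have z1 := expR_sub1 (incr_le k w) eta2; have u1 := expR_sub1 (incr_le k.+1 w) eta2.
  have u2 := expR_sub1D (incr_le k.+1 w) eta2.
  move: (incr k w) (incr k.+1 w) z1 u1 u2 (expR_gt0 (Act k w)) => y u z1 u1 u2.
  move: (expR (Act k w)) => a a0.
  rewrite (_ : _ - _ = a * ((expR y - 1) * (expR u - 1) + (expR u - (1 + u)))); last by ring.
  rewrite normrM gtr0_norm// [leRHS]mulrC ler_pM2l//.
  rewrite (le_trans (ler_normD _ _))// normrM.
  have -> : 6 * eta ^+ 2 = 2 * eta * (2 * eta) + 2 * eta ^+ 2 by ring.
  by apply: lerD => //; apply: ler_pM.
have h2 := correlation gk.
have h3 : Z k <= 2 * Z k.+1.
  by have [_ /le_trans] := Z_step k; apply; rewrite ler_pM2r ?Z_gt0.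
exact: le_trans (norm_le_dist h1 h2) (fin _ _ h3).
Qed.

Let fine_ln_step k : gam * T <= grid k ->
  `|ln (Z k.+2) - ln (Z k.+1)| <= 2 * (12 * eta ^+ 2 + eps * eta).
Proof.
move=> gk; apply: ln_dist (fine_step gk) => //.
by apply: addr_ge0; [apply: mulr_ge0 => //; exact: sqr_ge0|rewrite mulr_ge0].
Qed.

(** Up to block [m.+1] each step is paid at the crude price [eta]; afterwards the mixing estimate
    makes it of second order. *)
Let ln_dist0 m k : gam * T <= grid m ->
  `|ln (Z k) - ln (Z 0)| <= eta * m.+1%:R + 2 * (12 * eta ^+ 2 + eps * eta) * k%:R.
Proof.
move=> gm; set x := 12 * _ + _.
have x0 : 0 <= x.
  by apply: addr_ge0; [apply: mulr_ge0 => //; exact: sqr_ge0|rewrite mulr_ge0].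
have small n : `|ln (Z n) - ln (Z 0)| <= eta * n%:R.
  elim: n => [|n IH]; first by rewrite subrr normr0 mulr0.
  apply: (le_trans (ler_distD (ln (Z n)) _ _)).
  by rewrite -[n.+1%:R]natr1 mulrDr mulr1 [leRHS]addrC; apply: lerD (ln_step n) IH.
have [km|mk] := leqP k m.+1.
  apply: (le_trans (small k)); rewrite -[leLHS]addr0; apply: lerD.
    by rewrite ler_wpM2l// ler_nat.
  by rewrite mulr_ge0// mulr_ge0.
rewrite -(subnKC (ltnW mk)); move: (k - m.+1)%N => n {k mk}.
elim: n => [|n IH].
  rewrite addn0 (le_trans (small _))// lerDl mulr_ge0// mulr_ge0//.
rewrite addnS; apply: (le_trans (ler_distD (ln (Z (m.+1 + n)%N)) _ _)).
rewrite -[(m.+1 + n).+1%:R]natr1 mulrDr mulr1 addrA [leRHS]addrC; apply: lerD IH.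
rewrite addSn; apply: fine_ln_step; rewrite (le_trans gm)// /grid.
by apply: ler_wpM2r; [exact: ltW|rewrite ler_nat leq_addr].
Qed.

(** There are about [gam * T / del] crude steps at price [2 * B * del] and at most [T / del + 1]
    fine ones at price [2 * (12 * eta ^+ 2 + eps * eta)], with [eta = 2 * B * del]. Rounding to
    whole blocks produces the last bracket. *)
Lemma ln_average_dist :
  `|ln (\int[Q]_w expR (tint T (fun t => G (t, w)))) -
    ln (\int[Q]_w expR (tint T (fun t => H (t, w))))| <=
  (2 * B * gam + 96 * B ^+ 2 * del + 4 * eps * B) * T + (4 * B * del + 1).
Proof.
pose m := (Num.truncn (gam * T / del)).+1; pose N := (Num.truncn (T / del)).+1.
have trd x : 0 <= x -> x < (Num.truncn (x / del)).+1%:R * del /\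
    (Num.truncn (x / del))%:R * del <= x.
  move=> x0; have xd : 0 <= x / del by rewrite divr_ge0// ltW.
  have /andP[h1 h2] := truncn_itv xd.
  by rewrite -ltr_pdivrMr// -ler_pdivlMr.
have gT0 : 0 <= gam * T by rewrite mulr_ge0// ltW.
have [gm mle] := trd _ gT0; have [TN Nle] := trd _ T0.
have eG : \int[Q]_w expR (tint T (fun t => G (t, w))) = Z N.
  apply: eq_Rintegral => w _; congr expR; apply: eq_tint => t /andP[_ tT].
  by rewrite hybridE (le_lt_trans tT).
have eH : \int[Q]_w expR (tint T (fun t => H (t, w))) = Z 0.
  apply: eq_Rintegral => w _; congr expR; apply: eq_tint => t /andP[t0 _].
  by rewrite hybridE /grid mul0r ltNge t0.
have d0 := ln_dist0 N (ltW gm).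
rewrite eG.
rewrite eH.
apply: (le_trans d0).
clear d0 eG eH.
have h1 : eta * m.+1%:R <= 2 * B * (gam * T) + 4 * B * del.
  have -> : eta * m.+1%:R = 2 * B * ((Num.truncn (gam * T / del))%:R * del) + 4 * B * del.
    by rewrite /eta /m -natr1 -natr1; ring.
  by rewrite lerD2r ler_wpM2l// mulr_ge0.
have h2 : 2 * (12 * eta ^+ 2 + eps * eta) * N%:R <= (96 * B ^+ 2 * del + 4 * eps * B) * T + 1.
  have -> : 2 * (12 * eta ^+ 2 + eps * eta) * N%:R =
    (96 * B ^+ 2 * del + 4 * eps * B) * ((Num.truncn (T / del))%:R * del) +
    2 * (12 * eta ^+ 2 + eps * eta) by rewrite /eta /N -natr1; ring.
  apply: lerD; last by have := eta_small; lra.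
  rewrite ler_wpM2l//; apply: addr_ge0; rewrite !mulr_ge0// ltW//.
apply: (le_trans (lerD h1 h2)); rewrite le_eqVlt; apply/orP; left; apply/eqP; ring.
Qed.

End grid.
End averaging.

Lemma ln_growth_dist (R : realType) (C a y : R) : 0 < C ->
  C^-1 * expR a <= y <= C * expR a -> `|ln y - a| <= `|ln C|.
Proof.
move=> C0 /andP[lo hi].
have lo0 : 0 < C^-1 * expR a by rewrite mulr_gt0 ?invr_gt0 ?expR_gt0.
have y0 := lt_le_trans lo0 lo.
have h1 : - ln C + a <= ln y.
  by rewrite -lnV ?posrE// -[a]expRK -lnM ?posrE ?invr_gt0 ?expR_gt0// ler_ln ?posrE.
have h2 : ln y <= ln C + a.
  by rewrite -[a]expRK -lnM ?posrE ?expR_gt0// ler_ln ?posrE// (lt_le_trans y0).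
have := ler_norm (ln C); have := ler_norm (- ln C); rewrite normrN.
by rewrite ler_norml; lra.
Qed.

Lemma averaging_constants (R : realType) (C zeta : R) : 1 <= C -> 0 < zeta ->
  exists gam del eps M : R, [/\ 0 < gam, gam <= 1, 0 < del & 0 < eps] /\
    [/\ 12 * (2 * C * del) ^+ 2 + eps * (2 * C * del) <= 2^-1,
        2 * C * del <= 2^-1 &
        forall T, M <= T -> (2 * C * gam + 96 * C ^+ 2 * del + 4 * eps * C) * T +
          (4 * C * del + 1) <= zeta * T].
Proof.
move=> C1 zeta0; have C0 : 0 < C by exact: lt_le_trans C1.
have [z [z0 z1 zz]] : exists z, [/\ 0 < z, z <= 1 & z <= zeta].
  by exists (Num.min 1 zeta); rewrite lt_min ltr01 zeta0 !ge_min !lexx orbT.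
(* Each of the three terms of the slope becomes [z / 8]. For [T] at least [8 / z] the remaining
   [5 / 8 * z * T] is at least 5 and absorbs the additive constant. *)
exists (z / (16 * C)), (z / (768 * C ^+ 2)), (z / (32 * C)), (8 / z).
have C2 : 0 < C ^+ 2 by exact: exprn_gt0.
have etaE : 2 * C * (z / (768 * C ^+ 2)) = z / C / 384 by field; exact: lt0r_neq0.
have zC0 : 0 < z / C by exact: divr_gt0.
have zC1 : z / C <= 1 by rewrite ler_pdivrMr// mul1r (le_trans z1).
rewrite -[4 * C * _](_ : 2 * (2 * C * (z / (768 * C ^+ 2))) = _); last by ring.
have -> : z / (16 * C) = z / C / 16 by field; exact: lt0r_neq0.
have -> : z / (32 * C) = z / C / 32 by field; exact: lt0r_neq0.
have cE : 2 * C * (z / C / 16) + 96 * C ^+ 2 * (z / (768 * C ^+ 2)) +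
    4 * (z / C / 32) * C = z * (3 / 8) by field; exact: lt0r_neq0.
rewrite {}cE {}etaE; split.
  clear zz z1 zeta0 zeta.
  split.
        lra.
      lra.
    apply: divr_gt0 z0 _. apply: mulr_gt0 C2.
    exact: ltr0Sn.
  lra.
move: (z / C) zC0 zC1 => e e0 e1.
split; [|lra|].
  have : e ^+ 2 <= e by rewrite expr2 ler_piMl// ltW.
  rewrite (_ : 12 * _ + _ = e ^+ 2 * (12 / 384 ^+ 2 + 1 / (32 * 384))); last by field.
  lra.
move=> T MT; have T8 : 8 <= z * T by rewrite mulrC -ler_pdivrMr.
have T0 : 0 <= T by apply: le_trans MT; rewrite divr_ge0// ltW.
have : z * T <= zeta * T by exact: ler_wpM2r.
have -> : z * (3 / 8) * T = (z * T) * (3 / 8) by ring.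
lra.
Qed.

(** * Reduction to a function of the slowest coordinate *)

Section nonconventional_average.
Context (R : realType) (dO dE : measure_display).
Context (Omega : measurableType dO) (E : measurableType dE).
Variables (X : R -> Omega -> E) (p : R -> R.-pker E ~> E).
Variable Px : R.-pker E ~> Omega.
Hypothesis mfam : markov_family X p Px.
Variable mu : probability E R.
Hypotheses (doeblin : strong_doeblin p) (inv_mu : invariant_measure p mu).
Variables (Q : probability Omega R) (QM : markov_property X p Q).
Variables (l : nat) (q : 'I_l.+1 -> R -> R).
Notation tupE := (l.+1.-tuple E).
Hypothesis q_ge0 : forall i t, 0 <= q i t.
Hypothesis q_mono : forall i s t, s <= t -> q i s <= q i t.
Hypothesis q_order : forall (i j : 'I_l.+1) (gam : R), (i < j)%N -> 0 < gam -> gam <= 1 ->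
  \forall t \near +oo, q i t <= q j (gam * t).
Hypothesis q_gap : forall (j : 'I_l.+1) (del : R), (0 < j)%N -> 0 < del ->
  (q j (t + del) - q j t) @[t --> +oo] --> +oo.

Definition log_mean W T := ln (\int[Q]_w expR (tint T (fun t => rate X q W (t, w)))).

Lemma log_mean_average W B (j : 'I_l.+1) zeta : bdm W B -> depends_upto j W ->
  (0 < j)%N -> 0 < zeta ->
  \forall T \near +oo, `|log_mean W T - log_mean (average mu j W) T| <= zeta * T.
Proof.
move=> bW0 dW j0 zeta0.
have [C [C1 bW]] : exists C, 1 <= C /\ bdm W C.
  exists (Num.max 1 B); rewrite le_max lexx; split=> //.
  by apply: bdmW bW0 _; rewrite le_max lexx orbT.
have [gam [del [eps [T1 [[gam0 gam1 del0 eps0] [small eta2 final]]]]]] :=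
  averaging_constants C1 zeta0.
have [t1 [_ mix]] := semigroup_mixing mfam inv_mu doeblin eps0.
have [M [_ hM]] : \forall t \near +oo, t1 <= q j (t + del) - q j t.
  exact: (cvgryPge _).1 (q_gap j0 del0) t1.
have ord : \forall T \near +oo, forall i : 'I_l.+1, (i < j)%N -> q i T <= q j (gam * T).
  apply: filter_forall => i; have [ij|nij] := boolP (i < j)%N; last exact: nearW.
  by apply: filterS (q_order ij gam0 gam1) => T h _.
near=> T.
have T0 : 0 <= T by near: T; apply: nbhs_pinfty_ge; exact: num_real.
have MT : M < gam * T.
  rewrite mulrC -ltr_pdivrMr//; near: T; apply: nbhs_pinfty_gt; exact: num_real.
have before : forall i : 'I_l.+1, (i < j)%N -> q i T <= q j (gam * T) by near: T.
have gap t : gam * T <= t -> t1 <= q j (t + del) - q j t.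
  by move=> gt; apply: hM; exact: lt_le_trans gt.
have := ln_average_dist mfam QM q_ge0 q_mono bW C1 dW j0 mix
  (ltW eps0) T0 del0 gam0 gam1 before gap small eta2.
move=> /le_trans; apply; apply: final.
near: T; apply: nbhs_pinfty_ge; exact: num_real.
Unshelve. all: by end_near.
Qed.

(** Coordinates are averaged from the fastest, of index [l], downwards: at each stage the coordinate
    removed is the fastest on which the function still depends. *)
Fixpoint averaged (k : nat) W : tupE -> R :=
  if k is k'.+1 then average mu (inord (l - k')) (averaged k' W) else W.

Lemma bdm_averaged k W B : bdm W B -> bdm (averaged k W) B.
Proof. by move=> bW; elim: k => //= k IH; exact: bdm_average. Qed.

Lemma depends_averaged k W : depends_upto (l - k) (averaged k W).
Proof.
elim: k => [|k IH] /=; first by rewrite subn0; exact: depends_all.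
have := @depends_average _ _ _ mu _ (inord (l - k)) (averaged k W).
by rewrite inordK ?ltnS ?leq_subr// subnS; apply.
Qed.

Lemma log_mean_averaged k W B zeta : (k <= l)%N -> bdm W B -> 0 < zeta ->
  \forall T \near +oo, `|log_mean W T - log_mean (averaged k W) T| <= zeta * T.
Proof.
move=> kl bW; elim: k kl zeta => [|k IH] kl zeta z0 /=.
  apply: filterS (nbhs_pinfty_ge (num_real 0)) => T T0.
  by rewrite subrr normr0 mulr_ge0// ltW.
have z2 : 0 < zeta / 2 by rewrite divr_gt0.
have jE : @inord l (l - k) = (l - k)%N :> nat by rewrite inordK ?ltnS ?leq_subr.
have dA : depends_upto (@inord l (l - k)) (averaged k W).
  by rewrite jE; exact: depends_averaged.
have j0 : (0 < @inord l (l - k))%N by rewrite jE subn_gt0.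
have h2 := log_mean_average (bdm_averaged k bW) dA j0 z2.
have h1 := IH (ltnW kl) _ z2.
apply: filterS2 h1 h2 => T h1 h2.
apply: (le_trans (ler_distD (log_mean (averaged k W) T) _ _)).
rewrite [zeta in leRHS]splitr mulrDl; exact: lerD h1 h2.
Qed.

(** The coordinate averaged last has the smallest index and is the outermost integral, which matches
    the order of [iterated_integral]. The last [k] entries of the tuple come from [y]; the default
    of [nth] is never reached. *)
Lemma averagedE k W (z : tupE) : (k <= l)%N ->
  averaged k W z = iterated_integral mu (fun y : k.-tuple E =>
    W [tuple if (i + k < l.+1)%N then tnth z i else nth (tnth z i) y (i + k - l.+1)
       | i < l.+1]).
Proof.
elim: k z => [|k IH] z kl /=.
  congr W; apply: eq_from_tnth => i; by rewrite tnth_mktuple addn0 ltn_ord.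
apply: eq_Rintegral => y0 _; rewrite IH ?(ltnW kl)//.
congr (iterated_integral mu _); apply/funext => y; congr W.
apply: eq_from_tnth => i; rewrite !tnth_mktuple.
have jE : @inord l (l - k) = (l - k)%N :> nat by rewrite inordK ?ltnS ?leq_subr.
rewrite -(inj_eq val_inj) /= jE.
rewrite addnS; case: (ltngtP i (l - k)%N) => ik.
- have -> : (i + k < l.+1)%N by lia.
  by have -> : ((i + k).+1 < l.+1)%N by lia.
- have -> : (i + k < l.+1)%N = false by lia.
  have -> : ((i + k).+1 < l.+1)%N = false by lia.
  have -> : ((i + k).+1 - l.+1 = (i + k - l.+1).+1)%N by lia.
  by apply: set_nth_default; rewrite size_tuple; have := ltn_ord i; lia.
- have -> : (i + k < l.+1)%N by lia.
  have -> : ((i + k).+1 < l.+1)%N = false by lia.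
  by have -> : ((i + k).+1 - l.+1 = 0)%N by lia.
Qed.

Lemma averaged_full W (z : tupE) :
  averaged l W z = iterated_integral mu (fun y => W [tuple of tnth z ord0 :: y]).
Proof.
rewrite averagedE//; congr (iterated_integral mu _); apply/funext => y; congr W.
apply: eq_from_tnth => i; rewrite tnth_mktuple.
case: (unliftP ord0 i) => [i' ->|->].
  rewrite tnthS lift0 addSn ltnS ltnNge leq_addl /= subSS addnK.
  by rewrite -tnth_nth.
by rewrite tnth0 add0n ltnSn.
Qed.

Lemma bdm_iterated_mean W B : bdm W B ->
  bdm (fun x : E => iterated_integral mu (fun y : l.-tuple E => W [tuple of x :: y])) B.
Proof.
move=> bW; rewrite (_ : (fun x => _) = fun x => averaged l W [tuple x | i < l.+1]).
  apply: (bdm_comp _ (bdm_averaged l bW)).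
  by apply: (measurable_mktuple (f := fun _ x => x)) => i; exact: measurable_id.
by apply/funext => x; rewrite averaged_full tnth_mktuple.
Qed.

Variable alpha : R.
Hypothesis alpha0 : 0 < alpha.
Hypothesis q_first : forall t, 0 <= t -> q ord0 t = alpha * t.

Lemma log_mean_full W B T : bdm W B -> 0 <= T ->
  log_mean (averaged l W) T = ln (\int[Q]_w fk_op X Px alpha
    (fun x => iterated_integral mu (fun y : l.-tuple E => W [tuple of x :: y])) T (fun=> 1) (X 0 w)).
Proof.
move=> bW T0.
rewrite -(fk_op_start mfam (ltW alpha0) QM T0 (bdm_iterated_mean bW) bdm1).
congr ln; apply: eq_Rintegral => w _; rewrite /fk mulr1; congr expR.
apply: eq_tint => t /andP[t0 _]; rewrite /rate averaged_full tnth_mktuple /=.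
by rewrite q_first// add0r.
Qed.

(** After full averaging the logarithm differs from [Lam * T] by a bounded amount, since the bounds
    in [growth] survive integration over the initial law; averaging itself costs an arbitrarily
    small multiple of [T]. *)
Lemma nonconventional_growth W B Lam : bdm W B ->
  growth X Px alpha (fun x => iterated_integral mu (fun y : l.-tuple E => W [tuple of x :: y])) Lam ->
  T^-1 * log_mean W T @[T --> +oo] --> Lam.
Proof.
move=> bW [C C0 hC]; apply/cvgrPdist_le => e e0.
have e2 : 0 < e / 2 by rewrite divr_gt0.
have full T : 0 <= T -> `|log_mean (averaged l W) T - Lam * T| <= `|ln C|.
  move=> T0; rewrite (log_mean_full bW T0).
  set g := (fun x : E => iterated_integral _ _); have bg : bdm g B by exact: bdm_iterated_mean.
  have bh := bdm_fk_op mfam alpha T0 bg bdm1.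
  have bhX := bdm_comp (measurable_time mfam 0) bh.
  have cst c : \int[Q]_w c = c by rewrite Rintegral_cst//= probability_setT mulr1.
  have lo : C^-1 * expR (Lam * T) <= \int[Q]_w fk_op X Px alpha g T (fun=> 1) (X 0 w).
    rewrite -[leLHS]cst.
    apply: (le_bint measurableT (prob_fin Q) (bdm_cst _) bhX) => w _.
    by have /andP[] := hC T (X 0 w) T0.
  have hi : \int[Q]_w fk_op X Px alpha g T (fun=> 1) (X 0 w) <= C * expR (Lam * T).
    rewrite -[leRHS]cst.
    apply: (le_bint measurableT (prob_fin Q) bhX (bdm_cst _)) => w _.
    by have /andP[] := hC T (X 0 w) T0.
  by apply: ln_growth_dist => //; rewrite lo hi.
have near_full := log_mean_averaged (leqnn l) bW e2.
near=> T.
have T0 : 0 < T by near: T; apply: nbhs_pinfty_gt; exact: num_real.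
have h1 : `|log_mean W T - log_mean (averaged l W) T| <= e / 2 * T by near: T.
have h2 : `|ln C| <= e / 2 * T.
  by rewrite mulrC -ler_pdivrMr//; near: T; apply: nbhs_pinfty_ge; exact: num_real.
have h3 : `|log_mean W T - Lam * T| <= e * T.
  apply: (le_trans (ler_distD (log_mean (averaged l W) T) _ _)).
  rewrite [e in leRHS]splitr mulrDl; apply: lerD h1 _.
  exact: le_trans (full _ (ltW T0)) h2.
have -> : Lam - T^-1 * log_mean W T = T^-1 * (Lam * T - log_mean W T).
  by rewrite mulrBr mulrCA mulVf ?mulr1// gt_eqF.
by rewrite normrM gtr0_norm ?invr_gt0// mulrC ler_pdivrMr// distrC.
Unshelve. all: by end_near.
Qed.

End nonconventional_average.

(** * Large deviations *)

Section limits_at_infinity.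
Context (R : realType).

Lemma limf_esup_le (f : R -> \bar R) (c : \bar R) :
  (\forall T \near +oo, (f T <= c)%E) -> (limf_esup f +oo%R <= c)%E.
Proof.
move=> h; apply: ge_ereal_inf; exists (ereal_sup (f @` [set T | (f T <= c)%E])).
  by exists [set T | (f T <= c)%E].
by apply: ge_ereal_sup => _ [T /= fT <-].
Qed.

Lemma limf_einf_ge (f : R -> \bar R) (c : \bar R) :
  (\forall T \near +oo, (c <= f T)%E) -> (c <= limf_einf f +oo%R)%E.
Proof.
move=> h; rewrite /limf_einf leeNr; apply: limf_esup_le.
by apply: filterS h => T; rewrite leeN2.
Qed.

Lemma lne_mono (x y : \bar R) : (0 <= x -> x <= y -> lne x <= lne y)%E.
Proof.
by move=> x0 xy; rewrite lee_lne// in_itv/= leey andbT// (le_trans x0).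
Qed.

End limits_at_infinity.

Section large_deviations.
Context (R : realType) d (Omega : measurableType d) (P : probability Omega R).
Variables (S : R -> Omega -> R) (B : R) (Lam : R -> R).
Hypothesis bS : forall T, 0 <= T -> bdm (S T) (B * T).

Definition moment lam T : R := \int[P]_w expR (lam * S T w).

Hypothesis cvg_moment : forall lam, T^-1 * ln (moment lam T) @[T --> +oo] --> Lam lam.

Let bexp lam T : 0 <= T -> bdm (fun w => expR (lam * S T w)) (expR (`|lam| * (B * T))).
Proof. by move=> T0; apply: bdm_exp; apply: bdmZ; exact: bS. Qed.

Let pint_cst c : \int[P]_w c = c.
Proof. by rewrite Rintegral_cst//= probability_setT mulr1. Qed.

Let moment_gt0 lam T : 0 <= T -> 0 < moment lam T.
Proof.
move=> T0; apply: (lt_le_trans (expR_gt0 (- (`|lam| * (B * T))))).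
rewrite -[leLHS]pint_cst.
apply: (le_bint measurableT (prob_fin P) (bdm_cst _) (bexp lam T0)) => w _.
rewrite ler_expR; have [_ /(_ w)] := bdmZ lam (bS T0).
by rewrite ler_norml => /andP[].
Qed.

Lemma moment_bounds lam e : 0 < e -> \forall T \near +oo,
  expR (T * (Lam lam - e)) <= moment lam T <= expR (T * (Lam lam + e)).
Proof.
move=> e0; have /cvgrPdist_le /(_ e e0) h := @cvg_moment lam.
apply: filterS2 h (nbhs_pinfty_gt (num_real 0)) => T h T0.
have m0 := moment_gt0 lam (ltW T0).
move: h; rewrite ler_norml => /andP[h1 h2].
have e1 : T * (T^-1 * ln (moment lam T)) = ln (moment lam T).
  by rewrite mulrA mulfV ?mul1r// gt_eqF.
rewrite -[moment lam T]lnK ?posrE// !ler_expR -e1 !ler_pM2l//.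
by apply/andP; split; lra.
Qed.

Let pr (A : set Omega) := \int[P]_w \1_A w.

Let prE A : measurable A -> P A = (pr A)%:E.
Proof.
move=> mA; rewrite /pr /Rintegral integral_indic// setIT fineK//.
exact: fin_num_measure.
Qed.

Let bindicP (A : set Omega) : measurable A -> bdm (fun w : Omega => \1_A w : R) 1.
Proof.
move=> mA; split; first exact: measurable_indic.
by move=> w; rewrite indicE ger0_norm// lern1 leq_b1.
Qed.

Let v T w := T^-1 * S T w.

Let bv T : 0 < T -> bdm (v T) B.
Proof.
move=> T0; have := bdmZ T^-1 (bS (ltW T0)); rewrite gtr0_norm ?invr_gt0//.
by rewrite mulrCA mulVf ?mulr1// gt_eqF.
Qed.

Let SE T w : 0 < T -> S T w = T * v T w.
Proof. by move=> T0; rewrite /v mulrA mulfV ?mul1r// gt_eqF. Qed.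

Lemma measurable_average T (G : set (measurableTypeR R)) : 0 < T -> measurable G ->
  measurable [set w | G (v T w)].
Proof.
by move=> T0 mG; have [mv _] := bv T0; rewrite -[X in measurable X]setTI; exact: mv.
Qed.

Let half lam a : set (measurableTypeR R) := [set u | a <= lam * u - Lam lam].

Let mhalf lam a : measurable (half lam a).
Proof.
rewrite -[X in measurable X]setTI.
have mf : measurable_fun setT (fun u : R => lam * u - Lam lam).
  by apply: measurable_funB => //; exact: measurable_funM.
rewrite /half (_ : [set u | _] = (fun u : R => lam * u - Lam lam) @^-1` `[a, +oo[%classic).
  by apply: mf => //; exact: measurable_itv.
by apply/seteqP; split=> u /=; rewrite in_itv/= andbT.
Qed.

Let chernoff lam a e : 0 < e -> \forall T \near +oo,
  (P [set w | half lam a (v T w)] <= (expR (- (T * (a - e))))%:E)%E.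
Proof.
move=> e0; apply: filterS2 (moment_bounds lam e0) (nbhs_pinfty_gt (num_real 0)).
move=> T /andP[_ hi] T0.
have mD := measurable_average T0 (mhalf lam a).
rewrite (prE mD) lee_fin /pr.
have le1 : \int[P]_w \1_[set w | half lam a (v T w)] w <=
    \int[P]_w (expR (- (T * (a + Lam lam))) * expR (lam * S T w)).
  apply: (le_bint measurableT (prob_fin P) (bindicP mD) (bdmZ _ (bexp lam (ltW T0)))).
  move=> w _; rewrite indicE -expRD; case: (boolP (w \in _)) => [/set_mem|_]; last first.
    exact: expR_ge0.
  rewrite /half /= => h; rewrite -expR0 ler_expR (SE _ T0).
  have : T * a <= T * (lam * v T w - Lam lam) by rewrite ler_pM2l.
  by move: (v T w) => x; rewrite (mulrCA lam T); lra.
apply: (le_trans le1); rewrite (bintZ measurableT (prob_fin P) _ (bexp lam (ltW T0))).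
apply: (le_trans (ler_wpM2l (expR_ge0 _) hi)).
by rewrite -expRD ler_expR; lra.
Qed.

Definition J u : \bar R := ereal_sup [set (lam * u - Lam lam)%:E | lam in setT].

Let munion a (s : seq R) T : 0 < T ->
  measurable [set w | exists2 lam, lam \in s & half lam a (v T w)].
Proof.
move=> T0; elim: s => [|x s IHs].
  by rewrite (_ : [set w | _] = set0)// -subset0 => w [].
rewrite (_ : [set w | _] = [set w | half x a (v T w)] `|`
    [set w | exists2 lam, lam \in s & half lam a (v T w)]).
  by apply: measurableU => //; exact: measurable_average (mhalf x a).
apply/seteqP; split=> w /=.
  by move=> [y]; rewrite inE => /orP[/eqP ->|ys] hy; [left|right; exists y].
  move=> [hx|[y ys hy]]; first by exists x => //; rewrite mem_head.
  by exists y => //; rewrite inE ys orbT.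
Qed.

Let union_bound (s : seq R) a e : 0 < e -> \forall T \near +oo,
  (P [set w | exists2 lam, lam \in s & half lam a (v T w)]
    <= ((size s)%:R * expR (- (T * (a - e))))%:E)%E.
Proof.
move=> e0; elim: s => [|lam s IH].
  apply: nearW => T; rewrite (_ : [set w | _] = set0) ?measure0 ?mul0r//.
  by rewrite -subset0 => w [].
apply: filterS3 (chernoff lam a e0) IH (nbhs_pinfty_gt (num_real 0)) => T h1 h2 T0.
rewrite (_ : [set w | _] = [set w | half lam a (v T w)] `|`
    [set w | exists2 lam, lam \in s & half lam a (v T w)]); last first.
  apply/seteqP; split=> w /=.
    by move=> [y]; rewrite inE => /orP[/eqP ->|ys] hy; [left|right; exists y].
  move=> [hx|[y ys hy]]; first by exists lam => //; rewrite mem_head.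
  by exists y => //; rewrite inE ys orbT.
have m1 := measurable_average T0 (mhalf lam a); have m2 := munion a s T0.
rewrite (prE (measurableU _ _ m1 m2)).
move: h1 h2; rewrite (prE m1) (prE m2) !lee_fin => h1 h2.
apply: (@le_trans _ _ (pr [set w | half lam a (v T w)] +
    pr [set w | exists2 lam, lam \in s & half lam a (v T w)])).
  rewrite /pr -(bintD measurableT (prob_fin P) (bindicP m1) (bindicP m2)).
  apply: (le_bint measurableT (prob_fin P) (bindicP (measurableU _ _ m1 m2))
    (bdmD (bindicP m1) (bindicP m2))) => w _.
  rewrite !indicE in_setU.
  by case: (w \in _); case: (w \in _); rewrite /= ?addr0 ?add0r// lerDl.
by rewrite -natr1 mulrDl mul1r addrC; exact: lerD.
Qed.

(** The averages take values in [[- B, B]], so [K] may be treated as compact: finitely many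
    half-lines on which some linear functional exceeds [a] cover it, and the Chernoff bound is
    summed over them. *)
Lemma upper_bound_level (K : set R) (a : R) : closed K ->
  (forall u, K u -> (a%:E < J u)%E) ->
  (limf_esup (fun T : R => (T^-1)%:E * lne (P [set w | K (v T w)])) +oo%R <= (- a)%:E)%E.
Proof.
move=> cK hK.
have [s hs] : exists s : seq R, forall u, K u -> - B <= u <= B ->
    exists2 lam, lam \in s & half lam a u.
  have cpt : compact (`[- B, B] `&` K).
    by apply: compact_closedI => //; exact: segment_compact.
  move: cpt; rewrite compact_cover.
  move=> /(_ R setT (fun lam => [set u : R | a < lam * u - Lam lam])) [].
  - move=> lam _; apply: (@open_comp _ _ (fun u : R => lam * u - Lam lam) [set y | a < y]).
      move=> u _; apply: cvgB; last exact: cvg_cst.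
      by apply: cvgM; [exact: cvg_cst|exact: cvg_id].
    exact: open_gt.
  - move=> u [_ Ku]; have := hK u Ku; rewrite /J => /ereal_sup_gt[_ [lam _ <-]].
    by rewrite lte_fin; exists lam.
  move=> D _ hD; exists (finmap.enum_fset D) => u Ku uB.
  have [|lam lamD h] := hD u; first by split=> //=; rewrite in_itv.
  by exists lam => //; exact: ltW.
apply/lee_addgt0Pr => e e0; apply: limf_esup_le.
have e2 : 0 < e / 2 by exact: divr_gt0.
(* The successor keeps the prefactor positive when the cover is empty, so its logarithm is harmless;
   divided by [T] it vanishes. *)
pose n : R := (size s).+1%:R; have n0 : 0 < n by rewrite ltr0n.
apply: filterS3 (union_bound s a e2) (nbhs_pinfty_gt (num_real 0))
  (nbhs_pinfty_ge (num_real (ln n / (e / 2)))) => T h T0 hT.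
have mK : measurable (K : set (measurableTypeR R)) by exact: closed_measurable.
have pK : (P [set w | K (v T w)] <= (n * expR (- (T * (a - e / 2))))%:E)%E.
  have mKw := measurable_average T0 mK.
  have mU := munion a s T0.
  apply: (@le_trans _ _ (P [set w | exists2 lam, lam \in s & half lam a (v T w)])).
    apply: le_measure; rewrite ?inE// => w /= Kw; apply: hs => //.
    by have [_ /(_ w)] := bv T0; rewrite ler_norml.
  by apply: (le_trans h); rewrite lee_fin ler_wpM2r ?expR_ge0// ler_nat.
have T1 : (0 <= (T^-1)%:E)%E by rewrite lee_fin invr_ge0 ltW.
have E0 : 0 < n * expR (- (T * (a - e / 2))) by rewrite mulr_gt0 ?expR_gt0.
apply: (@le_trans _ _ ((T^-1)%:E * lne (n * expR (- (T * (a - e / 2))))%:E)%E).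
  apply: lee_wpmul2l => //.
  by apply: lne_mono => //; exact: measure_ge0.
rewrite lne_EFin// -EFinM -EFinD lee_fin lnM ?posrE ?expR_gt0// expRK.
rewrite mulrDr mulrN mulrA mulVf ?mul1r ?gt_eqF//.
have : T^-1 * ln n <= e / 2 by rewrite mulrC ler_pdivrMr// mulrC -ler_pdivrMr.
lra.
Qed.

Lemma large_deviations_upper (K : set R) : closed K ->
  (limf_esup (fun T : R => (T^-1)%:E * lne (P [set w | K (T^-1 * S T w)%R])) +oo%R
   <= - ereal_inf [set J u | u in K])%E.
Proof.
move=> cK; set L := limf_esup _ _; set I := ereal_inf _.
have level a : (a%:E < I)%E -> (L <= (- a)%:E)%E.
  move=> aI; apply: upper_bound_level => // u Ku; apply: lt_le_trans aI _.
  by apply: ge_ereal_inf; exists (J u) => //; exists u.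
case: I level => [r||] level /=; last by rewrite leey.
  apply/lee_addgt0Pr => e e0.
  have := level (r - e); rewrite lte_fin gtrBl => /(_ e0).
  by rewrite -EFinD opprB addrC.
move: L level => [x| |]//= level.
  by have := level (1 - x)%R; rewrite ltry lee_fin => /(_ isT) ?; exfalso; lra.
by have := level 0%R; rewrite ltry => /(_ isT).
Qed.

(** For nonzero [h], the half-line at distance at least [del] from [u], on the side given by the
    sign of [h]. *)
Let far h u del : set (measurableTypeR R) := [set x | `|h| * del <= h * (x - u)].

Let mfar h u del : measurable (far h u del).
Proof.
have mf : measurable_fun setT (fun x : measurableTypeR R => h * (x - u) : measurableTypeR R).
  by apply: measurable_funM => //; exact: measurable_funB.
rewrite /far (_ : [set x | _] = setT `&`
    (fun x : measurableTypeR R => h * (x - u)) @^-1` `[`|h| * del, +oo[%classic).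
  by apply: mf => //; exact: measurable_itv.
by apply/seteqP; split=> x /=; rewrite in_itv/= andbT//; case.
Qed.

Let tail lam h u del : 0 < `|h| -> 0 < del ->
  Lam (lam + h) <= Lam lam + h * u + `|h| * del / 2 ->
  \forall T \near +oo,
    \int[P]_w (\1_[set w | far h u del (v T w)] w * expR (lam * S T w)) <=
    4^-1 * moment lam T.
Proof.
move=> h0 del0; have [c cE] : exists c, c = `|h| * del by eexists.
have c0 : 0 < c by rewrite cE; exact: mulr_gt0.
rewrite -cE => hL.
have c8 : 0 < c / 8 by exact: divr_gt0.
apply: filterS3 (moment_bounds lam c8) (moment_bounds (lam + h) c8)
  (nbhs_pinfty_gt (num_real (Num.max 0 (12 / c)))) => T /andP[lo _] /andP[_ hi].
rewrite gt_max => /andP[T0 Tc].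
have mD := measurable_average T0 (mfar h u del).
have b1 := bexp (lam + h) (ltW T0).
apply: (@le_trans _ _ (expR (- (T * (h * u + c))) * moment (lam + h) T)).
  rewrite /moment -(bintZ measurableT (prob_fin P) _ b1).
  apply: (le_bint measurableT (prob_fin P)
    (bdmM (bindicP mD) (bexp lam (ltW T0))) (bdmZ _ b1)) => w _.
  rewrite indicE -expRD; case: (boolP (w \in _)) => [/set_mem|_]; last first.
    by rewrite mul0r expR_ge0.
  rewrite /far /= mul1r ler_expR (SE _ T0) -cE; move: (v T w) => x.
  rewrite -(ler_pM2l T0) (mulrCA lam T) (mulrCA (lam + h) T); lra.
apply: (le_trans (ler_wpM2l (expR_ge0 _) hi)); rewrite -expRD.
have Tc12 : 3 <= T * (c / 4).
  by move: (ltW Tc); rewrite ler_pdivrMr// mulrA; lra.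
have : expR (- (T * (c / 4))) <= 4^-1.
  rewrite expRN lef_pV2 ?posrE ?expR_gt0//.
  by apply: le_trans (expR_ge1Dx _); lra.
move=> h4; have m0 := lt_le_trans (expR_gt0 _) lo.
apply: le_trans _ (ler_wpM2r (ltW m0) h4).
apply: (le_trans _ (ler_wpM2l (expR_ge0 _) lo)); rewrite -expRD ler_expR.
have : T * Lam (lam + h) <= T * (Lam lam + h * u + c / 2) by rewrite ler_pM2l.
lra.
Qed.

Let near_mean u del : set (measurableTypeR R) := [set x | `|x - u| < del].

Let mnear u del : measurable (near_mean u del).
Proof.
have mf : measurable_fun setT (fun x : measurableTypeR R => `|x - u| : measurableTypeR R).
  by apply: measurableT_comp => //; exact: measurable_funB.
rewrite /near_mean (_ : [set x | _] = setT `&`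
    (fun x : measurableTypeR R => `|x - u|) @^-1` `]-oo, del[%classic).
  by apply: mf => //; exact: measurable_itv.
by apply/seteqP; split=> x /=; rewrite in_itv//; case.
Qed.

(* Under the law of density proportional to [expR (lam * S T)] the averages
   concentrate at the derivative of [Lam] at [lam]. *)
Let tilting (lam u del zeta : R) : is_derive lam 1 Lam u -> 0 < del -> 0 < zeta ->
  \forall T \near +oo,
    ((expR (- (T * (lam * u - Lam lam + `|lam| * del + zeta))))%:E <=
     P [set w | near_mean u del (v T w)])%E.
Proof.
move=> dLam del0 zeta0.
have [r r0 hr] : exists2 r, 0 < r & forall h, 0 < `|h| < r ->
    Lam (lam + h) <= Lam lam + h * u + `|h| * del / 2.
  have [dl ul] := dLam.
  have /cvgrPdist_le /(_ (del / 2)) cu :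
    h^-1 *: ((Lam \o shift lam) h%:A - Lam lam) @[h --> 0^'] --> u by rewrite -ul; exact: dl.
  have /nbhs_ballP[r /= r0 hr] := cu (divr_gt0 del0 (ltr0n _ 2)).
  exists r => // h /andP[h0 hltr]; have hn0 : h != 0 by rewrite -normr_gt0.
  have := hr h; rewrite /ball/= sub0r normrN => /(_ hltr hn0).
  rewrite /shift /= /GRing.scale /= mulr1 [h + lam]addrC.
  move: (Lam (lam + h) - Lam lam) (subrK (Lam lam) (Lam (lam + h))) => D <- hD.
  rewrite addrC -addrA lerD2l.
  have -> : D = h * u + h * (h^-1 * D - u) by field.
  rewrite lerD2l (le_trans (ler_norm _))// normrM -mulrA ler_wpM2l// distrC.
  exact: hD.
have z2 : 0 < zeta / 2 by exact: divr_gt0.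
have r2 : `|r / 2| = r / 2 by rewrite gtr0_norm// divr_gt0.
have r2r : r / 2 < r by rewrite ltr_pdivrMr// ltr_pMr// ltr1n.
have t1 := @tail lam (r / 2) u del; rewrite r2 in t1.
have t2 := @tail lam (- (r / 2)) u del; rewrite normrN r2 in t2.
have hr1 := hr (r / 2); rewrite r2 in hr1.
have hr2 := hr (- (r / 2)); rewrite normrN r2 in hr2.
have rr : 0 < r / 2 < r by rewrite divr_gt0.
have r20 : 0 < r / 2 by rewrite divr_gt0.
move: t1 t2 => /(_ r20 del0 (hr1 rr)) t1 /(_ r20 del0 (hr2 rr)) t2.
near=> T.
have T0 : 0 < T by near: T; apply: nbhs_pinfty_gt; exact: num_real.
have mN := measurable_average T0 (mnear u del).
have h1 : \int[P]_w (\1_[set w | far (r / 2) u del (v T w)] w * expR (lam * S T w)) <=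
    4^-1 * moment lam T by near: T.
have h2 : \int[P]_w (\1_[set w | far (- (r / 2)) u del (v T w)] w * expR (lam * S T w)) <=
    4^-1 * moment lam T by near: T.
have [lo _] : expR (T * (Lam lam - zeta / 2)) <= moment lam T /\
    moment lam T <= expR (T * (Lam lam + zeta / 2)).
  by apply/andP; near: T; exact: moment_bounds.
have Tz : 2 <= T * (zeta / 2).
  by rewrite mulrC -ler_pdivrMl//; near: T; apply: nbhs_pinfty_ge; exact: num_real.
have be := bexp lam (ltW T0).
have m1 := measurable_average T0 (mfar (r / 2) u del).
have m2 := measurable_average T0 (mfar (- (r / 2)) u del).
(* The moment splits over the neighbourhood of [u] and the two tails. The tails carry at most half
   of it, so the neighbourhood carries the other half, and there the density is at most the
   displayed exponential. *)
have split3 : moment lam T <= expR (T * (lam * u + `|lam| * del)) *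
    pr [set w | near_mean u del (v T w)] + 4^-1 * moment lam T + 4^-1 * moment lam T.
  apply: le_trans (lerD (lerD (lexx _) h1) h2).
  rewrite /pr -(bintZ measurableT (prob_fin P) _ (bindicP mN)).
  rewrite -(bintD measurableT (prob_fin P) (bdmZ _ (bindicP mN)) (bdmM (bindicP m1) be)).
  rewrite -(bintD measurableT (prob_fin P) (bdmD (bdmZ _ (bindicP mN)) (bdmM (bindicP m1) be))
     (bdmM (bindicP m2) be)).
  apply: (le_bint measurableT (prob_fin P) be (bdmD (bdmD (bdmZ _ (bindicP mN))
    (bdmM (bindicP m1) be)) (bdmM (bindicP m2) be))) => w _.
  have e0 := expR_ge0 (lam * S T w).
  have i0 (A : set Omega) : 0 <= \1_A w * expR (lam * S T w) by rewrite mulr_ge0.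
  have n0 (A : set Omega) : 0 <= expR (T * (lam * u + `|lam| * del)) * \1_A w.
    by rewrite mulr_ge0 ?expR_ge0.
  have [nr|] := ltP `|v T w - u| del.
    rewrite -addrA (le_trans _ (lerD (lexx _) (addr_ge0 (i0 _) (i0 _))))// addr0.
    rewrite indicE mem_set// mulr1 ler_expR (SE _ T0) mulrCA ler_pM2l//.
    rewrite -lerBlDl -mulrBr (le_trans (ler_norm _))// normrM.
    by rewrite ler_wpM2l// ltW.
  rewrite ler_normr => /orP[hi|hi].
    rewrite -[leLHS]add0r -[leLHS]addr0; apply: lerD (i0 _); apply: lerD (n0 _) _.
    by rewrite indicE mem_set ?mul1r//= /far /= r2 ler_pM2l.
  rewrite -[leLHS]add0r; apply: lerD; first by rewrite addr_ge0.
  rewrite indicE mem_set ?mul1r//= /far /= normrN r2 mulNr -mulrN ler_pM2l//.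
rewrite (prE mN) lee_fin.
move: (moment lam T) (pr _) split3 lo => m a split3 lo.
have E0 := expR_gt0 (T * (lam * u + `|lam| * del)).
rewrite -(ler_pM2l E0) -expRD.
have h3 : 2^-1 * m <= expR (T * (lam * u + `|lam| * del)) * a.
  by move: split3; move: (expR _ * a) => b; lra.
apply: le_trans h3.
have h4 : expR (- (T * (zeta / 2))) <= 2^-1.
  rewrite expRN lef_pV2 ?posrE ?expR_gt0//.
  by apply: le_trans (expR_ge1Dx _); lra.
apply: (le_trans _ (ler_pM _ _ h4 lo)); rewrite ?expR_ge0// -expRD ler_expR; lra.
Unshelve. all: by end_near.
Qed.


Let Lam0 : Lam 0 = 0.
Proof.
apply: (cvg_unique (F := T^-1 * ln (moment 0 T) @[T --> +oo]) _ (@cvg_moment 0)) => //.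
rewrite (_ : (fun T => _) = fun=> 0); first exact: cvg_cst.
apply/funext => T; rewrite /moment; under eq_Rintegral do rewrite mul0r expR0.
by rewrite pint_cst ln1 mulr0.
Qed.

Hypothesis dLam : forall lam, derivable Lam lam 1.

(* The penalty [eps / 2 * lam ^+ 2] makes the supremum defining [J u] attained,
   at the cost of moving [u] by at most [r]. *)
Let near_exposed (u j r : R) : J u = j%:E -> 0 < r ->
  exists lam u' : R, [/\ is_derive lam 1 Lam u', `|u' - u| < r & lam * u' - Lam lam <= j].
Proof.
move=> Ju r0.
have supJ lam : lam * u - Lam lam <= j.
  by rewrite -lee_fin -Ju; apply: ereal_sup_ubound; exists lam.
have j0 : 0 <= j by have := supJ 0; rewrite mul0r Lam0 subrr.
(* At the maximizer [c] the penalty [eps / 2 * c ^+ 2] is at most [j], and stationarity moves [u] by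
   [eps * c], whose square is at most [2 * eps * j], below [r ^+ 2]. *)
pose eps := r ^+ 2 / (4 * (j + 1)).
have j1 : 0 < 4 * (j + 1) by rewrite mulr_gt0// ltr_wpDl.
have eps0 : 0 < eps by rewrite divr_gt0// exprn_gt0.
(* At distance [m] or more from 0 the penalty exceeds [j], so the maximum over [[- m, m]] is
   interior and the derivative vanishes there. *)
pose m := 2 * (j + 1) / eps + 1.
have m1 : 1 <= m by rewrite lerDr divr_ge0 ?ltW// mulr_gt0// ltr_wpDl.
have em : j < eps / 2 * m.
  have -> : eps / 2 * m = j + 1 + eps / 2 by rewrite /m; field; exact: lt0r_neq0.
  by lra.
pose f lam := lam * u - Lam lam - eps / 2 * lam ^+ 2.
have halfK (a b : R) : a / 2 * (2 * b) = a * b by field.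
have df (c : R) : is_derive c 1 f (u - 'D_1 Lam c - eps * c).
  have dl : is_derive c 1 Lam ('D_1 Lam c) by exact: DeriveDef.
  have -> : f = (@id R) * cst u - Lam - cst (eps / 2) * (@id R) ^+ 2.
    by apply/funext => x; rewrite /f /=.
  apply: is_derive_eq.
  rewrite /= /cst /GRing.scale /= !mulr0 !mulr1 expr1 add0r addr0.
  by rewrite halfK.
have [c cm maxc] : exists2 c, c \in `[- m, m] & forall t, t \in `[- m, m] -> f t <= f c.
  apply: EVT_max; first by lra.
  apply: derivable_within_continuous => c _.
  by have [] := df c.
have fc0 : 0 <= f c.
  have <- : f 0 = 0 by rewrite /f Lam0; ring.
  by apply: maxc; rewrite in_itv/=; lra.
have c2 : eps / 2 * c ^+ 2 <= j by have := supJ c; move: fc0; rewrite /f; lra.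
have cm' : c \in `]- m, m[.
  rewrite in_itv/= -ltr_norml ltNge; apply/negP => mc.
  have : eps / 2 * m <= j.
    apply: le_trans c2; apply: ler_wpM2l; first by rewrite divr_ge0 ?(ltW eps0).
    rewrite -[c ^+ 2]real_normK ?num_real// expr2 (le_trans mc)// ler_peMl//.
    exact: le_trans mc.
  by rewrite leNgt em.
have d0 : is_derive c 1 f 0.
  apply: derive1_at_max cm' _; first by lra.
    by move=> t _; have [] := df t.
  by move=> t tm; apply: maxc; exact: subset_itv_oo_cc.
have dE : 'D_1 Lam c = u - eps * c.
  have := @derive_val _ _ _ _ _ _ _ (df c); rewrite derive_val; lra.
exists c, (u - eps * c); split.
- by rewrite -dE; exact: DeriveDef.
- rewrite addrAC subrr add0r normrN -ltr_sqr ?nnegrE ?(ltW r0)//.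
  rewrite real_normK ?num_real// exprMn.
  have -> : eps ^+ 2 * c ^+ 2 = 2 * eps * (eps / 2 * c ^+ 2) by field.
  apply: (@le_lt_trans _ _ (2 * eps * j)); first by rewrite ler_wpM2l// mulr_ge0// ltW.
  rewrite /eps mulrA mulrAC ltr_pdivrMr// -mulrA mulrCA ltr_pM2l ?exprn_gt0//.
  lra.
- have := supJ c; have : 0 <= eps * c ^+ 2 by rewrite mulr_ge0 ?sqr_ge0 ?(ltW eps0).
  rewrite mulrBr (mulrCA c eps) -expr2; lra.
Qed.

Lemma large_deviations_lower (U : set R) : open U ->
  (- ereal_inf [set J u | u in U] <=
   limf_einf (fun T : R => (T^-1)%:E * lne (P [set w | U (T^-1 * S T w)%R])) +oo%R)%E.
Proof.
move=> oU; rewrite leeNl; apply: le_ereal_inf_tmp => _ [u Uu <-]; rewrite leeNl.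
set L := limf_einf _ _.
have J0 : (0 <= J u)%E.
  by apply: ereal_sup_ubound; exists 0 => //; rewrite mul0r Lam0 subrr.
case Ju : (J u) => [j||]; last 2 first.
- exact: leNye.
- by move: J0; rewrite Ju.
apply/lee_addgt0Pr => zeta zeta0.
suff : ((- (j + zeta))%:E <= L)%E.
  move=> h; apply: le_trans (leeD2r zeta%:E h).
  by rewrite -EFinD -EFinN lee_fin; lra.
have /nbhs_ballP[r /= r0 rU] : nbhs u U by exact: open_nbhs_nbhs.
have r2 : 0 < r / 2 by exact: divr_gt0.
have [lam [u' [dl u'u lj]]] := near_exposed Ju r2.
(* The first bound keeps the neighbourhood of [u'] inside the ball of radius [r] around [u]; the
   second makes the cost [|lam| * del] of tilting at most [zeta / 2]. *)
pose del := Num.min (r / 2) (zeta / 2 / (`|lam| + 1)).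
have l1 : 0 < `|lam| + 1 by rewrite ltr_wpDl.
have z2 : 0 < zeta / 2 by exact: divr_gt0.
have del0 : 0 < del by rewrite lt_min r2 divr_gt0.
have ldel : `|lam| * del <= zeta / 2.
  apply: (@le_trans _ _ ((`|lam| + 1) * del)).
    by apply: ler_wpM2r; [exact: ltW|rewrite lerDl].
  by rewrite mulrC -ler_pdivlMr// ge_min lexx orbT.
apply: limf_einf_ge.
apply: filterS2 (tilting dl del0 z2) (nbhs_pinfty_gt (num_real 0)) => T h T0.
have mU : measurable (U : set (measurableTypeR R)) by exact: open_measurable.
have hU : ((expR (- (T * (j + zeta))))%:E <= P [set w | U (v T w)])%E.
  apply: (@le_trans _ _ (P [set w | near_mean u' del (v T w)])).
    apply: le_trans h; rewrite lee_fin ler_expR lerN2 ler_pM2l//; lra.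
  apply: le_measure; rewrite ?inE; [exact: measurable_average (mnear _ _)|exact: measurable_average|].
  move=> w /= hw; apply: rU; rewrite /ball/=.
  have -> : u - v T w = - (u' - u) + (u' - v T w) by ring.
  rewrite (le_lt_trans (ler_normD _ _))// normrN (splitr r) ltrD// distrC.
  by apply: lt_le_trans hw _; rewrite ge_min lexx.
have T1 : (0 <= (T^-1)%:E)%E by rewrite lee_fin invr_ge0 ltW.
apply: (@le_trans _ _ ((T^-1)%:E * lne (expR (- (T * (j + zeta))))%:E)%E).
  rewrite lne_EFin ?expR_gt0// -EFinM lee_fin expRK mulrN mulrA mulVf ?mul1r//.
  by rewrite gt_eqF.
apply: lee_wpmul2l => //; apply: lne_mono => //; rewrite lee_fin; exact: expR_ge0.
Qed.

End large_deviations.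

(** * The growth rate of a family of functionals *)

Section iterated_integrals.
Context (R : realType) d (E : measurableType d) (mu : probability E R).

Lemma bdm_cons k (f : k.+1.-tuple E -> R) B y : bdm f B ->
  bdm (fun z : k.-tuple E => f [tuple of y :: z]) B.
Proof.
apply: bdm_comp; apply: (@measurable_cons _ _ _ _ (cst y) _ id); last exact: measurable_id.
exact: measurable_cst.
Qed.

Lemma iterated_integralD k (f g : k.-tuple E -> R) B C h : bdm f B -> bdm g C ->
  iterated_integral mu (fun z => f z + h * g z) =
  iterated_integral mu f + h * iterated_integral mu g.
Proof.
elim: k f g => [//|k IH] f g bf bg /=.
have bh := bdm_iterated_mean mu bg.
rewrite -(bintZ measurableT (prob_fin mu) h bh).
rewrite -(bintD measurableT (prob_fin mu) (bdm_iterated_mean mu bf) (bdmZ h bh)).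
by apply: eq_Rintegral => y _; apply: IH; exact: bdm_cons.
Qed.

Lemma iterated_integral_cvg k (F : nat -> k.-tuple E -> R) f B :
  (forall n, bdm (F n) B) -> bdm f B -> (forall z, F n z @[n --> \oo] --> f z) ->
  iterated_integral mu (F n) @[n --> \oo] --> iterated_integral mu f.
Proof.
elim: k F f => [|k IH] F f bF bf cF /=; first exact: cF.
apply: (bint_cvg measurableT (prob_fin mu) (fun n => bdm_iterated_mean mu (bF n))).
  by have [] := bdm_iterated_mean mu bf.
by move=> y _; apply: IH => [n||z]; [exact: bdm_cons|exact: bdm_cons|exact: cF].
Qed.

End iterated_integrals.

Section differentiable_growth.
Context (R : realType) (dO dE : measure_display).
Context (Omega : measurableType dO) (E : measurableType dE).
Variables (X : R -> Omega -> E) (p : R -> R.-pker E ~> E).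
Variable Px : R.-pker E ~> Omega.
Hypothesis mfam : markov_family X p Px.
Variables (alpha : R) (alpha0 : 0 < alpha).
Variable mu : probability E R.
Hypotheses (doeblin : strong_doeblin p) (inv_mu : invariant_measure p mu).
Variables (x0 : E) (l : nat) (W : R -> l.+1.-tuple E -> R).
Hypothesis dW : differentiable_family W.

Definition mean_rate (V : l.+1.-tuple E -> R) (x : E) : R :=
  iterated_integral mu (fun z : l.-tuple E => V [tuple of x :: z]).

Lemma derivable_growth_family (Lam : R -> R) lam :
  (forall c, growth X Px alpha (mean_rate (W c)) (Lam c)) -> derivable Lam lam 1.
Proof.
move=> gLam.
have bW c : exists B, bdm (W c) B by apply/bounded_measurableP; exact: family_bounded dW c.
have [C hC] := family_quotient_bounded dW lam.
have /nbhs_ballP[del /= del0 hdel] := hC.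
pose C1 := `|C|.
have quot h z : `|h| < del -> h != 0 -> `|h^-1 * (W (lam + h) z - W lam z)| <= C1.
  move=> hh h0; rewrite normrM normfV mulrC ler_pdivrMr ?normr_gt0//.
  have := hdel h; rewrite /ball/= sub0r normrN => /(_ hh z) /le_trans; apply.
  by rewrite ler_wpM2r// ler_norm.
pose D z := derive1 (fun c : R => W c z) lam.
have cD z : h^-1 * (W (lam + h) z - W lam z) @[h --> 0^'] --> D z.
  have dz : derivable (fun c : R => W c z) lam 1 by exact: family_derivable.
  have cz : h^-1 *: (((fun c : R => W c z) \o shift lam) h%:A - W lam z) @[h --> 0^']
      --> 'D_1 (fun c : R => W c z) lam by exact: dz.
  rewrite /D derive1E (_ : (fun h : R => h^-1 * (W (lam + h) z - W lam z)) =
    (fun h : R => h^-1 *: (((fun c : R => W c z) \o shift lam) h%:A - W lam z))) //.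
  by apply/funext => h; rewrite /= /GRing.scale/= mulr1 [h + lam]addrC.
have near0 h : `|h| <= del / 2 -> `|h| < del.
  by move/le_lt_trans; apply; rewrite ltr_pdivrMr// ltr_pMr// ltr1n.
have bq h : `|h| <= del / 2 -> h != 0 ->
    bdm (fun z => h^-1 * (W (lam + h) z - W lam z)) C1.
  move=> hh h0; split; last by move=> z; apply: quot => //; exact: near0.
  have [B1 [m1 _]] := bW (lam + h); have [B2 [m2 _]] := bW lam.
  by apply: measurable_funM => //; exact: measurable_funB.
(* The difference quotient, completed by the derivative at 0 and by 0 for large [h], so that a
   single bound holds for all [h]. *)
pose V h z := if h == 0 then D z else
  if `|h| <= del / 2 then h^-1 * (W (lam + h) z - W lam z) else 0.
have d2 : 0 < del / 2 by exact: divr_gt0.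
have cV (u : nat -> R) : u n @[n --> \oo] --> 0 -> forall z, V (u n) z @[n --> \oo] --> D z.
  move=> u0 z; apply/cvgrPdist_le => e e0.
  have /cvgrPdist_le /(_ e e0) /nbhs_ballP[r /= r0 hr] := cD z.
  have m0 : 0 < Num.min r (del / 2) by rewrite lt_min r0.
  have /cvgrPdist_lt /(_ _ m0) := u0; apply: filterS => n.
  rewrite sub0r normrN lt_min => /andP[ur ud]; rewrite /V.
  have [_|un0] := eqVneq (u n) 0; first by rewrite subrr normr0 ltW.
  rewrite (ltW ud); apply: hr => //; by rewrite /ball/= sub0r normrN.
(* A sequence of nonzero increments tending to 0: along it [D] is a pointwise limit of measurable
   functions bounded by [C1], hence measurable with the same bound. *)
pose u n : R := del / 2 * harmonic n.
have u0 : u n @[n --> \oo] --> 0.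
  by rewrite -[X in _ --> X](mulr0 (del / 2)); apply: cvgM; [exact: cvg_cst|exact: cvg_harmonic].
have un0 n : u n != 0 by rewrite mulf_neq0// ?gt_eqF// invr_gt0.
have ud n : `|u n| <= del / 2.
  rewrite gtr0_norm ?mulr_gt0// ?invr_gt0// ler_piMr ?(ltW d2)//.
  by rewrite /harmonic /= invf_le1// ler1n.
have Vu n : V (u n) = fun z => (u n)^-1 * (W (lam + u n) z - W lam z).
  by apply/funext => z; rewrite /V (negPf (un0 n)) ud.
have bD : bdm D C1.
  split=> [|z].
    apply: (@measurable_fun_cvg _ _ _ _ (fun n => V (u n))) => [n|z _].
      by rewrite Vu; have [] := bq _ (ud n) (un0 n).
    exact: cV.
  apply/ler_addgt0Pr => e e0.
  have /cvgrPdist_le /(_ e e0) [n _ /(_ n (leqnn n))] := cV u u0 z.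
  move=> hn; rewrite [leRHS]addrC; apply: (norm_le_dist hn).
  by rewrite Vu; have [_] := bq _ (ud n) (un0 n).
have bV h : bdm (V h) C1.
  have [->|h0] := eqVneq h 0.
    by rewrite (_ : V 0 = D)//; apply/funext => z; rewrite /V eqxx.
  have [hh|hh] := boolP (`|h| <= del / 2).
    rewrite (_ : V h = fun z => h^-1 * (W (lam + h) z - W lam z)); first exact: bq.
    by apply/funext => z; rewrite /V (negPf h0) hh.
  rewrite (_ : V h = cst 0); last by apply/funext => z; rewrite /V (negPf h0) (negPf hh).
  by split=> [|z]; [exact: measurable_cst|rewrite normr0 normr_ge0].
apply: (@derivable_growth _ _ _ _ _ _ _ _ mfam _ alpha0 _ doeblin inv_mu x0
  (fun c => mean_rate (W c)) Lam lam (del / 2) C1 (fun h => mean_rate (V h))) => //.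
- exact: normr_ge0.
- by move=> h; exact: bdm_iterated_mean.
- by move=> c; have [B b] := bW c; exists B; exact: bdm_iterated_mean.
- move=> h hh; apply/funext => x; rewrite /mean_rate.
  have [B b] := bW lam.
  rewrite -(iterated_integralD mu h (bdm_cons x b) (bdm_cons x (bV h))).
  congr (iterated_integral mu _); apply/funext => z; rewrite /V.
  have [->|h0] := eqVneq h 0; first by rewrite addr0 mul0r addr0.
  by rewrite hh mulrA mulfV// mul1r [RHS]addrC subrK.
- move=> s s0 x; apply: (iterated_integral_cvg (B := C1)).
  + by move=> n; exact: bdm_cons.
  + exact: bdm_cons.
  + by move=> z; rewrite [X in _ --> X](_ : _ = D [tuple of x :: z]); [exact: cV|rewrite /V eqxx].
Qed.

End differentiable_growth.

Section operator_growth.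
Context (R : realType).

Lemma cvg_log_growth (f : R -> R) (C Lam : R) : 0 < C ->
  (forall t, 0 <= t -> C^-1 * expR (Lam * t) <= f t <= C * expR (Lam * t)) ->
  t^-1 * ln (f t) @[t --> +oo] --> Lam.
Proof.
move=> C0 hf; apply/cvgrPdist_le => e e0.
near=> t.
have t0 : 0 < t by near: t; apply: nbhs_pinfty_gt; exact: num_real.
have h2 : `|ln C| <= e * t.
  by rewrite mulrC -ler_pdivrMr//; near: t; apply: nbhs_pinfty_ge; exact: num_real.
have -> : Lam - t^-1 * ln (f t) = t^-1 * (Lam * t - ln (f t)).
  by rewrite mulrBr mulrCA mulVf ?mulr1// gt_eqF.
rewrite normrM gtr0_norm ?invr_gt0// mulrC ler_pdivrMr// (le_trans _ h2)// distrC.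
exact: ln_growth_dist C0 (hf t (ltW t0)).
Unshelve. all: by end_near.
Qed.

Context (dO dE : measure_display).
Context (Omega : measurableType dO) (E : measurableType dE).
Variables (X : R -> Omega -> E) (p : R -> R.-pker E ~> E).
Variable Px : R.-pker E ~> Omega.
Hypothesis mfam : markov_family X p Px.
Variables (alpha : R) (alpha0 : 0 < alpha) (x0 : E).

Lemma sup_norm_le (f : E -> R) (B : R) : (forall x, `|f x| <= B) -> sup_norm f <= B.
Proof.
move=> fB; apply: ge_sup; first by exists `|f x0|, x0.
by move=> _ [x _ <-].
Qed.

Lemma le_sup_norm (f : E -> R) (B : R) x : (forall y, `|f y| <= B) -> `|f x| <= sup_norm f.
Proof.
move=> fB; apply: ub_le_sup; last by exists x.
by exists B => _ [y _ <-].
Qed.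

(** By positivity the image of a function bounded by 1 is dominated by the image of the constant 1,
    so the operator norm is squeezed between the two bounds in [growth]. *)
Lemma growth_operator_norm (A : R -> (E -> R) -> E -> R) g Lam : bm g ->
  (forall t f x, 0 <= t -> A t f x = fk_op X Px alpha g t f x) ->
  growth X Px alpha g Lam -> growth_rate A t @[t --> +oo] --> Lam.
Proof.
move=> [B bg] AE [C C0 hC]; apply: (cvg_log_growth C0) => t t0.
have E0 := expR_gt0 (Lam * t).
have bound f x : bounded_measurable f -> sup_norm f <= 1 ->
    `|A t f x| <= C * expR (Lam * t).
  move=> /bounded_measurableP[D bf] f1.
  have fle y : `|f y| <= 1 by apply: le_trans f1; apply: (@le_sup_norm _ D); case: bf.
  have bf1 : bdm f 1 by split=> //; case: bf.
  rewrite AE//; have /andP[_ h] := hC t x t0; apply: le_trans h.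
  apply: (bint_normW measurableT (prob_fin (law Px x))
    (bdm_fk mfam alpha 0 t0 bg bf1) (bdm_fk mfam alpha 0 t0 bg bdm1)) => w _.
  by rewrite /fk normrM ger0_norm ?expR_ge0// ler_wpM2l ?expR_ge0.
have ub : ubound [set sup_norm (A t f) | f in
    [set f | bounded_measurable f /\ sup_norm f <= 1]] (C * expR (Lam * t)).
  by move=> _ [f [bf f1] <-]; apply: sup_norm_le => x; exact: bound.
have one1 : sup_norm (fun _ : E => 1 : R) <= 1.
  by apply: sup_norm_le => x; rewrite normr1.
have bone1 : bounded_measurable (fun _ : E => 1 : R).
  by apply/bounded_measurableP; exists 1; exact: bdm1.
apply/andP; split; last first.
  apply: ge_sup => //.
  by exists (sup_norm (A t (fun _ => 1))), (fun _ => 1).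
apply: (@le_trans _ _ (sup_norm (A t (fun _ => 1)))); last first.
  by apply: ub_le_sup; [exists (C * expR (Lam * t))|exists (fun _ => 1)].
apply: (@le_trans _ _ `|A t (fun _ => 1) x0|).
  have /andP[h _] := hC t x0 t0.
  by rewrite AE// (le_trans h)// ler_norm.
by apply: le_sup_norm => y; exact: bound.
Qed.

End operator_growth.

(* Only nonnegative times are constrained by the hypotheses; clamping the time
   gives a jointly measurable process over all of [R]. *)
Definition clamp (R : realType) (A : Type) (f : R -> A) (t : R) : A := f (Num.max 0 t).

Lemma clampE (R : realType) (A : Type) (f : R -> A) t : 0 <= t -> clamp f t = f t.
Proof. by move=> t0; rewrite /clamp max_r. Qed.

Section clamped_process.
Context (R : realType) (dO dE : measure_display).
Context (Omega : measurableType dO) (E : measurableType dE).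
Variables (X : R -> Omega -> E) (p : R -> R.-pker E ~> E).

Lemma markov_property_clamp (Q : {measure set Omega -> \bar R}) :
  markov_property X p Q -> markov_property (clamp X) p Q.
Proof.
move=> QM s t A B s0 t0 nA mB.
rewrite clampE ?addr_ge0// clampE//; apply: QM => //.
move: nA; rewrite /natural_filtration.
rewrite (_ : [set A | exists u B, [/\ 0 <= u, u <= s, measurable B & A = clamp X u @^-1` B]] =
  [set A | exists u B, [/\ 0 <= u, u <= s, measurable B & A = X u @^-1` B]])//.
by apply/seteqP; split=> D /= [u [F [u0 us mF ->]]]; exists u, F; split=> //;
  rewrite clampE.
Qed.

Lemma markov_family_clamp P Px : markov_process X p P Px -> markov_family (clamp X) p Px.
Proof.
move=> [mX _ sX mkX _]; split.
- have mh : measurable_fun setT (fun z : measurableTypeR R * Omega =>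
      (Num.max 0 z.1 : measurableTypeR R, z.2)).
    apply: measurable_fun_pair; last exact: measurable_snd.
    by apply: measurable_maxr => //; exact: measurable_fst.
  have mD : measurable ([set t : measurableTypeR R | 0 <= t] `*` [set: Omega]).
    apply: measurableX => //.
    by rewrite (_ : [set t | _] = `[0, +oo[%classic)//; apply/seteqP; split=> t /=; rewrite in_itv/= andbT.
  apply: (measurable_comp mD _ mX mh).
  by move=> _ [z _ <-] /=; split=> //=; rewrite le_max lexx.
- by move=> x B mB; rewrite clampE//; exact: sX.
- by move=> x; apply: markov_property_clamp; exact: mkX.
Qed.

End clamped_process.

Section clamped_scales.
Context (R : realType) (l : nat) (alpha1 : R) (q : 'I_l.+1 -> R -> R).
Hypothesis scales : time_scales alpha1 q.
Notation qp i := (clamp (q i)).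

Lemma clamp_scales_ge0 i t : 0 <= qp i t.
Proof. by apply: (scales_ge0 scales); rewrite le_max lexx. Qed.

Lemma clamp_scales_mono i s t : s <= t -> qp i s <= qp i t.
Proof.
move=> st; apply: (scales_increasing scales); first by rewrite le_max lexx.
by rewrite ge_max le_max lexx /= le_max st orbT.
Qed.

Lemma clamp_scales_first t : 0 <= t -> qp ord0 t = alpha1 * t.
Proof. by move=> t0; rewrite clampE// (scales_first scales). Qed.

Lemma clamp_scales_gap (j : 'I_l.+1) (del : R) : (0 < j)%N -> 0 < del ->
  (qp j (t + del) - qp j t) @[t --> +oo] --> +oo.
Proof.
case: (unliftP ord0 j) => [j' ->|->//] _ del0.
have := scales_gap scales j' del0; apply: cvg_trans; apply: near_eq_cvg.
apply: filterS (nbhs_pinfty_ge (num_real 0)) => t t0.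
by rewrite !clampE// addr_ge0// ltW.
Qed.

Let order_succ (j : 'I_l) (gam : R) : 0 < gam ->
  \forall t \near +oo, q (widen_ord (leqnSn l) j) t <= q (lift ord0 j) (gam * t).
Proof.
move=> gam0; have := scales_order scales j gam0; rewrite limf_einfE.
move=> /ereal_sup_gt[_ [V VF <-]] hV; apply: filterS VF => t Vt.
rewrite -subr_ge0 -lee_fin; apply/ltW/(lt_le_trans hV).
by apply: ereal_inf_lbound; exists t.
Qed.

(** Only consecutive scales are compared by hypothesis. The chain from [i] to [j] uses the factor 1
    at the lower links and [gam] at the top one. *)
Lemma clamp_scales_order (i j : 'I_l.+1) (gam : R) : (i < j)%N -> 0 < gam -> gam <= 1 ->
  \forall t \near +oo, qp i t <= qp j (gam * t).
Proof.
case: (unliftP ord0 j) => [j' ->|->//]; rewrite lift0 ltnS.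
case: j' => n nl /=; elim: n nl gam => [|n IH] nl gam ij gam0 gam1.
  have e : i = widen_ord (leqnSn l) (Ordinal nl).
    by apply: val_inj => /=; apply/eqP; rewrite -leqn0.
  rewrite e; apply: filterS2 (order_succ (Ordinal nl) gam0)
    (nbhs_pinfty_ge (num_real 0)) => t h t0.
  by rewrite !clampE// mulr_ge0// ltW.
have hs := order_succ (Ordinal nl) gam0.
have e1 : widen_ord (leqnSn l) (Ordinal nl) = lift ord0 (Ordinal (ltnW nl)).
  by apply: val_inj; rewrite /= /bump.
rewrite e1 in hs.
move: ij; rewrite leq_eqVlt => /orP[/eqP ij|ij].
  have e2 : i = lift ord0 (Ordinal (ltnW nl)) by apply: val_inj; rewrite /= ij.
  rewrite e2; apply: filterS2 hs (nbhs_pinfty_ge (num_real 0)) => t h t0.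
  by rewrite !clampE// mulr_ge0// ltW.
have hi := IH (ltnW nl) 1 ij ltr01 (lexx _).
apply: filterS3 hs hi (nbhs_pinfty_ge (num_real 0)) => t h1 h2 t0.
move: h2; rewrite mul1r => h2; apply: (le_trans h2).
by rewrite !clampE// mulr_ge0// ltW.
Qed.

End clamped_scales.

Theorem theorem2p3 (R : realType) (M : completePseudoMetricType R)
    (dO : measure_display) (Omega : measurableType dO)
    (P : probability Omega R) (X : R -> Omega -> borel M)
    (p : R -> R.-pker (borel M) ~> (borel M))
    (Px : R.-pker (borel M) ~> Omega)
    (mu : probability (borel M) R)
    (l : nat) (alpha1 : R) (q : 'I_l.+1 -> R -> R)
    (polishM : polish M)
    (markovX : markov_process X p P Px)
    (doeblin : strong_doeblin p)
    (inv_mu : invariant_measure p mu)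
    (scales : time_scales alpha1 q) :
  let r (W : l.+1.-tuple (borel M) -> R) : R :=
    spectral_radius (Rcont X Px mu alpha1 W) in
  let J (F : l.+1.-tuple (borel M) -> R) : R -> \bar R :=
    rate_function (fun lambda => r (fun z => lambda * F z)) in
  let S (F : l.+1.-tuple (borel M) -> R) : R -> Omega -> R :=
    nonconventional_integral X q F in
  [/\ (* the limit defining the spectral radius exists *)
      forall W : l.+1.-tuple (borel M) -> R, bounded_measurable W ->
        growth_rate (Rcont X Px mu alpha1 W) t @[t --> +oo] --> ln (r W),
      forall W : R -> l.+1.-tuple (borel M) -> R, differentiable_family W ->
        exists Q : R -> R,
          [/\ forall (lambda : R) (x : borel M),
                T^-1 * ln (Ex Px x (fun w =>
                  expR (nonconventional_integral X q (W lambda) T w)))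
                  @[T --> +oo] --> Q lambda,
              forall lambda : R, derivable Q lambda 1 &
              forall lambda : R, Q lambda = ln (r (W lambda))] &
      forall F : l.+1.-tuple (borel M) -> R, bounded_measurable F ->
        (forall K : set R, closed K ->
          (limf_esup (fun T : R =>
             (T^-1)%:E * lne (P [set w | K (T^-1 * S F T w)%R])) +oo%R
           <= - ereal_inf [set J F u | u in K])%E) /\
        (forall U : set R, open U ->
          (- ereal_inf [set J F u | u in U]
           <= limf_einf (fun T : R =>
             (T^-1)%:E * lne (P [set w | U (T^-1 * S F T w)%R])) +oo%R)%E)].
Proof.
move=> r J S.
have [w0 _] : exists w0 : Omega, True.
  apply: contrapT => noO; have := @probability_setT _ _ _ P.
  rewrite (_ : setT = set0) ?measure0; first by move/eqP; rewrite eq_sym onee_eq0.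
  by apply/seteqP; split=> // w _; exfalso; apply: noO; exists w.
pose x0 : borel M := X 0 w0.
have mfam := markov_family_clamp markovX.
pose Xc := clamp X; pose qc (i : 'I_l.+1) := clamp (q i).
have alpha0 := scales_alpha1 scales.
have integralE W T w : nonconventional_integral X q W T w =
    tint T (fun t => rate Xc qc W (t, w)).
  apply: eq_tint => t /andP[t0 _]; congr W; apply: eq_from_tnth => i.
  by rewrite !tnth_mktuple /= /Xc /qc !clampE// (scales_ge0 scales).
have operatorE (W : l.+1.-tuple (borel M) -> R) t f x : 0 <= t ->
    Rcont X Px mu alpha1 W t f x = fk_op Xc Px alpha1 (mean_rate mu W) t f x.
  move=> t0; apply: eq_Rintegral => w _; rewrite mulrC /fk add0r.
  have -> : Xc (alpha1 * t) w = X (alpha1 * t) w by rewrite /Xc clampE// mulr_ge0// ltW.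
  have -> : hatW X mu alpha1 W t w = expR (additive Xc alpha1 (mean_rate mu W) 0 t w).
    apply: (f_equal expR); apply: eq_tint => s /andP[s0 _].
    by rewrite /mean_rate /Xc add0r clampE// mulr_ge0// ltW.
  by [].
have growthP W : bounded_measurable W -> growth Xc Px alpha1 (mean_rate mu W) (ln (r W)) /\
    growth_rate (Rcont X Px mu alpha1 W) t @[t --> +oo] --> ln (r W).
  move=> /bounded_measurableP[B bW].
  have bm_rate : bm (mean_rate mu W) by exists B; exact: bdm_iterated_mean.
  have [Lam gLam] := growth_total mfam alpha0 doeblin inv_mu x0 bm_rate.
  have c := growth_operator_norm mfam x0 bm_rate (operatorE W) gLam.
  have -> : ln (r W) = Lam by rewrite /r /spectral_radius expRK; exact: cvg_lim c.
  by split.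
(* Stated for a general Markov law: it is used with [law Px x] for the limit at each starting point
   and with [P] for the large deviations. *)
have momentE W (Q : probability Omega R) : bounded_measurable W -> markov_property X p Q ->
    T^-1 * ln (\int[Q]_w expR (nonconventional_integral X q W T w)) @[T --> +oo] --> ln (r W).
  move=> bW QM; have [g _] := growthP W bW; have /bounded_measurableP[B b] := bW.
  have := nonconventional_growth mfam doeblin inv_mu (markov_property_clamp QM)
    (clamp_scales_ge0 scales) (clamp_scales_mono scales) (clamp_scales_order scales)
    (clamp_scales_gap scales) alpha0 (clamp_scales_first scales) b g.
  apply: cvg_trans; apply: near_eq_cvg; apply: nearW => T.
  apply: (f_equal (fun a => T^-1 * ln a)).
  by apply: eq_Rintegral => w _; rewrite integralE.
have derivableP W lam : differentiable_family W ->
    derivable (fun lambda => ln (r (W lambda))) lam 1.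
  move=> dW; apply: (derivable_growth_family mfam alpha0 doeblin inv_mu x0 dW) => c.
  by have [] := growthP (W c) (family_bounded dW c).
split.
- by move=> W bW; have [] := growthP W bW.
- move=> W dW; exists (fun lambda => ln (r (W lambda))); split=> //.
    move=> lambda x.
    exact: (momentE (W lambda) (law Px x) (family_bounded dW _) (process_markov_from markovX x)).
  by move=> lambda; exact: derivableP.
move=> F bF; have /bounded_measurableP[B b] := bF.
have dF : differentiable_family (fun lambda z => lambda * F z).
  have dlin (lam : R) z : is_derive lam 1 (fun c : R => c * F z) (F z).
    have -> : (fun c : R => c * F z) = (@id R) * cst (F z) by [].
    by apply: is_derive_eq; rewrite /= /GRing.scale /= mulr0 mulr1 add0r.
  split=> [lam|lam z|lam|lam].
  - by apply/bounded_measurableP; exists (`|lam| * B); exact: bdmZ.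
  - by have [] := dlin lam z.
  - rewrite (_ : (fun z => _) = F); first by have [] := bF.
    apply/funext => z; rewrite derive1E; have dz := dlin lam z; exact: derive_val.
  - exists B; apply: (@filterE _ (nbhs (0 : R))) => h z; rewrite -mulrBl addrAC subrr add0r normrM mulrC.
    by rewrite ler_wpM2r//; case: b.
have bS T : 0 <= T -> bdm (S F T) (B * T).
  move=> T0; rewrite (_ : S F T = fun w => tint T (fun t => rate Xc qc F (t, w))).
    exact: (bdm_tint T0 (bdm_rate_tuple mfam (clamp_scales_mono scales) b)).
  by apply/funext => w; exact: integralE.
have mom lam : T^-1 * ln (moment P (S F) lam T) @[T --> +oo] --> ln (r (fun z => lam * F z)).
  have := momentE _ P (family_bounded dF lam) (process_markov markovX).
  apply: cvg_trans; apply: near_eq_cvg; apply: nearW => T.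
  apply: (f_equal (fun a => T^-1 * ln a)).
  apply: eq_Rintegral => w _; apply: (f_equal expR); rewrite integralE /S integralE.
  have bF' := bdm_rate_tuple mfam (clamp_scales_mono scales) b.
  exact: (tintZ lam T (bdm_pair2 w bF')).
split=> [K cK|U oU].
- exact: (large_deviations_upper bS mom cK).
- by apply: (large_deviations_lower bS mom _ oU) => lam; exact: (derivableP _ _ dF).
Qed.
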